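(* Let $a_1,\ldots,a_n\in C^\infty(\mathbb{T}^n)$ be real-valued, let $X_j=\partial_{t_j}+a_j(t)\partial_x$ for $j\in\{1,\ldots,n\}$ on $\mathbb{T}^{n+1}=\mathbb{T}^n_t\times\mathbb{T}_x$, and let $P=\sum_{j=1}^nX_j^2$. For each $j$ put $a_{j0}(t)=\frac1{2\pi}\int_0^{2\pi}a_j(t_1,\ldots,t_{j-1},\lambda,t_{j+1},\ldots,t_n)\,d\lambda$, $t\in\mathbb{T}^n$, and let $\mathcal{X}_0$ be the system of constant-coefficient real vector fields on $\mathbb{T}^{n+1}$ $$\mathcal{X}_0=\{\partial_{t_j}+a_{j0}(t)\partial_x:\ j\in\{1,\ldots,n\},\ t\in\mathbb{T}^n\}.$$ Then $P$ is globally hypoelliptic in $\mathbb{T}^{n+1}$ if and only if $\mathcal{X}_0$ is globally hypoelliptic in $\mathbb{T}^{n+1}$ or there exists a point $t\in\mathbb{T}^n$ of finite type for $X_1,\ldots,X_n$.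
   Context: $\mathbb{T}=\mathbb{R}/2\pi\mathbb{Z}$. In the definition of $\mathcal{X}_0$, the point $t$ in $a_{j0}(t)$ is a parameter: for each fixed $j$ and each fixed $t\in\mathbb{T}^n$ one gets one vector field with constant coefficients. A system (set) $\mathcal{S}$ of linear partial differential operators on $\mathbb{T}^N$ is globally hypoelliptic in $\mathbb{T}^N$ if $u\in\mathcal{D}'(\mathbb{T}^N)$ and $Qu\in C^\infty(\mathbb{T}^N)$ for every $Q\in\mathcal{S}$ imply $u\in C^\infty(\mathbb{T}^N)$; a single operator $P$ is globally hypoelliptic if $\{P\}$ is. A point $t\in\mathbb{T}^n$ is of finite type for $X_1,\ldots,X_n$ if Hörmander's condition holds there, i.e. the Lie algebra generated by $X_1,\ldots,X_n$ under iterated commutators spans the tangent space of $\mathbb{T}^{n+1}$ at $(t,x)$ (this does not depend on $x\in\mathbb{T}$). *)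

(* Defs.v *)
From HB Require Import structures.
From mathcomp Require Import all_boot all_order all_algebra.
From mathcomp Require Import all_classical all_reals all_analysis.
From mathcomp Require Import complex.
Set Implicit Arguments.
Unset Strict Implicit.
Unset Printing Implicit Defensive.
Import Order.TTheory GRing.Theory Num.Theory.
Import numFieldNormedType.Exports.
Local Open Scope classical_set_scope.
Local Open Scope ring_scope.
Local Open Scope complex_scope.

(* Functions on the torus T^N = (R / 2 pi Z)^N are represented by functions on
   R^N = 'rV[R]_N that are 2 pi-periodic in each coordinate; points of T^N are
   represented by arbitrary points of R^N. *)
Section Torus.
Variables (R : realType) (N : nat).
Implicit Types (x v : 'rV[R]_N) (k : 'I_N) (s : seq 'I_N).

Definition periodic (T : Type) (f : 'rV[R]_N -> T) : Prop :=
  forall x k, f (x + (2 * pi) *: delta_mx 0 k) = f x.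

Definition partial k (f : 'rV[R]_N -> R) : 'rV[R]_N -> R :=
  fun x => 'D_(delta_mx 0 k) f x.

Definition partials s (f : 'rV[R]_N -> R) : 'rV[R]_N -> R := foldr partial f s.

(* 'D_v is total, so the existence of each iterated partial derivative has to be
   required explicitly. *)
Definition smooth (f : 'rV[R]_N -> R) : Prop :=
  forall s, (forall x k, derivable (partials s f) x (delta_mx 0 k)) /\
            continuous (partials s f).

Definition smooth_torus (f : 'rV[R]_N -> R) : Prop := smooth f /\ periodic f.

Definition re_fun (f : 'rV[R]_N -> R[i]) : 'rV[R]_N -> R := fun x => complex.Re (f x).
Definition im_fun (f : 'rV[R]_N -> R[i]) : 'rV[R]_N -> R := fun x => complex.Im (f x).

(* The space C^oo(T^N) of complex-valued smooth functions. *)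
Definition Csmooth_torus (f : 'rV[R]_N -> R[i]) : Prop :=
  [/\ smooth (re_fun f), smooth (im_fun f) & periodic f].

Definition Cpartial k (f : 'rV[R]_N -> R[i]) : 'rV[R]_N -> R[i] :=
  fun x => partial k (re_fun f) x +i* partial k (im_fun f) x.

Definition Cpartials s (f : 'rV[R]_N -> R[i]) : 'rV[R]_N -> R[i] :=
  foldr Cpartial f s.

Definition set_coord k (l : R) x : 'rV[R]_N :=
  \row_i (if i == k then l else x 0 i).

Definition integrate_coord k (f : 'rV[R]_N -> R) : 'rV[R]_N -> R :=
  fun x => \int[lebesgue_measure]_(l in `[0, 2 * pi]) f (set_coord k l x).

(* The iterated integral over [0, 2 pi]^N; the base point 0 is irrelevant, as
   every coordinate is integrated out. *)
Definition torus_integral (f : 'rV[R]_N -> R) : R :=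
  foldr integrate_coord f (enum 'I_N) 0.

Definition Ctorus_integral (f : 'rV[R]_N -> R[i]) : R[i] :=
  torus_integral (re_fun f) +i* torus_integral (im_fun f).

(* No structure is imposed on the domain: only the values on C^oo(T^N) are meaningful. *)
Definition functional := ('rV[R]_N -> R[i]) -> R[i].

(* D'(T^N): linear forms u on C^oo(T^N) with |u phi| <= C ||phi||_{C^m} for some
   C and m; M ranges over the upper bounds of the C^m norm of phi. *)
Definition distribution_torus (u : functional) : Prop :=
  (forall (c : R[i]) (phi psi : 'rV[R]_N -> R[i]),
     Csmooth_torus phi -> Csmooth_torus psi ->
     u (fun x => c * phi x + psi x) = c * u phi + u psi) /\
  (exists (C : R) (m : nat), forall (phi : 'rV[R]_N -> R[i]) (M : R),
     Csmooth_torus phi ->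
     (forall s x, (size s <= m)%N -> `|Cpartials s phi x| <= M%:C) ->
     `|u phi| <= (C * M)%:C).

Definition smooth_distribution (u : functional) : Prop :=
  exists2 f, Csmooth_torus f & forall phi, Csmooth_torus phi ->
    u phi = Ctorus_integral (fun x => f x * phi x).

Definition dist_partial k (u : functional) : functional :=
  fun phi => - u (Cpartial k phi).

Definition dist_mul (b : 'rV[R]_N -> R) (u : functional) : functional :=
  fun phi => u (fun x => (b x)%:C * phi x).

(* A linear partial differential operator is given by its action on
   distributions, built from dist_partial and dist_mul. *)
Definition dist_op := functional -> functional.

Definition globally_hypoelliptic (S : set dist_op) : Prop :=
  forall u, distribution_torus u ->
    (forall Q, S Q -> smooth_distribution (Q u)) -> smooth_distribution u.

(* A vector field X stands for the first-order operator
   \sum_k X_k(x) d/dx_k. *)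
Definition vector_field := 'rV[R]_N -> 'rV[R]_N.

Definition vf_op (X : vector_field) : dist_op :=
  fun u phi => \sum_(k < N) dist_mul (fun x => X x 0 k) (dist_partial k u) phi.

Definition lie_bracket (X Y : vector_field) : vector_field :=
  fun p => 'D_(X p) Y p - 'D_(Y p) X p.

Inductive lie_algebra (G : set vector_field) : vector_field -> Prop :=
| lie_gen X : G X -> lie_algebra G X
| lie_zero : lie_algebra G (fun=> 0)
| lie_add X Y : lie_algebra G X -> lie_algebra G Y ->
    lie_algebra G (fun p => X p + Y p)
| lie_scale (c : R) X : lie_algebra G X -> lie_algebra G (fun p => c *: X p)
| lie_bracketed X Y : lie_algebra G X -> lie_algebra G Y ->
    lie_algebra G (lie_bracket X Y).

Definition hormander_at (G : set vector_field) (p : 'rV[R]_N) : Prop :=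
  forall v, exists2 Z, lie_algebra G Z & Z p = v.

End Torus.

(* Points of T^n_t x T_x are pairs row_mx t x : 'rV_(n + 1), the last coordinate
   being x. *)
Section Tube.
Variables (R : realType) (n : nat).

Definition tube_field (j : 'I_n) (b : 'rV[R]_n -> R) : vector_field R (n + 1) :=
  fun p => delta_mx 0 (lshift 1 j) + b (lsubmx p) *: delta_mx 0 (rshift n ord0).

Definition sum_squares (a : 'I_n -> 'rV[R]_n -> R) : dist_op R (n + 1) :=
  fun u phi => \sum_(j < n)
    vf_op (tube_field j (a j)) (vf_op (tube_field j (a j)) u) phi.

Definition average (j : 'I_n) (b : 'rV[R]_n -> R) : 'rV[R]_n -> R :=
  fun t => (2 * pi)^-1 * integrate_coord j b t.

Definition averaged_system (a : 'I_n -> 'rV[R]_n -> R) :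
    set (dist_op R (n + 1)) :=
  [set Q | exists (j : 'I_n) (t : 'rV[R]_n),
     Q = vf_op (tube_field j (fun=> average j (a j) t))].

(* The condition does not depend on x, since the coefficients do not. *)
Definition finite_type (a : 'I_n -> 'rV[R]_n -> R) (t : 'rV[R]_n) : Prop :=
  forall x : 'rV[R]_1,
    hormander_at [set X | exists j, X = tube_field j (a j)] (row_mx t x).

End Tube.

(* Main.v *)
Require Import Defs.
From mathcomp Require Import all_boot all_order all_algebra.
From mathcomp Require Import all_classical all_reals all_analysis.
From mathcomp Require Import complex.
From mathcomp Require Import ring lra zify.
Set Implicit Arguments.
Unset Strict Implicit.
Unset Printing Implicit Defensive.
Import Order.TTheory GRing.Theory Num.Theory.
Import numFieldNormedType.Exports.
Local Open Scope classical_set_scope.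
Local Open Scope ring_scope.

(* Since the coefficients are real, everything is tested on real-valued functions and transported
   to complex distributions at the end.

   If the form [a_1 dt_1 + ... + a_n dt_n] is closed, then [a_j = c_j + d_j A] with constants [c_j],
   which are the averages [a_j0], and the shear [x -> x + A(t)] conjugates [X_j] to
   [L_j = d_j + c_j d_x].  For constant coefficients the Fourier coefficients of [sum_j L_j^2 u]
   control [|l_j|^2 |u^|], where [l_j] is the symbol of [L_j]; as [|u^|] grows at most polynomially,
   [|l_j| |u^|], the geometric mean of [|l_j|^2 |u^|] and [|u^|], decays rapidly as soon as
   [|l_j|^2 |u^|] does.  Hence [sum_j L_j^2 u] is smooth exactly when all [L_j u] are.  In this case
   no point is of finite type, as the [X_j] commute.

   Otherwise some [b = d_j a_k - d_k a_j] is not zero and [X_j, X_k] have commutator [b d_x], so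
   there are points of finite type, and [P] is globally hypoelliptic: ellipticity in [t] makes the
   Fourier coefficients of [u] decay rapidly in the frequencies of [t], with polynomial losses in
   the frequency [xi] of [x]; so the partial Fourier coefficients [u_xi] are smooth on [T^n] and
   satisfy [sum_j |(d_j + i xi a_j) u_xi|^2 = - <f_xi, u_xi>].  The commutator bounds the integral of
   [b^2 |u_xi|^2] by this energy, and an L^1 Poincare inequality for [|u_xi|^2] with weight [b^2]
   together with [|d_j |v|^2| <= 2 |v| |(d_j + i xi a_j) v|] bounds the L^2 norm of [u_xi] by it,
   uniformly in [xi <> 0].  As [f] is smooth, [u_xi] is rapidly decreasing in [xi]. *)

(** * Calculus on the torus *)

(** Real waves [cos (k . x + th)] replace exponentials: a derivative becomes a phase shift by pi/2.
    An explicit trigonometric approximate identity shows that a distribution is determined by its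
    values on waves ([rdist_wave_eq0]), and this settles identities that would otherwise call for
    Fubini: shear invariance, integrals of functions of [t] alone, convolutions, even the symmetry
    of second derivatives. In the non-closed case the order of the two estimates matters. The energy
    argument pairs the equation with [u_xi] itself, so [u_xi] must already be smooth; the decay in
    the frequencies of [t] therefore comes first, and its loss in [xi] is harmless while [xi] is
    fixed. Commutator and Poincare inequality both return [|u_xi|^2] on the right, but with a free
    small factor, so it is absorbed on the left. As the resulting constant does not depend on [xi],
    the decay of [f_xi] passes to [u_xi] at every order. The loss of the first estimate is repaid at
    the end by a geometric mean with this decay in [xi]. *)

Section Calculus.
Variables (R : realType) (N : nat).
Implicit Types (x y : 'rV[R]_N) (k : 'I_N) (f g : 'rV[R]_N -> R).

Local Notation e_ k := (delta_mx 0 k : 'rV[R]_N).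
Local Notation sp := (@smooth_torus R N).

(* A derivative with a uniformly quadratic remainder: this form passes through integrals over
   compact sets without dominated convergence. *)
Definition qderiv k f g :=
  exists B : R, forall x h, `|f (x + h *: e_ k) - f x - h * g x| <= B * h ^+ 2.

Definition bounded f := exists B : R, forall x, `|f x| <= B.

Lemma boundedP f : bounded f -> exists2 B : R, 0 < B & forall x, `|f x| <= B.
Proof.
move=> [B fB]; exists (`|B| + 1); first by rewrite ltr_wpDl.
by move=> x; rewrite (le_trans (fB x))// (le_trans (ler_norm B))// lerDl.
Qed.

Lemma qderivP k f g : qderiv k f g ->
  exists2 B : R, 0 < B & forall x h, `|f (x + h *: e_ k) - f x - h * g x| <= B * h ^+ 2.
Proof.
move=> [B fB]; exists (`|B| + 1); first by rewrite ltr_wpDl.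
move=> x h; rewrite (le_trans (fB x h))// ler_wpM2r ?sqr_ge0//.
by rewrite (le_trans (ler_norm B))// lerDl.
Qed.

Lemma quad_is_derive (V : normedModType R) (f : V -> R) (x v : V) (d B : R) :
  (forall h, `|f (x + h *: v) - f x - h * d| <= B * h ^+ 2) -> is_derive x v f d.
Proof.
move=> fB0; have B0 : 0 < `|B| + 1 by rewrite ltr_wpDl.
have fB h : `|f (x + h *: v) - f x - h * d| <= (`|B| + 1) * h ^+ 2.
  rewrite (le_trans (fB0 h))// ler_wpM2r ?sqr_ge0//.
  by rewrite (le_trans (ler_norm B))// lerDl.
have cv : (fun h => h^-1 *: ((f \o shift x) (h *: v) - f x)) @ 0^' --> d.
  apply/cvgrPdist_le => e e0; near=> h.
  have h0 : h != 0 by near: h; exact: nbhs_dnbhs_neq.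
  rewrite /= [h *: v + x]addrC.
  have -> : d - h^-1 *: (f (x + h *: v) - f x)
          = - (h^-1 * (f (x + h *: v) - f x - h * d)).
    by rewrite mulrBr mulrA mulVf// mul1r opprB.
  rewrite normrN normrM normfV ler_pdivrMl ?normr_gt0//.
  rewrite (le_trans (fB h))// -[h ^+ 2]real_normK ?num_real// expr2 mulrCA ler_wpM2l//.
  rewrite -ler_pdivlMl// mulrC; near: h.
  by apply: dnbhs0_le; rewrite divr_gt0.
apply: DeriveDef; first by apply/cvg_ex; exists d.
by apply: cvg_lim cv.
Unshelve. all: by end_near.
Qed.

Lemma qderiv_is_derive k f g x : qderiv k f g -> is_derive x (e_ k) f (g x).
Proof. by move=> [B fB]; apply: quad_is_derive (fB x). Qed.

Lemma qderiv_partial k f g : qderiv k f g -> partial k f = g.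
Proof. by move=> fg; apply/funext => x; have [_] := qderiv_is_derive x fg. Qed.

Lemma mvt0 (phi phi' : R -> R) : (forall x : R, is_derive x 1 phi (phi' x)) ->
  forall h, exists2 c, `|c| <= `|h| & phi h - phi 0 = h * phi' c.
Proof.
move=> d h.
have ct : continuous phi.
  by move=> x; apply/differentiable_continuous/derivable1_diffP; case: (d x).
have [h0|h0] := leP 0 h.
  have [|c] := @MVT_segment R phi phi' 0 h h0 (fun t _ => d t).
    by apply: continuous_subspaceT.
  rewrite in_itv/= => /andP[c0 ch] E; exists c; last by rewrite E subr0 mulrC.
  by rewrite !ger0_norm// (le_trans c0).
have [|c] := @MVT_segment R phi phi' h 0 (ltW h0) (fun t _ => d t).
  by apply: continuous_subspaceT.
rewrite in_itv/= => /andP[c0 ch] E; exists c.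
  by rewrite !ler0_norm ?lerN2 ?(ltW h0).
by rewrite -opprB E sub0r mulrN opprK mulrC.
Qed.

(** One application of the mean value theorem against a Lipschitz bound on the derivative; this is
    why the constant is [B] and not [B / 2]. *)
Lemma taylor2 (phi phi' : R -> R) B : (forall x : R, is_derive x 1 phi (phi' x)) ->
  (forall x : R, `|phi' x - phi' 0| <= B * `|x|) ->
  forall h, `|phi h - phi 0 - h * phi' 0| <= B * h ^+ 2.
Proof.
move=> d b h; have [c ch ->] := mvt0 d h.
rewrite -mulrBr normrM -[h ^+ 2]real_normK ?num_real// expr2.
rewrite mulrCA ler_wpM2l// (le_trans (b c))//.
have [B0|B0] := leP 0 B; first by rewrite ler_wpM2l.
have := b 1; rewrite normr1 mulr1 => /(le_trans (normr_ge0 _)).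
by rewrite leNgt B0.
Qed.

Lemma is_derive_line f x v g (t : R) :
  (forall y, is_derive y v f (g y)) ->
  is_derive t 1 (fun h : R => f (x + h *: v)) (g (x + t *: v)).
Proof.
move=> d.
have E : (fun h => h^-1 *: (((fun h : R => f (x + h *: v)) \o shift t) (h *: (1 : R)) -
            f (x + t *: v))) =
         (fun h => h^-1 *: ((f \o shift (x + t *: v)) (h *: v) - f (x + t *: v))).
  by apply/funext => h /=; rewrite /shift/= scalerDl [h *: 1]mulr1 addrCA.
have [D <-] := d (x + t *: v).
by apply: DeriveDef; rewrite /derivable /derive E.
Qed.

(** A general increment is followed along axis-parallel segments. [E] is left arbitrary because it
    is later a Lipschitz bound, a constant, zero, or a multiple of [1 - cos h] plus a constant. *)
Lemma telescope_coord (E : 'I_N -> R -> R) f (s : seq 'I_N) (d : 'I_N -> R) x :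
  (forall k x h, `|f (x + h *: e_ k) - f x| <= E k h) ->
  `|f (x + \sum_(k <- s) d k *: e_ k) - f x| <= \sum_(k <- s) E k (d k).
Proof.
move=> b; elim: s => [|k s IH]; first by rewrite !big_nil addr0 subrr normr0.
rewrite !big_cons addrA addrAC.
set y := x + _ in IH *.
rewrite -(subrKA (f y)) (le_trans (ler_normD _ _))// lerD//.
Qed.

Lemma rV_sum_delta x : x = \sum_k x 0 k *: e_ k.
Proof. by rewrite {1}[x]row_sum_delta. Qed.

Lemma coord_bound (E : 'I_N -> R -> R) f x y :
  (forall k x h, `|f (x + h *: e_ k) - f x| <= E k h) ->
  `|f (x + y) - f x| <= \sum_k E k (y 0 k).
Proof.
move=> b; rewrite {1}[y]rV_sum_delta.
exact: (@telescope_coord E f (index_enum _) (fun k => y 0 k) x b).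
Qed.

Lemma coord_lip_continuous (B : 'I_N -> R) f :
  (forall k x h, `|f (x + h *: e_ k) - f x| <= B k * `|h|) -> continuous f.
Proof.
move=> b x; apply/(@cvgrPdist_le _ _ _ (nbhs x)) => e e0.
have B0 k : 0 <= B k.
  by have := le_trans (normr_ge0 _) (b k 0 1); rewrite normr1 mulr1.
pose S := \sum_k B k; have S0 : 0 <= S by apply: sumr_ge0.
apply/nbhs_ballP; exists (e / (S + 1)); first by rewrite /= divr_gt0// ltr_wpDl.
move=> y; rewrite -ball_normE /= distrC => /ltW yx.
rewrite distrC -{1}(subrK x y) [y - x + x]addrC.
rewrite (le_trans (coord_bound x (y - x) b))//.
apply: (@le_trans _ _ (\sum_k B k * (e / (S + 1)))).
  apply: ler_sum => k _; rewrite ler_wpM2l// (le_trans _ yx)//.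
  by rewrite [leRHS]/Num.Def.normr/= mx_normrE; apply: (le_bigmax _ _ (0, k)).
rewrite -mulr_suml -/S mulrA ler_pdivrMr ?ltr_wpDl// mulrC ler_pM2l// lerDl//.
Qed.

(** The quadratic remainder is at most linear only for [|h| <= 1]; beyond that, boundedness of [f]
    takes over. *)
Lemma qderiv_lip k f g : qderiv k f g -> bounded f -> bounded g ->
  exists2 B : R, 0 < B & forall x h, `|f (x + h *: e_ k) - f x| <= B * `|h|.
Proof.
move=> /qderivP[B B0 fB] /boundedP[C C0 fC] /boundedP[D D0 gD].
exists (B + D + C + C); first by rewrite !addr_gt0.
move=> x h; have [h1|h1] := leP `|h| 1.
  rewrite -[X in `|X|](subrK (h * g x)) (le_trans (ler_normD _ _))//.
  have h2 : h ^+ 2 <= `|h| by rewrite -real_normK ?num_real// expr2 ler_piMl.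
  have E1 := le_trans (fB x h) (ler_wpM2l (ltW B0) h2).
  have E2 : `|h * g x| <= D * `|h| by rewrite normrM mulrC ler_wpM2r.
  have E3 : 0 <= C * `|h| by rewrite mulr_ge0// ltW.
  by have := lerD E1 E2; lra.
rewrite (le_trans (ler_normB _ _))// (le_trans (lerD (fC _) (fC _)))//.
have := ler_pM (ltW C0) ler01 (lexx C) (ltW h1).
have : 0 <= B * `|h| by rewrite mulr_ge0// ltW.
have : 0 <= D * `|h| by rewrite mulr_ge0// ltW.
lra.
Qed.

Lemma qderivD k f f' g g' : qderiv k f f' -> qderiv k g g' ->
  qderiv k (fun x => f x + g x) (fun x => f' x + g' x).
Proof.
move=> [B fB] [C gC]; exists (B + C) => x h.
have -> : f (x + h *: e_ k) + g (x + h *: e_ k) - (f x + g x) - h * (f' x + g' x) =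
  (f (x + h *: e_ k) - f x - h * f' x) + (g (x + h *: e_ k) - g x - h * g' x).
  by ring.
by rewrite (le_trans (ler_normD _ _))// [leRHS]mulrDl lerD.
Qed.

Lemma qderivM k f f' g g' : bounded f -> bounded f' -> bounded g -> bounded g' ->
  qderiv k f f' -> qderiv k g g' ->
  qderiv k (fun x => f x * g x) (fun x => f' x * g x + f x * g' x).
Proof.
move=> bf bf' bg bg' qf qg.
have [Bf' Bf'0 lf'] := boundedP bf'; have [Bf Bf0 lf] := boundedP bf.
have [Bg Bg0 lg] := boundedP bg; have [L L0 gL] := qderiv_lip qg bg bg'.
have [B B0 fB] := qderivP qf; have [C C0 gC] := qderivP qg.
exists (B * Bg + Bf * C + Bf' * L) => x h.
set y := x + h *: _.
have -> : f y * g y - f x * g x - h * (f' x * g x + f x * g' x) =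
  (f y - f x - h * f' x) * g y + f x * (g y - g x - h * g' x) +
  h * f' x * (g y - g x) by ring.
rewrite (le_trans (ler_normD _ _))// [leRHS]mulrDl lerD//.
  rewrite (le_trans (ler_normD _ _))// [leRHS]mulrDl lerD// normrM.
    by rewrite mulrAC ler_pM// fB.
  by rewrite -mulrA ler_pM// gC.
rewrite !normrM -[h ^+ 2]real_normK ?num_real// expr2.
rewrite [leRHS](_ : _ = (`|h| * Bf') * (L * `|h|)); last by ring.
by rewrite ler_pM ?mulr_ge0// ?ler_wpM2l// gL.
Qed.

Lemma qderivZ k c f f' : qderiv k f f' ->
  qderiv k (fun x => c * f x) (fun x => c * f' x).
Proof.
move=> [B fB]; exists (`|c| * B) => x h.
by rewrite -mulrBr mulrCA -mulrBr normrM -mulrA ler_wpM2l.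
Qed.

Lemma qderiv_cst k c : qderiv k (fun=> c) (fun=> 0).
Proof. by exists 0 => x h; rewrite subrr mulr0 subr0 normr0 mul0r. Qed.

Lemma periodic_addz f k (z : int) x : Defs.periodic f ->
  f (x + (2 * pi * z%:~R) *: e_ k) = f x.
Proof.
move=> pf; have H (n : nat) y : f (y + (2 * pi * n%:R) *: e_ k) = f y.
  elim: n y => [|n IH] y; first by rewrite mulr0 scale0r addr0.
  by rewrite -(addn1 n) natrD mulrDr mulr1 scalerDl addrA pf IH.
case: z => n; first exact: H.
by rewrite NegzE mulrNz mulrN scaleNr -[LHS](H n.+1) subrK.
Qed.

Lemma periodic_bounded f : Defs.periodic f -> continuous f -> bounded f.
Proof.
move=> pf cf.
have tp : 0 < 2 * pi :> R by rewrite mulr_gt0// pi_gt0.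
pose A := [set v : 'rV[R]_N | forall i, [set` `[0, 2 * pi]] (v ord0 i)].
have cA : compact A.
  by apply: (@rV_compact R N (fun=> [set` `[0, 2 * pi]])) => i; exact: segment_compact.
have A0 : A !=set0.
  by exists 0 => i /=; rewrite mxE in_itv/= lexx ltW.
have cf' : {within A, continuous f} by apply: continuous_subspaceT.
have [M _ fM] := EVT_max_rV A0 cA cf'.
have [m _ fm] := EVT_min_rV A0 cA cf'.
exists (`|f M| + `|f m|) => x.
(* Removing whole periods moves [x] into the cube, where the extreme value theorem applies. *)
pose z k := Num.floor (x 0 k / (2 * pi)).
pose y := x - \sum_k (2 * pi * (z k)%:~R) *: e_ k.
have yA : y \in A.
  apply/mem_set => i /=; rewrite in_itv/= !mxE summxE (bigD1 i)//= big1 ?addr0; last first.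
    by move=> k ki; rewrite !mxE/= eq_sym (negbTE ki) mulr0.
  rewrite !mxE !eqxx mulr1 subr_ge0 lerBlDr.
  have := floor_itv (x 0 i / (2 * pi)); rewrite -/(z i) => /andP[z1 z2].
  have -> : 2 * pi + 2 * pi * (z i)%:~R = (z i + 1)%:~R * (2 * pi) :> R.
    by rewrite intrD; ring.
  by rewrite mulrC -ler_pdivlMr// z1/= -ler_pdivrMr// ltW.
have -> : f x = f y.
  rewrite /y -sumrN; elim/big_rec: _ => [|k w _ ->]; first by rewrite addr0.
  by rewrite [- _ + _]addrC addrA -scaleNr -mulrN -mulrNz periodic_addz.
have := fM y yA; have := fm y yA.
have := ler_norm (f M); have := ler_norm (- f m); rewrite normrN.
have := normr_ge0 (f M); have := normr_ge0 (f m).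
rewrite ler_norml => *; apply/andP; split; lra.
Qed.

Lemma partials_rcons s k f : partials (rcons s k) f = partials s (partial k f).
Proof. by rewrite /partials foldr_rcons. Qed.

Lemma smooth_partial k f : smooth f -> smooth (partial k f).
Proof. by move=> sf s; rewrite -partials_rcons; exact: sf. Qed.

Lemma smooth_is_derive k f : smooth f -> forall x, is_derive x (e_ k) f (partial k f x).
Proof. by move=> sf x; have [/(_ x k) d _] := sf [::]; apply: derivableP. Qed.

Lemma periodic_partial k f : Defs.periodic f -> Defs.periodic (partial k f).
Proof.
move=> pf x j; rewrite /partial /derive.
rewrite (_ : (fun h => _) = (fun h => h^-1 *: ((f \o shift x) (h *: e_ k) - f x)))//.
by apply/funext => h /=; rewrite /shift/= addrA !pf.
Qed.

Lemma sp_partial k f : sp f -> sp (partial k f).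
Proof. by move=> [sf pf]; split; [exact: smooth_partial|exact: periodic_partial]. Qed.

Lemma sp_bounded f : sp f -> bounded f.
Proof. by move=> [sf pf]; apply: periodic_bounded => //; have [] := sf [::]. Qed.

Lemma sp_taylor k f B x h : sp f ->
  (forall y, `|partial k (partial k f) y| <= B) ->
  `|f (x + h *: e_ k) - f x - h * partial k f x| <= B * h ^+ 2.
Proof.
move=> sf fB; have sf' := sp_partial k sf.
have d1 t := is_derive_line x t (smooth_is_derive k sf.1).
have d2 t := is_derive_line x t (smooth_is_derive k sf'.1).
have := @taylor2 (fun h => f (x + h *: e_ k)) _ B d1.
rewrite /= scale0r addr0; apply => t.
have [c _] := mvt0 d2 t; rewrite /= scale0r addr0 => ->.
by rewrite normrM mulrC ler_wpM2r.
Qed.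

Lemma sp_qderiv k f : sp f -> qderiv k f (partial k f).
Proof.
move=> sf; have [B _ fB] := boundedP (sp_bounded (sp_partial k (sp_partial k sf))).
by exists B => x h; exact: sp_taylor.
Qed.

Lemma sp_lip k f : sp f ->
  exists2 B : R, 0 < B & forall x h, `|f (x + h *: e_ k) - f x| <= B * `|h|.
Proof.
move=> sf; apply: qderiv_lip (sp_qderiv k sf) _ _; first exact: sp_bounded.
exact/sp_bounded/sp_partial.
Qed.

(* Smoothness by coinduction: a class of bounded periodic functions stable under
   differentiation, with uniformly quadratic remainders, consists of smooth functions. *)
Lemma sp_coind (P : ('rV[R]_N -> R) -> Prop) :
  (forall f, P f -> Defs.periodic f /\ bounded f) ->
  (forall f k, P f -> exists2 g, P g & qderiv k f g) ->
  forall f, P f -> sp f.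
Proof.
move=> Pb Pd f Pf; split; last by have [] := Pb _ Pf.
have Pp k g : P g -> P (partial k g).
  by move=> Pg; have [g' Pg' /qderiv_partial ->] := Pd g k Pg.
have Ps s : P (partials s f) by elim: s => //= k s; exact: Pp.
move=> s; split=> [x k|].
  by have [g _ /(qderiv_is_derive x)[]] := Pd _ k (Ps s).
have L k : exists B : R, forall x h,
    `|partials s f (x + h *: e_ k) - partials s f x| <= B * `|h|.
  have [g Pg q] := Pd _ k (Ps s).
  by have [B _ ?] := qderiv_lip q (Pb _ (Ps s)).2 (Pb _ Pg).2; exists B.
have [B BP] := choice L; exact: coord_lip_continuous BP.
Qed.

Lemma sp_lip_all f : sp f -> exists B : 'I_N -> R,
  forall k x h, `|f (x + h *: e_ k) - f x| <= B k * `|h|.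
Proof.
move=> sf.
have L k : exists B : R, forall x h, `|f (x + h *: e_ k) - f x| <= B * `|h|.
  by have [B _ ?] := sp_lip k sf; exists B.
by have [B BP] := choice L; exists B.
Qed.

(** Derivatives of products and of sheared functions are sums of products. Closing the generators
    under both operations gives a class to which [sp_coind] applies, while only the derivatives of
    the generators have to be computed. *)
Inductive alg (P : ('rV[R]_N -> R) -> Prop) : ('rV[R]_N -> R) -> Prop :=
| alg_gen f : P f -> alg P f
| alg_add f g : alg P f -> alg P g -> alg P (fun x => f x + g x)
| alg_mul f g : alg P f -> alg P g -> alg P (fun x => f x * g x).

Lemma boundedD f g : bounded f -> bounded g -> bounded (fun x => f x + g x).
Proof.
move=> [B fB] [C gC]; exists (B + C) => x.
by rewrite (le_trans (ler_normD _ _))// lerD.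
Qed.

Lemma boundedM f g : bounded f -> bounded g -> bounded (fun x => f x * g x).
Proof. by move=> [B fB] [C gC]; exists (B * C) => x; rewrite normrM ler_pM. Qed.

Lemma alg_sp (P : ('rV[R]_N -> R) -> Prop) :
  (forall f, P f -> Defs.periodic f /\ bounded f) ->
  (forall f k, P f -> exists2 g, alg P g & qderiv k f g) ->
  forall f, alg P f -> sp f.
Proof.
move=> Pb Pd.
have A f : alg P f -> Defs.periodic f /\ bounded f.
  elim=> [{}f /Pb//|{}f g _ [pf bf] _ [pg bg]|{}f g _ [pf bf] _ [pg bg]].
    by split; [move=> x k; rewrite pf pg|exact: boundedD].
  by split; [move=> x k; rewrite pf pg|exact: boundedM].
apply: sp_coind => // f k.
elim=> [{}f /Pd//|{}f g _ [f' Pf' qf] _ [g' Pg' qg]|].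
  by exists (fun x => f' x + g' x); [exact: alg_add|exact: qderivD].
move=> {}f g Pf [f' Pf' qf] Pg [g' Pg' qg].
exists (fun x => f' x * g x + f x * g' x).
  by apply: alg_add; apply: alg_mul.
apply: qderivM => //.
- exact: (A _ Pf).2.
- exact: (A _ Pf').2.
- exact: (A _ Pg).2.
- exact: (A _ Pg').2.
Qed.

Lemma sp_alg f : alg (sp) f -> sp f.
Proof.
apply: alg_sp => [g sg|g k sg]; first by split; [case: sg|exact: sp_bounded].
by exists (partial k g); [apply/alg_gen/sp_partial|exact: sp_qderiv].
Qed.

Lemma spD f g : sp f -> sp g -> sp (fun x => f x + g x).
Proof. by move=> sf sg; apply: sp_alg; apply: alg_add; apply: alg_gen. Qed.

Lemma spM f g : sp f -> sp g -> sp (fun x => f x * g x).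
Proof. by move=> sf sg; apply: sp_alg; apply: alg_mul; apply: alg_gen. Qed.

Lemma sp_cst (c : R) : sp (fun=> c).
Proof.
apply: (@sp_coind (fun f => exists c, f = fun=> c)); last by exists c.
  by move=> _ [d ->]; split=> //; exists `|d| => x.
by move=> _ k [d ->]; exists (fun=> 0); [exists 0|exact: qderiv_cst].
Qed.

Lemma spZ c f : sp f -> sp (fun x => c * f x).
Proof. by apply: spM; exact: sp_cst. Qed.

Lemma spN f : sp f -> sp (fun x => - f x).
Proof. by move=> /(spZ (-1)); under eq_fun do rewrite mulN1r. Qed.

Lemma spB f g : sp f -> sp g -> sp (fun x => f x - g x).
Proof. by move=> sf sg; apply: spD => //; exact: spN. Qed.

Lemma sp_sum (I : Type) (r : seq I) (P : pred I) (F : I -> 'rV[R]_N -> R) :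
  (forall i, P i -> sp (F i)) ->
  sp (fun x => \sum_(i <- r | P i) F i x).
Proof.
move=> sF; elim: r => [|i r IH].
  by rewrite (_ : (fun x => _) = fun=> 0); [exact: sp_cst|apply/funext => x; rewrite big_nil].
have [Pi|nPi] := boolP (P i).
  rewrite (_ : (fun x => _) = fun x => F i x + \sum_(j <- r | P j) F j x).
    by apply: spD => //; exact: sF.
  by apply/funext => x; rewrite big_cons Pi.
rewrite (_ : (fun x => _) = fun x => \sum_(j <- r | P j) F j x)//.
by apply/funext => x; rewrite big_cons (negbTE nPi).
Qed.

Lemma partialD k f g : sp f -> sp g ->
  partial k (fun x => f x + g x) = (fun x => partial k f x + partial k g x).
Proof. by move=> sf sg; apply/qderiv_partial/qderivD; exact: sp_qderiv. Qed.

Lemma partialZ k c f : sp f ->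
  partial k (fun x => c * f x) = (fun x => c * partial k f x).
Proof. by move=> sf; apply/qderiv_partial/qderivZ/sp_qderiv. Qed.

Lemma partialN k f : sp f ->
  partial k (fun x => - f x) = (fun x => - partial k f x).
Proof.
move=> sf; rewrite (_ : (fun x => - f x) = (fun x => -1 * f x)).
  by rewrite partialZ//; under eq_fun do rewrite mulN1r.
by under eq_fun do rewrite -mulN1r.
Qed.

Lemma partialB k f g : sp f -> sp g ->
  partial k (fun x => f x - g x) = (fun x => partial k f x - partial k g x).
Proof. by move=> sf sg; rewrite partialD ?partialN//; exact: spN. Qed.

Lemma partialM k f g : sp f -> sp g ->
  partial k (fun x => f x * g x) = (fun x => partial k f x * g x + f x * partial k g x).
Proof.
by move=> sf sg; apply/qderiv_partial/qderivM; try exact: sp_qderiv;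
  apply: sp_bounded => //; apply: sp_partial.
Qed.

Lemma partial_cst k (c : R) : partial k (fun=> c) = (fun=> 0).
Proof. exact/qderiv_partial/qderiv_cst. Qed.

Lemma sp_translate f y : sp f -> sp (fun x => f (x + y)).
Proof.
move=> sf; apply: (@sp_coind (fun g => exists2 f, sp f & g = fun x => f (x + y))).
- move=> _ [g [sg pg] ->]; split; first by move=> x k; rewrite addrAC pg.
  by have [B gB] := sp_bounded (conj sg pg); exists B.
- move=> _ k [g sg ->]; exists (fun x => partial k g (x + y)).
    by exists (partial k g) => //; exact: sp_partial.
  have [B gB] := sp_qderiv k sg; exists B => x h.
  by rewrite /= (addrAC x) gB.
by exists f.
Qed.

Lemma partial_translate k f y : sp f ->
  partial k (fun x => f (x + y)) = (fun x => partial k f (x + y)).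
Proof.
move=> sf; apply: qderiv_partial.
by have [B gB] := sp_qderiv k sf; exists B => x h; rewrite /= (addrAC x) gB.
Qed.

Lemma constant_of_qderiv0 f : (forall k, qderiv k f (fun=> 0)) -> forall x y, f x = f y.
Proof.
move=> q x y.
suff H k z h : `|f (z + h *: e_ k) - f z| <= 0.
  have := @coord_bound (fun _ _ => 0) f y (x - y) H.
  by rewrite big1// (addrC y) subrK normr_le0 subr_eq0 => /eqP.
have d t := is_derive_line z t (fun w => qderiv_is_derive w (q k)).
have [c _] := mvt0 d h; rewrite /= scale0r addr0 mulr0 => ->.
by rewrite normr0.
Qed.

End Calculus.

(** * Integration over the torus *)

Section CircleIntegral.
Variable R : realType.
Implicit Types f g : R -> R.

Definition cint f : R := \int[lebesgue_measure]_(s in `[0, 2 * pi]) f s.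

Lemma twopi_gt0 : 0 < 2 * pi :> R.
Proof. by rewrite mulr_gt0// pi_gt0. Qed.

Lemma cont_integrable f : continuous f ->
  (@lebesgue_measure R).-integrable `[0, 2 * pi] (EFin \o f).
Proof.
move=> cf; apply: continuous_compact_integrable; first exact: segment_compact.
exact: continuous_subspaceT.
Qed.

Lemma cintD f g : continuous f -> continuous g ->
  cint (fun s => f s + g s) = cint f + cint g.
Proof. by move=> cf cg; rewrite /cint RintegralD//; exact: cont_integrable. Qed.

Lemma cintZ c f : continuous f -> cint (fun s => c * f s) = c * cint f.
Proof. by move=> cf; rewrite /cint RintegralZl//; exact: cont_integrable. Qed.

Lemma cont_cst (c : R) : continuous (fun _ : R => c).
Proof. by move=> s; exact: cvg_cst. Qed.

Lemma contD f g : continuous f -> continuous g -> continuous (fun s => f s + g s).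
Proof. by move=> cf cg s; apply: continuousD; [exact: cf|exact: cg]. Qed.

Lemma contB f g : continuous f -> continuous g -> continuous (fun s => f s - g s).
Proof. by move=> cf cg s; apply: continuousB; [exact: cf|exact: cg]. Qed.

Lemma contM f g : continuous f -> continuous g -> continuous (fun s => f s * g s).
Proof. by move=> cf cg s; apply: continuousM; [exact: cf|exact: cg]. Qed.

Lemma cint_taylor f g (h : R) f' : continuous f -> continuous g -> continuous f' ->
  cint f - cint g - h * cint f' = cint (fun s => f s - g s - h * f' s).
Proof.
move=> cf cg cf'.
rewrite (_ : (fun s => _) = (fun s => (f s + -1 * g s) + (- h) * f' s)); last first.
  by apply/funext => s; ring.
have c1 := contM (@cont_cst (-1)) cg; have c2 := contM (@cont_cst (- h)) cf'.
rewrite (cintD (contD cf c1) c2) (cintD cf c1) (cintZ _ cg) (cintZ _ cf').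
by rewrite mulN1r mulNr.
Qed.

Lemma cint_le f g : continuous f -> continuous g -> (forall s, f s <= g s) ->
  cint f <= cint g.
Proof.
move=> cf cg fg; rewrite /cint le_Rintegral//; by [exact: cont_integrable|].
Qed.

Lemma cint_cst c : cint (fun=> c) = c * (2 * pi).
Proof.
rewrite /cint Rintegral_cst//= lebesgue_measure_itv/= lte_fin twopi_gt0.
by rewrite sube0.
Qed.

Lemma cint_bound f B : continuous f -> (forall s, 0 <= s <= 2 * pi -> `|f s| <= B) ->
  `|cint f| <= B * (2 * pi).
Proof.
move=> cf fB; rewrite -cint_cst.
rewrite (le_trans (le_normr_Rintegral _ (cont_integrable cf)))//.
apply: le_Rintegral => //.
- apply: (@cont_integrable (fun x => `|f x|)) => x.
  exact: (continuous_comp (cf x) (@norm_continuous _ _ _)).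
- by apply: (@cont_integrable (fun=> B)) => x; exact: cvg_cst.
Qed.

Lemma is_derive_continuous f g : (forall s : R, is_derive s 1 f (g s)) -> continuous f.
Proof.
by move=> d x; apply/differentiable_continuous/derivable1_diffP; case: (d x).
Qed.

Lemma cint_ftc f F : continuous f -> (forall s : R, is_derive s 1 F (f s)) ->
  cint f = F (2 * pi) - F 0.
Proof.
move=> cf d; have cF := is_derive_continuous d.
rewrite /cint /Rintegral (@continuous_FTC2 _ _ F)//.
- exact: twopi_gt0.
- exact: continuous_subspaceT.
- split; first by move=> x _; case: (d x).
  + by apply: cvg_at_right_filter; exact: cF.
  + by apply: cvg_at_left_filter; exact: cF.
- by move=> x _; rewrite derive1E; case: (d x).
Qed.

End CircleIntegral.

(** * Integration along one coordinate and over the whole torus *)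

Section TorusIntegral.
Variables (R : realType) (N : nat).
Implicit Types (x y : 'rV[R]_N) (k : 'I_N) (f g : 'rV[R]_N -> R) (w : R -> R).

Local Notation e_ k := (delta_mx 0 k : 'rV[R]_N).
Local Notation sp := (@smooth_torus R N).

Lemma line_continuous k f x : sp f -> continuous (fun s : R => f (x + s *: e_ k)).
Proof.
move=> sf; apply: is_derive_continuous => t.
by apply: is_derive_line => y; apply: smooth_is_derive; case: sf.
Qed.

(* The weight [w = id] produces periodic primitives, see [wavg_id_partial]. *)
Definition wavg w k f x := cint (fun s => w s * f (x + s *: e_ k)).

Lemma wavg_continuous w k f x : continuous w -> sp f ->
  continuous (fun s => w s * f (x + s *: e_ k)).
Proof. by move=> cw sf s; apply: continuousM; [exact: cw|exact: line_continuous]. Qed.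

Lemma weight_bounded w : continuous w ->
  exists2 W, 0 < W & forall s, 0 <= s <= 2 * pi -> `|w s| <= W.
Proof.
move=> cw; have tp := ltW (twopi_gt0 R).
have cw' : {within `[0, 2 * pi], continuous (fun s => `|w s|)}.
  apply: continuous_subspaceT => x.
  exact: (continuous_comp (cw x) (@norm_continuous _ _ _)).
have [c _ wc] := EVT_max tp cw'.
exists (`|w c| + 1); first by rewrite ltr_wpDl.
move=> s sI; have /wc/le_trans : s \in `[0, 2 * pi]%R by rewrite in_itv.
by apply; rewrite lerDl.
Qed.

Lemma wavg_qderiv w j k f : continuous w -> sp f ->
  qderiv k (wavg w j f) (wavg w j (partial k f)).
Proof.
move=> cw sf; have [W W0 wW] := weight_bounded cw.
have [B B0 fB] := qderivP (sp_qderiv k sf).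
exists (W * B * (2 * pi)) => x h.
have -> : wavg w j f (x + h *: e_ k) - wavg w j f x - h * wavg w j (partial k f) x =
  cint (fun s => w s * (f (x + s *: e_ j + h *: e_ k) - f (x + s *: e_ j)
                        - h * partial k f (x + s *: e_ j))).
  rewrite /wavg cint_taylor; last 3 first.
  - exact: wavg_continuous.
  - exact: wavg_continuous.
  - by apply: wavg_continuous => //; exact: sp_partial.
  by congr cint; apply/funext => s; rewrite (addrAC x); ring.
rewrite [leRHS]mulrAC.
apply: cint_bound => [|s sI].
  apply: contM => //; apply: contB; last first.
    by apply: contM => [|]; [exact: cont_cst|exact/line_continuous/sp_partial].
  apply: contB; last exact: line_continuous.
  rewrite (_ : (fun s => _) = (fun s => f (x + h *: e_ k + s *: e_ j))).
    exact: line_continuous.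
  by apply/funext => t; rewrite addrAC.
by rewrite normrM -mulrA ler_pM// wW.
Qed.

Lemma wavg_sp w j f : continuous w -> sp f -> sp (wavg w j f).
Proof.
move=> cw sf; apply: (@sp_coind _ _ (fun g => exists2 f, sp f & g = wavg w j f)).
- move=> _ [g sg ->]; split.
    move=> x k; rewrite /wavg; congr cint; apply/funext => s.
    by rewrite addrAC sg.2.
  have [W W0 wW] := weight_bounded cw; have [B gB] := sp_bounded sg.
  exists (W * B * (2 * pi)) => x; apply: cint_bound => [|s sI].
    exact: wavg_continuous.
  by rewrite normrM ler_pM// wW.
- move=> _ k [g sg ->]; exists (wavg w j (partial k g)).
    by exists (partial k g) => //; exact: sp_partial.
  exact: wavg_qderiv.
- by exists f.
Qed.

Lemma partial_wavg w j k f : continuous w -> sp f ->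
  partial k (wavg w j f) = wavg w j (partial k f).
Proof. by move=> cw sf; apply/qderiv_partial/wavg_qderiv. Qed.

Lemma line_is_derive k f x (s : R) : sp f ->
  is_derive s 1 (fun h : R => f (x + h *: e_ k)) (partial k f (x + s *: e_ k)).
Proof. by move=> [sf _]; apply: is_derive_line => y; exact: smooth_is_derive. Qed.

Lemma wavg1_partial j f : sp f -> wavg (fun=> 1) j (partial j f) = fun=> 0.
Proof.
move=> sf; apply/funext => x; rewrite /wavg.
under eq_fun do rewrite mul1r.
rewrite (cint_ftc (@line_continuous j _ x (sp_partial j sf)) (fun s => line_is_derive j x s sf)).
by rewrite scale0r addr0 sf.2 subrr.
Qed.

(** Integration by parts over a period: the boundary term of [s * f (x + s e_j)] is [2 * pi * f x]
    by periodicity. As [wavg id j] commutes with derivatives, [wavg id j f / (2 * pi)] is thus a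
    periodic primitive of [f] minus its mean. *)
Lemma wavg_id_partial j f : sp f ->
  wavg id j (partial j f) = fun x => 2 * pi * f x - wavg (fun=> 1) j f x.
Proof.
move=> sf; apply/funext => x.
have c1 := @wavg_continuous (fun=> 1) j f x (@cont_cst R 1) sf.
have c2 := @wavg_continuous id j _ x (fun _ => cvg_id) (sp_partial j sf).
have d (s : R) : is_derive s 1 (fun s => s * f (x + s *: e_ j))
    (s * partial j f (x + s *: e_ j) + 1 * f (x + s *: e_ j)).
  have ds := line_is_derive j x s sf.
  have := @is_deriveM _ _ (id : R -> R) _ s 1 _ _ (is_derive_id s 1) ds.
  by move=> /is_derive_eq; apply; rewrite /GRing.scale/= mulr1 mul1r.
have E : wavg id j (partial j f) x + wavg (fun=> 1) j f x = 2 * pi * f x.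
  by rewrite /wavg -(cintD c2 c1) (cint_ftc (contD c2 c1) d) mul0r subr0 sf.2.
by rewrite -E addrK.
Qed.

(** The mean over a period has zero derivative in its own direction, so the period may start at [x]
    instead of at the point whose [j]-th coordinate is 0. *)
Lemma integrate_coordE j f : sp f -> integrate_coord j f = wavg (fun=> 1) j f.
Proof.
move=> sf; apply/funext => x.
have s1 : sp (wavg (fun=> 1) j f) by apply: wavg_sp => // s; exact: cvg_cst.
have q := sp_qderiv j s1.
rewrite partial_wavg// in q; last by move=> s; exact: cvg_cst.
rewrite wavg1_partial// in q.
have d t := is_derive_line x t (fun v => qderiv_is_derive v q).
have [c _] := mvt0 d (- x 0 j); rewrite /= scale0r addr0 mulr0 => /subr0_eq <-.
rewrite /wavg /integrate_coord /cint; apply: eq_Rintegral => s _.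
rewrite mul1r; congr f; apply/rowP => i; rewrite !mxE eqxx/= eq_sym.
by case: eqVneq => [->|_]; rewrite ?mulr1 ?mulr0 ?addr0 ?subrr ?add0r// subrK.
Qed.

Local Notation ic := (@integrate_coord R N).

Lemma ic_sp j f : sp f -> sp (ic j f).
Proof. by move=> sf; rewrite integrate_coordE//; apply: wavg_sp => // s; exact: cvg_cst. Qed.

Lemma ic_partial j k f : sp f -> ic j (partial k f) = partial k (ic j f).
Proof.
move=> sf; rewrite !integrate_coordE//; last exact: sp_partial.
by rewrite partial_wavg// => s; exact: cvg_cst.
Qed.

Lemma ic_partial_same j f : sp f -> ic j (partial j f) = fun=> 0.
Proof.
by move=> sf; rewrite integrate_coordE ?wavg1_partial//; exact: sp_partial.
Qed.

Lemma icE j f x : ic j f x = cint (fun s => f (x + (s - x 0 j) *: e_ j)).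
Proof.
rewrite /integrate_coord /cint; apply: eq_Rintegral => s _; congr f.
apply/rowP => i; rewrite !mxE eqxx/= eq_sym.
by case: eqVneq => [->|_]; rewrite ?mulr1 ?mulr0 ?addr0// addrC subrK.
Qed.

Lemma ic_continuous j f x : sp f -> continuous (fun s => f (x + (s - x 0 j) *: e_ j)).
Proof.
move=> sf; rewrite (_ : (fun s => _) = (fun s => f ((x - x 0 j *: e_ j) + s *: e_ j))).
  exact: line_continuous.
by apply/funext => s; rewrite scalerBl addrA addrAC.
Qed.

Lemma icD j f g : sp f -> sp g -> ic j (fun x => f x + g x) = fun x => ic j f x + ic j g x.
Proof.
by move=> sf sg; apply/funext => x; rewrite !icE cintD//; exact: ic_continuous.
Qed.

Lemma icZ j c f : sp f -> ic j (fun x => c * f x) = fun x => c * ic j f x.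
Proof.
by move=> sf; apply/funext => x; rewrite !icE cintZ//; exact: ic_continuous.
Qed.

Lemma ic_le j f g : sp f -> sp g -> (forall x, f x <= g x) -> forall x, ic j f x <= ic j g x.
Proof. by move=> sf sg fg x; rewrite !icE cint_le//; exact: ic_continuous. Qed.

Lemma ic_cst j (c : R) : ic j (fun=> c) = fun=> c * (2 * pi).
Proof. by apply/funext => x; rewrite icE cint_cst. Qed.

Definition fold_ic s f := foldr ic f s.

Lemma fold_ic_sp s f : sp f -> sp (fold_ic s f).
Proof. by move=> sf; elim: s => //= j s; exact: ic_sp. Qed.

Lemma fold_icD s f g : sp f -> sp g ->
  fold_ic s (fun x => f x + g x) = fun x => fold_ic s f x + fold_ic s g x.
Proof. by move=> sf sg; elim: s => //= j s ->; rewrite icD//; exact: fold_ic_sp. Qed.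

Lemma fold_icZ s c f : sp f -> fold_ic s (fun x => c * f x) = fun x => c * fold_ic s f x.
Proof. by move=> sf; elim: s => //= j s ->; rewrite icZ//; exact: fold_ic_sp. Qed.

Lemma fold_ic_le s f g : sp f -> sp g -> (forall x, f x <= g x) ->
  forall x, fold_ic s f x <= fold_ic s g x.
Proof. by move=> sf sg fg; elim: s => //= j s IH; apply: ic_le => //; exact: fold_ic_sp. Qed.

Lemma fold_ic_cst s (c : R) : fold_ic s (fun=> c) = fun=> c * (2 * pi) ^+ size s.
Proof.
elim: s => [|j s IH] /=; first by apply/funext => x; rewrite mulr1.
by rewrite IH ic_cst; apply/funext => x; rewrite exprSr -mulrA.
Qed.

Lemma fold_ic_partial_comm s k f : sp f ->
  fold_ic s (partial k f) = partial k (fold_ic s f).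
Proof. by move=> sf; elim: s => //= j s ->; rewrite ic_partial//; exact: fold_ic_sp. Qed.

(** The derivative commutes with the inner integrals until it meets the one in its own direction, so
    the order of integration never has to be changed. *)
Lemma fold_ic_partial s k f : k \in s -> sp f -> fold_ic s (partial k f) = fun=> 0.
Proof.
move=> + sf; elim: s => //= j s IH; rewrite inE.
case: eqVneq => [->|_] /= ks.
  by rewrite fold_ic_partial_comm// ic_partial_same//; exact: fold_ic_sp.
by rewrite IH// ic_cst mul0r.
Qed.

Local Notation T := (@torus_integral R N).

Lemma TD f g : sp f -> sp g -> T (fun x => f x + g x) = T f + T g.
Proof. by move=> sf sg; rewrite /torus_integral -!/(fold_ic _ _) fold_icD. Qed.

Lemma TZ c f : sp f -> T (fun x => c * f x) = c * T f.
Proof. by move=> sf; rewrite /torus_integral -!/(fold_ic _ _) fold_icZ. Qed.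

Lemma TN f : sp f -> T (fun x => - f x) = - T f.
Proof.
move=> sf; rewrite -mulN1r -TZ//; congr T; apply/funext => x.
by rewrite mulN1r.
Qed.

Lemma TB f g : sp f -> sp g -> T (fun x => f x - g x) = T f - T g.
Proof. by move=> sf sg; rewrite TD ?TN//; exact: spN. Qed.

Lemma T_le f g : sp f -> sp g -> (forall x, f x <= g x) -> T f <= T g.
Proof. by move=> sf sg fg; exact: fold_ic_le. Qed.

Lemma T_cst (c : R) : T (fun=> c) = c * (2 * pi) ^+ N.
Proof. by rewrite /torus_integral -/(fold_ic _ _) fold_ic_cst size_enum_ord. Qed.

Lemma T_partial k f : sp f -> T (partial k f) = 0.
Proof.
by move=> sf; rewrite /torus_integral -/(fold_ic _ _) fold_ic_partial// mem_enum.
Qed.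

Lemma T_sum (I : Type) (r : seq I) (P : pred I) (F : I -> 'rV[R]_N -> R) :
  (forall i, P i -> sp (F i)) ->
  T (fun x => \sum_(i <- r | P i) F i x) = \sum_(i <- r | P i) T (F i).
Proof.
move=> sF; elim: r => [|i r IH].
  rewrite big_nil (_ : (fun x => _) = fun=> 0) ?T_cst ?mul0r//.
  by apply/funext => x; rewrite big_nil.
rewrite big_cons; case: ifPn => Pi.
  rewrite -IH -TD; [|exact: sF|exact: sp_sum].
  by congr T; apply/funext => x; rewrite big_cons Pi.
by rewrite -IH; congr T; apply/funext => x; rewrite big_cons (negbTE Pi).
Qed.

Lemma T_norm_le f g : sp f -> sp g -> (forall x, `|f x| <= g x) -> `|T f| <= T g.
Proof.
move=> sf sg fg; rewrite ler_norml -(TN sg); apply/andP; split; apply: T_le => //; first exact: spN.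
  by move=> x; have := fg x; rewrite ler_norml => /andP[].
by move=> x; rewrite (le_trans (ler_norm _)).
Qed.

Lemma T_bound f B : sp f -> (forall x, `|f x| <= B) -> `|T f| <= B * (2 * pi) ^+ N.
Proof. by move=> sf fB; rewrite -T_cst; apply: T_norm_le => //; exact: sp_cst. Qed.

Lemma T_ge0 f : sp f -> (forall x, 0 <= f x) -> 0 <= T f.
Proof.
by move=> sf f0; rewrite -(mul0r ((2 * pi) ^+ N)) -T_cst; apply: T_le => //; exact: sp_cst.
Qed.

Lemma T_parts k f g : sp f -> sp g ->
  T (fun x => f x * partial k g x) = - T (fun x => partial k f x * g x).
Proof.
move=> sf sg; apply/eqP; rewrite -subr_eq0 opprK addrC -TD.
- by rewrite -partialM// T_partial//; exact: spM.
- by apply: spM => //; exact: sp_partial.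
- by apply: spM => //; exact: sp_partial.
Qed.

(** As a function of the translation, the integral has as derivative the integral of a partial
    derivative, which is 0. *)
Lemma T_translate f y : sp f -> T (fun x => f (x + y)) = T f.
Proof.
move=> sf; pose G (y : 'rV[R]_N) := T (fun x => f (x + y)).
suff q k : qderiv k G (fun=> 0).
  rewrite -[LHS]/(G y) (constant_of_qderiv0 q y 0) /G; congr T.
  by apply/funext => x; rewrite addr0.
have [B fB] := sp_qderiv k sf.
exists (B * (2 * pi) ^+ N) => z h; rewrite mulr0 subr0 /G.
have -> : T (fun x => f (x + (z + h *: e_ k))) - T (fun x => f (x + z)) =
  T (fun x => f (x + z + h *: e_ k) - f (x + z) - h * partial k f (x + z)).
  have s1 := sp_translate z sf; have s2 := sp_translate (z + h *: e_ k) sf.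
  have s3 := sp_partial k s1.
  have -> : (fun x => f (x + z + h *: e_ k) - f (x + z) - h * partial k f (x + z))
    = (fun x => f (x + (z + h *: e_ k)) - f (x + z) - h * partial k (fun x => f (x + z)) x).
    by apply/funext => x; rewrite addrA partial_translate.
  rewrite TB; [|exact: spB|exact: spZ].
  by rewrite TB// TZ// T_partial// mulr0 subr0.
rewrite mulrAC; apply: T_bound => [|x]; last by rewrite fB.
have s1 := sp_translate z sf.
apply: spB; last by apply: spZ; apply/(sp_translate (f := partial k f))/sp_partial.
apply: spB => //.
rewrite (_ : (fun x => _) = (fun x => f (x + (z + h *: e_ k)))).
  exact: sp_translate.
by apply/funext => x; rewrite addrA.
Qed.

End TorusIntegral.

(** * Plane waves *)

Section Cosine.
Variable R : realType.
Implicit Types a d h t : R.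

Lemma cos_addz a (z : int) : cos (a + 2 * pi * z%:~R) = cos a :> R.
Proof.
have H (n : nat) b : cos (b + 2 * pi * n%:R) = cos b :> R.
  elim: n b => [|n IH] b; first by rewrite mulr0 addr0.
  rewrite -(addn1 n) natrD mulrDr mulr1 addrA.
  by rewrite [2 * pi]mulr_natl cosD2pi -mulr_natl IH.
case: z => n; first exact: H.
by rewrite NegzE mulrNz mulrN -[LHS](H n.+1) subrK.
Qed.

Lemma is_derive_shiftl (f f' : R -> R) a t : (forall s : R, is_derive s 1 f (f' s)) ->
  is_derive t 1 (fun s => f (a + s)) (f' (a + t)).
Proof.
move=> d; have dg : is_derive t 1 (fun s => a + s) (1 : R).
  have := @is_deriveD _ _ _ (cst a) id t 1 _ _ (is_derive_cst _ _ _) (is_derive_id t 1).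
  by rewrite add0r.
have := @is_derive1_comp R f (fun s => a + s) t _ _ (d (a + t)) dg.
by rewrite mulr1.
Qed.

Lemma sin_lip a t : `|sin (a + t) - sin a| <= `|t|.
Proof.
have [c _] := mvt0 (fun s => is_derive_shiftl a s (@is_derive_sin R)) t.
by rewrite addr0 => ->; rewrite normrM ler_piMr// cos_max.
Qed.

Lemma cos_taylor a d : `|cos (a + d) - cos a + d * sin a| <= d ^+ 2.
Proof.
have D s := is_derive_shiftl a s (@is_derive_cos R).
have L (t : R) : `|- sin (a + t) - - sin (a + 0)| <= 1 * `|t|.
  by rewrite mul1r -opprD normrN addr0; exact: sin_lip.
by have := taylor2 D L d; rewrite /= addr0 mulrN opprK mul1r.
Qed.

(** Lets [1 - cos h] serve as a smooth periodic substitute for the squared distance, which can be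
    integrated exactly against [kern]. The constant comes from [1 - cos h = 2 sin^2 (h / 2)] and
    [sin t >= t * cos 1 / 2]. *)
Lemma sqr_le_1Bcos : exists2 c : R, 0 < c & forall h, `|h| <= pi -> h ^+ 2 <= c * (1 - cos h).
Proof.
have c1 : 0 < cos 1 :> R := cos1_gt0 R.
(* Up to 1 the mean value theorem gives even [t * cos 1]. Beyond 1, [sin t >= sin 1 >= cos 1] (as
   [cos 2 < 0]) and [t <= pi / 2 < 2], which accounts for the factor 1/2. *)
have cs t : 0 <= t <= pi / 2 -> t * (cos 1 / 2) <= sin t.
  move=> /andP[t0 tp]; have [t1|t1] := leP t 1.
    have [c ct] := mvt0 (@is_derive_sin R) t.
    rewrite sin0 subr0 => ->; rewrite ler_wpM2l//.
    move: ct; rewrite -(cos_norm c) (ger0_norm t0) => ct.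
    have c_1 : `|c| <= 1 by rewrite (le_trans ct).
    have p1 : 1 <= pi :> R by rewrite (le_trans _ (pi_ge2 R))// ler1n.
    have I1 : 1 \in `[0, pi : R] by rewrite in_itv/= ler01 p1.
    have Ic : `|c| \in `[0, pi : R] by rewrite in_itv/= normr_ge0 (le_trans c_1).
    have : cos 1 <= cos `|c| :> R by rewrite leNgt ltr_cos// -leNgt.
    by apply: le_trans; lra.
  have t2 : t <= 2 by rewrite (le_trans tp)// ltW// pihalf_lt2.
  have s1 : cos 1 <= sin 1 :> R.
    have : cos 1 ^+ 2 <= sin 1 ^+ 2 :> R.
      have := cos_mulr2n (1 : R); have := cos2_lt0 R; rewrite sin2cos2 -mulr_natl mulr1.
      by rewrite -mulr_natl; lra.
    rewrite ler_pXn2r// nnegrE ltW//.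
    by apply: sin_gt0_pi; rewrite ltr01/= (lt_le_trans _ (pi_ge2 R))// ltr1n.
  have : sin 1 <= sin t.
    have p2 := pihalf_ge1 R.
    rewrite leNgt ltr_sin -?leNgt ?ltW// in_itv/=; apply/andP; split; lra.
  apply: le_trans; rewrite (le_trans _ s1)//.
  have := ler_wpM2r (ltW c1) t2; lra.
exists (8 / cos 1 ^+ 2) => [|h hp]; first by rewrite divr_gt0// exprn_gt0.
have E : 1 - cos h = 2 * sin (`|h| / 2) ^+ 2.
  have := cos_mulr2n (`|h| / 2).
  have -> : `|h| / 2 *+ 2 = `|h| by rewrite -mulr_natr divfK ?pnatr_eq0.
  by rewrite cos_norm sin2cos2 => ->; ring.
have /cs H : 0 <= `|h| / 2 <= pi / 2 by rewrite divr_ge0//= ler_pM2r// invr_gt0.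
rewrite E -real_normK ?num_real//.
have H0 : 0 <= `|h| / 2 * (cos 1 / 2) by rewrite !mulr_ge0// ltW.
have := ler_pM H0 H0 H H.
move=> H2; by rewrite [leRHS]mulrAC ler_pdivlMr ?exprn_gt0//; lra.
Qed.

End Cosine.

(** * Waves: derivatives, products and orthogonality *)

Section Characters.
Variables (R : realType) (N : nat).
Implicit Types (x y : 'rV[R]_N) (j : 'I_N) (k l : 'rV[int]_N) (f g : 'rV[R]_N -> R) (th : R).

Local Notation e_ k := (delta_mx 0 k : 'rV[R]_N).
Local Notation sp := (@smooth_torus R N).
Local Notation T := (@torus_integral R N).

Definition dotz k x : R := \sum_i (k 0 i)%:~R * x 0 i.

(** The phase [th] is what makes real functions suffice: [th = 0] is the cosine, [th = - (pi / 2)]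
    the sine, and differentiation only adds [pi / 2]. *)
Definition wave k th x : R := cos (dotz k x + th).

Lemma dotzD k x y : dotz k (x + y) = dotz k x + dotz k y.
Proof. by rewrite -big_split; apply: eq_bigr => i _; rewrite mxE mulrDr. Qed.

Lemma dotzZ k (h : R) x : dotz k (h *: x) = h * dotz k x.
Proof. by rewrite mulr_sumr; apply: eq_bigr => i _; rewrite mxE mulrCA. Qed.

Lemma dotz_delta k j : dotz k (e_ j) = (k 0 j)%:~R.
Proof.
rewrite /dotz (bigD1 j)//= big1 ?addr0 => [|i ij]; last first.
  by rewrite mxE/= (negbTE ij) mulr0.
by rewrite mxE !eqxx mulr1.
Qed.

Lemma dotz_delta_l j x : dotz (delta_mx 0 j) x = x 0 j.
Proof.
rewrite /dotz (bigD1 j)//= big1 ?addr0 => [|i ij]; last first.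
  by rewrite mxE/= (negbTE ij) mul0r.
by rewrite mxE !eqxx mul1r.
Qed.

Lemma dotzDl k l x : dotz (k + l) x = dotz k x + dotz l x.
Proof. by rewrite -big_split; apply: eq_bigr => i _; rewrite mxE intrD mulrDl. Qed.

Lemma dotzNl k x : dotz (- k) x = - dotz k x.
Proof. by rewrite -sumrN; apply: eq_bigr => i _; rewrite mxE intrN mulNr. Qed.

Lemma dotz0l x : dotz 0 x = 0.
Proof. by apply: big1 => i _; rewrite mxE mul0r. Qed.

Lemma waveN k th x : wave (- k) th x = wave k (- th) x.
Proof. by rewrite /wave dotzNl -cosN opprD opprK. Qed.

Lemma wave_qderiv k th j :
  qderiv j (wave k th) (fun x => (k 0 j)%:~R * wave k (th + pi / 2) x).
Proof.
exists ((k 0 j)%:~R ^+ 2) => x h; rewrite /wave dotzD dotzZ dotz_delta.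
rewrite addrA cosDpihalf 2!mulrN opprK mulrA [leRHS]mulrC -exprMn.
by rewrite (addrAC (dotz k x)) cos_taylor.
Qed.

Lemma wave_le1 k th x : `|wave k th x| <= 1. Proof. exact: cos_max. Qed.

Lemma wave_sp k th : sp (wave k th).
Proof.
apply: (@sp_coind _ _ (fun f => exists c th, f = fun x => c * wave k th x)).
- move=> _ [c [t ->]]; split.
    move=> x j; rewrite /wave dotzD dotzZ dotz_delta (addrAC _ _ t).
    by rewrite cos_addz.
  by exists `|c| => x; rewrite normrM ler_piMr// wave_le1.
- move=> _ j [c [t ->]].
  exists (fun x => c * ((k 0 j)%:~R * wave k (t + pi / 2) x)).
    by exists (c * (k 0 j)%:~R), (t + pi / 2); apply/funext => x; rewrite mulrA.
  exact/qderivZ/wave_qderiv.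
- by exists 1, th; apply/funext => x; rewrite mul1r.
Qed.

Lemma partial_wave k th j :
  partial j (wave k th) = fun x => (k 0 j)%:~R * wave k (th + pi / 2) x.
Proof. exact/qderiv_partial/wave_qderiv. Qed.

Lemma partials_wave k th s : partials s (wave k th) =
  fun x => \prod_(j <- s) (k 0 j)%:~R * wave k (th + (size s)%:R * (pi / 2)) x.
Proof.
elim: s => [|j s IH] /=.
  by apply/funext => x; rewrite big_nil mul1r mul0r addr0.
rewrite IH partialZ; last exact: wave_sp.
rewrite partial_wave; apply/funext => x; rewrite big_cons.
rewrite mulrCA mulrA; congr (_ * wave _ _ _).
by rewrite -(addn1 (size s)) natrD; ring.
Qed.

Definition wt k : R := 1 + \sum_j `|(k 0 j)%:~R|.

Lemma wt_ge1 k : 1 <= wt k.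
Proof. by rewrite lerDl sumr_ge0. Qed.

Lemma wt_gt0 k : 0 < wt k.
Proof. exact: lt_le_trans (wt_ge1 k). Qed.

Lemma coord_le_wt k j : `|(k 0 j)%:~R| <= wt k.
Proof.
rewrite /wt (bigD1 j)//= addrCA lerDl addr_ge0// sumr_ge0//.
Qed.

Lemma partials_wave_le k th s m x : (size s <= m)%N ->
  `|partials s (wave k th) x| <= wt k ^+ m.
Proof.
move=> sm; rewrite partials_wave normrM.
apply: (@le_trans _ _ (wt k ^+ size s)); last by apply: ler_weXn2l => //; exact: wt_ge1.
rewrite (le_trans (ler_piMr _ (wave_le1 _ _ _)))//.
elim: s {sm} => [|j s IH]; first by rewrite big_nil normr1.
by rewrite big_cons normrM exprS ler_pM// coord_le_wt.
Qed.

Lemma waveM k l th th' x : wave k th x * wave l th' x =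
  2^-1 * (wave (k + l) (th + th') x + wave (k - l) (th - th') x).
Proof.
rewrite /wave !dotzDl dotzNl.
have -> : dotz k x + dotz l x + (th + th') = (dotz k x + th) + (dotz l x + th') by ring.
have -> : dotz k x - dotz l x + (th - th') = (dotz k x + th) - (dotz l x + th') by ring.
by set u := _ + th; set v := _ + th'; rewrite (cosD u) (cosB u); field.
Qed.

Lemma waveD k th x y : wave k th (x + y) =
  cos (dotz k y) * wave k th x - sin (dotz k y) * wave k (th - pi / 2) x.
Proof.
by rewrite /wave dotzD (addrAC (dotz k x)) (addrA _ th) cosBpihalf (cosD (_ + th)); ring.
Qed.

Lemma T_wave k th : T (wave k th) = if k == 0 then cos th * (2 * pi) ^+ N else 0.
Proof.
case: eqVneq => [->|k0].
  rewrite -T_cst; congr T; apply/funext => x; by rewrite /wave dotz0l add0r.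
have [j kj] : exists j, k 0 j != 0.
  apply/existsP; apply: contraNT k0; rewrite negb_exists => /forallP k0.
  by apply/eqP/rowP => j; rewrite mxE; have := k0 j; rewrite negbK => /eqP.
(* With [k_j] nonzero, the wave is up to the factor [k_j] the [j]-th derivative of a wave. *)
have := @T_partial R N j _ (wave_sp k (th - pi / 2)).
rewrite partial_wave subrK TZ; last exact: wave_sp.
by move=> /eqP; rewrite mulf_eq0 intr_eq0 (negbTE kj)/= => /eqP.
Qed.

Lemma T_waveM k l th th' : T (fun x => wave k th x * wave l th' x) =
  2^-1 * (2 * pi) ^+ N *
  ((k == - l)%:R * cos (th + th') + (k == l)%:R * cos (th - th')).
Proof.
under eq_fun do rewrite waveM.
rewrite TZ; last by apply: spD; exact: wave_sp.
rewrite TD; [|exact: wave_sp|exact: wave_sp].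
rewrite !T_wave addr_eq0 subr_eq0.
by case: eqP => _; case: eqP => _ /=; ring.
Qed.

End Characters.

(** * Real distributions and density of plane waves *)

Section Density.
Variables (R : realType) (N : nat).
Implicit Types (x y : 'rV[R]_N) (j : 'I_N) (k l : 'rV[int]_N) (f g : 'rV[R]_N -> R) (th : R).
Implicit Types (phi psi W : 'rV[R]_N -> R) (L : ('rV[R]_N -> R) -> R).

Local Notation e_ k := (delta_mx 0 k : 'rV[R]_N).
Local Notation sp := (@smooth_torus R N).
Local Notation T := (@torus_integral R N).

Definition Cm_le m (M : R) phi := forall s x, (size s <= m)%N -> `|partials s phi x| <= M.

Definition linear_form L :=
  forall (c : R) phi psi, sp phi -> sp psi -> L (fun x => c * phi x + psi x) = c * L phi + L psi.

Definition rdist L := linear_form L /\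
  exists (C : R) (m : nat), 0 <= C /\ forall phi (M : R), sp phi -> Cm_le m M phi -> `|L phi| <= C * M.

Definition rsmooth L := exists2 f, sp f & forall phi, sp phi -> L phi = T (fun x => f x * phi x).

Lemma linD L phi psi : linear_form L -> sp phi -> sp psi ->
  L (fun x => phi x + psi x) = L phi + L psi.
Proof.
move=> lL s1 s2; rewrite -[L phi]mul1r -lL//; congr L.
by apply/funext => x; rewrite mul1r.
Qed.

Lemma lin0 L : linear_form L -> L (fun=> 0) = 0.
Proof.
move=> lL; have s0 := @sp_cst R N 0.
have := linD lL s0 s0; rewrite (_ : (fun=> 0 + 0) = fun=> 0).
  by move/eqP; rewrite -subr_eq0 opprD addNKr oppr_eq0 => /eqP.
by apply/funext => x; rewrite addr0.
Qed.

Lemma linZ L c phi : linear_form L -> sp phi -> L (fun x => c * phi x) = c * L phi.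
Proof.
move=> lL s1; rewrite -[RHS]addr0 -{1}(lin0 lL) -lL//; last exact: sp_cst.
by congr L; apply/funext => x; rewrite addr0.
Qed.

Lemma linN L phi : linear_form L -> sp phi -> L (fun x => - phi x) = - L phi.
Proof.
move=> lL s1; rewrite -mulN1r -linZ//; congr L.
by apply/funext => x; rewrite mulN1r.
Qed.

Lemma linB L phi psi : linear_form L -> sp phi -> sp psi ->
  L (fun x => phi x - psi x) = L phi - L psi.
Proof. by move=> lL s1 s2; rewrite linD ?linN//; exact: spN. Qed.

Lemma lin_sum L (I : Type) (r : seq I) (F : I -> 'rV[R]_N -> R) :
  linear_form L -> (forall i, sp (F i)) ->
  L (fun x => \sum_(i <- r) F i x) = \sum_(i <- r) L (F i).
Proof.
move=> lL sF; elim: r => [|i r IH].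
  by rewrite big_nil -[RHS](lin0 lL); congr L; apply/funext => x; rewrite big_nil.
rewrite big_cons -IH -linD//; last exact: sp_sum.
by congr L; apply/funext => x; rewrite big_cons.
Qed.

Lemma Cm_le_ge0 m M phi : Cm_le m M phi -> 0 <= M.
Proof. by move=> H; rewrite (le_trans _ (H [::] 0 _)). Qed.

Lemma Cm_leS m M phi : Cm_le m.+1 M phi <->
  (forall x, `|phi x| <= M) /\ forall j, Cm_le m M (partial j phi).
Proof.
split=> [H|[H0 H1]].
  split=> [x|j s x sm]; first exact: (H [::]).
  by rewrite -partials_rcons; apply: H; rewrite size_rcons.
move=> s x; case/lastP: s => [|s j] sm; first exact: H0.
by rewrite partials_rcons; apply: H1; rewrite size_rcons in sm.
Qed.

Lemma Cm_le0 M phi : Cm_le 0 M phi <-> forall x, `|phi x| <= M.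
Proof. by split=> [H x|H [|//] x _]; [exact: (H [::])|exact: H]. Qed.

Lemma Cm_le_weak m n M M' phi : (m <= n)%N -> M <= M' -> Cm_le n M phi -> Cm_le m M' phi.
Proof.
move=> mn MM H s x sm; rewrite (le_trans (H s x _))//.
exact: leq_trans mn.
Qed.

Lemma Cm_leD m M M' phi psi : sp phi -> sp psi -> Cm_le m M phi -> Cm_le m M' psi ->
  Cm_le m (M + M') (fun x => phi x + psi x).
Proof.
elim: m M M' phi psi => [|m IH] M M' phi psi s1 s2.
  move=> /Cm_le0 H1 /Cm_le0 H2; apply/Cm_le0 => x.
  by rewrite (le_trans (ler_normD _ _))// lerD.
move=> /Cm_leS[H1 H1'] /Cm_leS[H2 H2']; apply/Cm_leS; split=> [x|j].
  by rewrite (le_trans (ler_normD _ _))// lerD.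
by rewrite partialD//; apply: IH => //; exact: sp_partial.
Qed.

Lemma sp_Cm_le m phi : sp phi -> exists2 M : R, 0 < M & Cm_le m M phi.
Proof.
elim: m phi => [|m IH] phi sphi.
  by have [B B0 fB] := boundedP (sp_bounded sphi); exists B => //; exact/Cm_le0.
have [B B0 fB] := boundedP (sp_bounded sphi).
have H j : exists M : R, 0 < M /\ Cm_le m M (partial j phi).
  by have [M M0 ?] := IH _ (sp_partial j sphi); exists M.
have [M MP] := choice H.
exists (B + \sum_j M j).
  by rewrite ltr_wpDr// sumr_ge0// => j _; rewrite ltW//; case: (MP j).
apply/Cm_leS; split=> [x|j].
  rewrite (le_trans (fB x))// lerDl sumr_ge0// => j _.
  by rewrite ltW//; case: (MP j).
apply: Cm_le_weak (MP j).2 => //.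
rewrite (bigD1 j)//= addrCA lerDl addr_ge0 ?(ltW B0)// sumr_ge0// => i _.
by rewrite ltW//; case: (MP i).
Qed.

(* Leibniz: [2 ^ m] counts the terms of an [m]-th derivative of a product. *)
Lemma Cm_leM m A M f phi : sp f -> sp phi -> Cm_le m A f -> Cm_le m M phi ->
  Cm_le m (2 ^+ m * (A * M)) (fun x => f x * phi x).
Proof.
elim: m f phi A M => [|m IH] f phi A M sf sphi.
  move=> /Cm_le0 H1 /Cm_le0 H2; apply/Cm_le0 => x.
  by rewrite expr0 mul1r normrM ler_pM.
move=> Hf Hp; have A0 := Cm_le_ge0 Hf; have M0 := Cm_le_ge0 Hp.
move: (Hf) (Hp) => /Cm_leS[H1 H1'] /Cm_leS[H2 H2']; apply/Cm_leS; split=> [x|j].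
  rewrite normrM (@le_trans _ _ (A * M))//; first exact: ler_pM.
  by rewrite ler_peMl ?mulr_ge0// exprn_ege1// ler1n.
have s1 := sp_partial j sf; have s2 := sp_partial j sphi.
rewrite partialM//.
rewrite (_ : _ ^+ m.+1 * _ = 2 ^+ m * (A * M) + 2 ^+ m * (A * M)); last first.
  by rewrite exprS; ring.
have Hf' : Cm_le m A f by apply: Cm_le_weak Hf.
have Hp' : Cm_le m M phi by apply: Cm_le_weak Hp.
by apply: Cm_leD; [exact: spM|exact: spM|exact: IH|exact: IH].
Qed.

Lemma T_linear_form f : sp f -> linear_form (fun phi => T (fun x => f x * phi x)).
Proof.
move=> sf c phi psi s1 s2; rewrite -TZ; last exact: spM.
rewrite -TD; [|by apply/spZ/spM|exact: spM].
by congr T; apply/funext => x; ring.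
Qed.

Lemma T_rdist f : sp f -> rdist (fun phi => T (fun x => f x * phi x)).
Proof.
move=> sf; split; first exact: T_linear_form.
have [B B0 fB] := boundedP (sp_bounded sf).
exists (B * (2 * pi) ^+ N), 0%N; split.
  by rewrite mulr_ge0 ?(ltW B0)// exprn_ge0// ltW// twopi_gt0.
move=> phi M sphi /Cm_le0 pM; rewrite mulrAC; apply: T_bound; first exact: spM.
by move=> x; rewrite normrM ler_pM.
Qed.

Lemma T_rdist1 : rdist T.
Proof.
have [l b] := T_rdist (sp_cst N (1 : R)).
have E phi : T (fun x => 1 * phi x) = T phi.
  by congr T; apply/funext => x; rewrite mul1r.
split; first by move=> c phi psi s1 s2; have := l c phi psi s1 s2; rewrite !E.
have [C [m [C0 H]]] := b; exists C, m; split=> // phi M sphi HM.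
by have := H phi M sphi HM; rewrite E.
Qed.

Lemma linear_formB L L' : linear_form L -> linear_form L' ->
  linear_form (fun phi => L phi - L' phi).
Proof. by move=> l l' c phi psi s1 s2; rewrite l// l'//; ring. Qed.

Lemma rdistB L L' : rdist L -> rdist L' -> rdist (fun phi => L phi - L' phi).
Proof.
move=> [l [C [m [C0 b]]]] [l' [C' [m' [C'0 b']]]]; split; first exact: linear_formB.
exists (C + C'), (m + m')%N; split; first exact: addr_ge0.
move=> phi M sphi H; rewrite (le_trans (ler_normB _ _))// mulrDl lerD//.
  by apply: b => //; apply: Cm_le_weak H; rewrite ?leq_addr.
by apply: b' => //; apply: Cm_le_weak H; rewrite ?leq_addl.
Qed.

Inductive trigpoly : ('rV[R]_N -> R) -> Prop :=
| trig_wave c k th : trigpoly (fun x => c * wave k th x)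
| trig_add f g : trigpoly f -> trigpoly g -> trigpoly (fun x => f x + g x).

Lemma trig_sp f : trigpoly f -> sp f.
Proof.
by elim=> [c k th|{}f g _ sf _ sg]; [exact/spZ/wave_sp|exact: spD].
Qed.

Lemma trig_mul f g : trigpoly f -> trigpoly g -> trigpoly (fun x => f x * g x).
Proof.
move=> tf; elim=> [c k th|g1 g2 _ t1 _ t2]; last first.
  rewrite (_ : (fun x => _) = fun x => f x * g1 x + f x * g2 x); first exact: trig_add.
  by apply/funext => x; rewrite mulrDr.
elim: tf => [d l t|f1 f2 _ t1 _ t2]; last first.
  rewrite (_ : (fun x => _) = fun x => f1 x * (c * wave k th x) + f2 x * (c * wave k th x)).
    exact: trig_add.
  by apply/funext => x; rewrite mulrDl.
rewrite (_ : (fun x => _) = fun x => (d * c / 2) * wave (l + k) (t + th) x +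
    (d * c / 2) * wave (l - k) (t - th) x).
  by apply: trig_add; exact: trig_wave.
by apply/funext => x; rewrite mulrACA waveM; ring.
Qed.

Definition cosc j := wave (delta_mx 0 j : 'rV[int]_N) 0 : 'rV[R]_N -> R.
Definition sinc j := wave (delta_mx 0 j : 'rV[int]_N) (- (pi / 2)) : 'rV[R]_N -> R.

Lemma coscE j x : cosc j x = cos (x 0 j).
Proof. by rewrite /cosc /wave dotz_delta_l addr0. Qed.

Lemma sincE j x : sinc j x = sin (x 0 j).
Proof. by rewrite /sinc /wave dotz_delta_l cosBpihalf. Qed.

Lemma partial_cosc j i : partial i (cosc j) = fun x => - (i == j)%:R * sinc j x.
Proof.
rewrite /cosc partial_wave; apply/funext => x; rewrite mxE/= sincE /wave dotz_delta_l.
by rewrite add0r cosDpihalf; case: eqP => _ /=; ring.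
Qed.

Lemma partial_sinc j i : partial i (sinc j) = fun x => (i == j)%:R * cosc j x.
Proof.
rewrite /sinc partial_wave; apply/funext => x; rewrite mxE/= coscE /wave dotz_delta_l.
by rewrite addNr addr0; case: eqP => _ /=; ring.
Qed.

Lemma cosc_sp j : sp (cosc j). Proof. exact: wave_sp. Qed.
Lemma sinc_sp j : sp (sinc j). Proof. exact: wave_sp. Qed.

(* [kern s / T (kern s)] is an approximate identity when every index has a large multiplicity
   in [s]. *)
Definition kern (s : seq 'I_N) x := foldr (fun j w => (1 + cosc j x) * w) 1 s.

Lemma kern_cons j s : kern (j :: s) = fun x => (1 + cosc j x) * kern s x.
Proof. by []. Qed.

Lemma trig_cst (c : R) : trigpoly (fun=> c).
Proof.
rewrite (_ : (fun=> c) = fun x => c * wave 0 0 x); first exact: trig_wave.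
by apply/funext => x; rewrite /wave dotz0l addr0 cos0 mulr1.
Qed.

Lemma kern_trig s : trigpoly (kern s).
Proof.
elim: s => [|j s IH]; first exact: trig_cst.
rewrite kern_cons; apply: trig_mul => //; apply: trig_add; first exact: trig_cst.
rewrite (_ : cosc j = fun x => 1 * wave (delta_mx 0 j) 0 x); first exact: trig_wave.
by apply/funext => x; rewrite mul1r.
Qed.

Lemma kern_sp s : sp (kern s). Proof. exact/trig_sp/kern_trig. Qed.

Lemma kern_ge0 s x : 0 <= kern s x.
Proof.
elim: s => [|j s IH] //=; rewrite mulr_ge0//.
by rewrite coscE -lerBlDl sub0r cos_geN1.
Qed.

(** Differentiation lowers one factor [1 + cos] and produces [- sin]; multiplying by another [sin]
    restores it, because [sin^2 = (1 - cos)(1 + cos)]. *)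
Lemma kern_deriv j s x : sinc j x * partial j (kern s) x =
  - (count_mem j s)%:R * (1 - cosc j x) * kern s x.
Proof.
elim: s => [|i s IH].
  by rewrite (_ : kern [::] = fun=> 1)// partial_cst /=; ring.
rewrite kern_cons partialM; last 2 first.
- by apply: spD; [exact: sp_cst|exact: cosc_sp].
- exact: kern_sp.
rewrite partialD; [|exact: sp_cst|exact: cosc_sp].
rewrite partial_cst partial_cosc /= natrD (eq_sym i j).
have S : sinc j x ^+ 2 = (1 - cosc j x) * (1 + cosc j x).
  by rewrite sincE coscE sin2cos2; ring.
rewrite mulrDr [sinc j x * ((1 + _) * _)]mulrCA IH.
by case: eqP => [<-|_] /=; [move: S => /(congr1 (fun u => u * kern s x)); lra|ring].
Qed.

(** The integral of the derivative of [sinc j * kern s] vanishes, and by [kern_deriv] this is a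
    linear equation for the mass of [1 - cos]. So the concentration of the kernel at the origin is
    known exactly. *)
Lemma kern_mass j s :
  T (fun x => (1 - cosc j x) * kern s x) = T (kern s) / (count_mem j s).+1%:R.
Proof.
have sk := kern_sp s; have sc := cosc_sp j.
have s1 : sp (fun x => (1 - cosc j x) * kern s x).
  by apply: spM => //; apply: spB => //; exact: sp_cst.
have := T_partial j (spM (sinc_sp j) sk).
rewrite partialM//; last exact: sinc_sp.
rewrite partial_sinc eqxx.
have -> : (fun x => true%:R * cosc j x * kern s x + sinc j x * partial j (kern s) x) =
  (fun x => kern s x - (count_mem j s).+1%:R * ((1 - cosc j x) * kern s x)).
  by apply/funext => x; rewrite kern_deriv -addn1 natrD /=; ring.
rewrite TB ?TZ//; last exact: spZ.
move/eqP; rewrite subr_eq0 => /eqP ->.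
by rewrite mulrC mulKf.
Qed.

(** Writing [1 + cos = 2 - (1 - cos)], [kern_mass] shows that an additional factor multiplies the
    mass by at least 1. *)
Lemma kern_mass_gt0 s : 0 < T (kern s).
Proof.
elim: s => [|j s IH].
  rewrite (_ : kern [::] = fun=> 1)// T_cst mul1r exprn_gt0//.
  exact: twopi_gt0.
have sk := kern_sp s; have sc := cosc_sp j.
rewrite kern_cons (_ : (fun x => _) = fun x => 2 * kern s x - (1 - cosc j x) * kern s x).
  rewrite TB ?TZ//; [|exact: spZ|by apply: spM => //; apply: spB => //; exact: sp_cst].
  rewrite kern_mass subr_gt0 ltr_pdivrMr//.
  have : 1 <= (count_mem j s).+1%:R :> R by rewrite ler1n.
  by move: (_%:R) IH => c; nra.
by apply/funext => x; ring.
Qed.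

(** Strictly a correlation: the average of the translates of [phi] with weight [W]. In this form all
    derivatives in [x] fall on [phi]. *)
Definition torus_conv W phi x := T (fun y => phi (y + x) * W y).

Lemma spMtr W phi x : sp W -> sp phi -> sp (fun y => phi (y + x) * W y).
Proof. by move=> sW sphi; apply: spM => //; exact: sp_translate. Qed.

Lemma conv_qderiv W phi j : sp W -> sp phi ->
  qderiv j (torus_conv W phi) (torus_conv W (partial j phi)).
Proof.
move=> sW sphi.
have [B B0 fB] := qderivP (sp_qderiv j sphi); have [A A0 WA] := boundedP (sp_bounded sW).
exists (B * A * (2 * pi) ^+ N) => x h; rewrite /torus_conv.
have sp' := sp_partial j sphi.
rewrite -TB; [|exact: spMtr|exact: spMtr].
rewrite -TZ; last exact: spMtr.
rewrite -TB; last 2 first.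
- by apply: spB; exact: spMtr.
- exact/spZ/spMtr.
rewrite mulrAC; apply: T_bound => [|y].
  by apply: spB; [apply: spB; exact: spMtr|exact/spZ/spMtr].
have -> : phi (y + (x + h *: e_ j)) * W y - phi (y + x) * W y
    - h * (partial j phi (y + x) * W y) =
  (phi (y + x + h *: e_ j) - phi (y + x) - h * partial j phi (y + x)) * W y.
  by rewrite addrA; ring.
by rewrite normrM mulrAC ler_pM.
Qed.

Lemma conv_sp W phi : sp W -> sp phi -> sp (torus_conv W phi).
Proof.
move=> sW sphi; apply: (@sp_coind _ _ (fun f => exists2 phi, sp phi & f = torus_conv W phi)).
- move=> _ [f sf ->]; split.
    by move=> x j; rewrite /torus_conv; congr T; apply/funext => y; rewrite addrA sf.2.
  have [B fB] := sp_bounded sf; have [A WA] := sp_bounded sW.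
  exists (B * A * (2 * pi) ^+ N) => x; apply: T_bound => [|y]; first exact: spMtr.
  by rewrite normrM ler_pM.
- move=> _ j [f sf ->]; exists (torus_conv W (partial j f)).
    by exists (partial j f) => //; exact: sp_partial.
  exact: conv_qderiv.
- by exists phi.
Qed.

Lemma partial_conv W phi j : sp W -> sp phi ->
  partial j (torus_conv W phi) = torus_conv W (partial j phi).
Proof. by move=> sW sphi; apply/qderiv_partial/conv_qderiv. Qed.

Lemma convE W phi x : sp W -> sp phi -> torus_conv W phi x = T (fun y => phi y * W (y - x)).
Proof.
move=> sW sphi; rewrite -[RHS](T_translate x); last first.
  by apply: spM => //; exact: sp_translate.
by rewrite /torus_conv; congr T; apply/funext => y; rewrite addrK.
Qed.

(** By the addition formula, averaging against a wave of frequency [k] gives a combination of two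
    waves of frequency [k], whatever [phi] is; so [L] never has to be exchanged with an integral. *)
Lemma lin_conv_trig L W phi : linear_form L -> (forall k th, L (wave k th) = 0) ->
  trigpoly W -> sp phi -> L (torus_conv W phi) = 0.
Proof.
move=> lL L0 tW sphi; elim: tW => [c k th|f g tf IHf tg IHg]; last first.
  have sf := trig_sp tf; have sg := trig_sp tg.
  rewrite (_ : torus_conv _ _ = fun x => torus_conv f phi x + torus_conv g phi x).
    by rewrite linD// ?IHf ?IHg ?addr0//; exact: conv_sp.
  apply/funext => x; rewrite /torus_conv -TD; [|exact: spMtr|exact: spMtr].
  by congr T; apply/funext => y; rewrite mulrDr.
have sw th' := @wave_sp R N k th'.
pose A := c * T (fun y => phi y * wave k th y).
pose B := c * T (fun y => phi y * wave k (th - pi / 2) y).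
rewrite (_ : torus_conv _ _ = fun x => A * wave k 0 x + - B * wave k (pi / 2) x).
  by rewrite linD ?linZ ?L0 ?mulr0 ?addr0//; exact: spZ.
apply/funext => x; rewrite convE//; last exact: spZ.
rewrite (_ : (fun y => _) = fun y => c * (wave k 0 x) * (phi y * wave k th y) +
    - c * wave k (pi / 2) x * (phi y * wave k (th - pi / 2) y)).
  rewrite TD; [|by apply: spZ; exact: spM|by apply: spZ; exact: spM].
  by rewrite !TZ; [rewrite /A /B; ring|exact: spM|exact: spM].
apply/funext => y; rewrite waveD /wave -[- x]scaleN1r dotzZ mulN1r cosN sinN.
by rewrite addr0 cosDpihalf; ring.
Qed.

(** After reduction of [h] to [|h'| <= pi], the Lipschitz bound [B |h'|] is split by
    [B |h'| <= eps + B^2 h'^2 / eps], and [sqr_le_1Bcos] replaces the square. *)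
Lemma coord_osc phi j (eps : R) : sp phi -> 0 < eps ->
  exists2 C : R, 0 < C & forall x h, `|phi (x + h *: e_ j) - phi x| <= eps + C * (1 - cos h).
Proof.
move=> sphi e0; have [B B0 fB] := sp_lip j sphi; have [c c0 cc] := sqr_le_1Bcos R.
exists (B ^+ 2 * c / eps); first by rewrite divr_gt0// mulr_gt0// exprn_gt0.
have p2 := twopi_gt0 R; move=> x h.
(* The summand 1/2 rounds to the nearest period, which gives [|h'| <= pi]. *)
pose z := Num.floor (h / (2 * pi) + 1 / 2); pose h' := h - 2 * pi * z%:~R.
have hh : `|h'| <= pi.
  have := floor_itv (h / (2 * pi) + 1 / 2); rewrite -/z => /andP[z1 z2].
  have E : h = h / (2 * pi) * (2 * pi) by rewrite divfK// gt_eqF.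
  rewrite intrD in z2; rewrite ler_norml /h'.
  move: (h / (2 * pi)) z1 z2 E => u z1 z2 E.
  have H1 : z%:~R * (2 * pi) <= (u + 1 / 2) * (2 * pi) by rewrite ler_pM2r.
  have H2 : (u + 1 / 2) * (2 * pi) <= (z%:~R + 1) * (2 * pi) by rewrite ler_pM2r// ltW.
  by apply/andP; split; lra.
have -> : phi (x + h *: e_ j) = phi (x + h' *: e_ j).
  by rewrite -(periodic_addz j z (x + h' *: e_ j) sphi.2) -addrA -scalerDl subrK.
have <- : cos h' = cos h by rewrite -(cos_addz h' z) subrK.
rewrite (le_trans (fB x h'))//.
have := cc _ hh.
have : 0 <= (eps - B * `|h'|) ^+ 2 + eps ^+ 2 by rewrite addr_ge0// sqr_ge0.
have H3 : 0 <= B ^+ 2 by apply: sqr_ge0.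
move=> H1 /(ler_wpM2l H3); rewrite -(real_normK (num_real h')) => H2.
have H4 : 0 <= B ^+ 2 * `|h'| ^+ 2 by rewrite mulr_ge0// sqr_ge0.
have -> : eps + B ^+ 2 * c / eps * (1 - cos h') =
    (eps ^+ 2 + B ^+ 2 * (c * (1 - cos h'))) / eps.
  by field; rewrite gt_eqF.
rewrite ler_pdivlMr//; lra.
Qed.

Lemma conv_approx phi (d : R) : sp phi -> 0 < d ->
  exists m0 : nat, forall s, (forall j, (m0 <= count_mem j s)%N) ->
    forall x, `|torus_conv (kern s) phi x - phi x * T (kern s)| <= d * T (kern s).
Proof.
(* The [N] coordinates together use at most [d / 2]; [N.+1] keeps the quotient meaningful for
   [N = 0]. *)
move=> sphi d0; pose eps := d / (2 * N.+1%:R).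
have e0 : 0 < eps by rewrite divr_gt0// mulr_gt0.
have H j : exists C : R, 0 < C /\
    forall x h, `|phi (x + h *: e_ j) - phi x| <= eps + C * (1 - cos h).
  by have [C C0 ?] := coord_osc j sphi e0; exists C.
have [C CP] := choice H.
pose S := \sum_j C j; have S0 : 0 <= S by apply: sumr_ge0 => j _; rewrite ltW//; case: (CP j).
(* By [kern_mass] the terms in [1 - cos] contribute at most [S / m0] of the mass, and this choice
   makes it at most [d / 2]. *)
pose m0 := (Num.truncn (2 * S / d)).+1.
exists m0 => s ms x; have sk := kern_sp s.
have Tk := kern_mass_gt0 s.
pose G y := \sum_j (eps + C j * (1 - cosc j y)).
have sG : sp G.
  apply: sp_sum => j _; apply: spD; first exact: sp_cst.
  by apply: spZ; apply: spB; [exact: sp_cst|exact: cosc_sp].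
have TG : T (fun y => G y * kern s y) <= d * T (kern s).
  rewrite (_ : (fun y => _) = fun y => \sum_j (eps * kern s y + C j * ((1 - cosc j y) * kern s y))).
    have s1 j : sp (fun y => (1 - cosc j y) * kern s y).
      by apply: spM => //; apply: spB; [exact: sp_cst|exact: cosc_sp].
    rewrite T_sum; last by move=> j _; apply: spD; apply: spZ.
    have M0 : 0 < m0%:R :> R by rewrite ltr0n.
    apply: (@le_trans _ _ (\sum_j (eps * T (kern s) + C j * (T (kern s) / m0%:R)))).
      apply: ler_sum => j _; rewrite TD; [|exact: spZ|exact: spZ].
      rewrite !TZ// kern_mass lerD2l ler_pM2l; last by case: (CP j).
      by rewrite ler_pM2l// lef_pV2 ?posrE// ler_nat leqW.
    rewrite big_split/= sumr_const card_ord -mulr_suml -/S.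
    have E1 : eps * T (kern s) *+ N <= d / 2 * T (kern s).
      rewrite -mulrnAl ler_pM2r// -mulr_natr /eps invfM mulrA -mulrA.
      by rewrite ler_piMr ?divr_ge0 ?(ltW d0)// mulrC ler_pdivrMr// mul1r ler_nat.
    have E2 : S * (T (kern s) / m0%:R) <= d / 2 * T (kern s).
      rewrite mulrCA mulrC ler_pM2r// ler_pdivrMr// -ler_pdivrMl ?divr_gt0//.
      have := truncnS_gt (2 * S / d); rewrite -/m0 => /ltW; apply: le_trans.
      by rewrite invf_div mulrAC.
    by have := lerD E1 E2; lra.
  by apply/funext => y; rewrite mulr_suml; apply: eq_bigr => j _; ring.
have D y : - G y <= phi (y + x) - phi x <= G y.
  rewrite -ler_norml (addrC y) (le_trans (coord_bound (E := fun j h => eps + C j * (1 - cos h)) _ _ _))//.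
    by move=> j z h; case: (CP j).
  by apply: ler_sum => j _; rewrite coscE.
rewrite ler_norml /torus_conv -(TZ (phi x))// -TB; [|exact: spMtr|exact: spZ].
have s2 : sp (fun y => phi (y + x) * kern s y - phi x * kern s y).
  by apply: spB; [exact: spMtr|exact: spZ].
have s3 : sp (fun y => G y * kern s y) by apply: spM.
apply/andP; split.
  rewrite lerNl -TN//; apply: le_trans TG; apply: T_le => //; first exact: spN.
  move=> y; have := D y; have := kern_ge0 s y => k0 /andP[D1 _].
  by rewrite -mulrBl -mulNr ler_wpM2r// lerNl.
apply: le_trans TG; apply: T_le => // y.
by have := D y; have := kern_ge0 s y => k0 /andP[_ D1]; rewrite -mulrBl ler_wpM2r.
Qed.

Lemma ex_count (m : nat) : exists s : seq 'I_N, forall j, count_mem j s = m.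
Proof.
elim: m => [|m [s IH]]; first by exists [::].
exists (enum 'I_N ++ s) => j; rewrite count_cat IH count_uniq_mem ?enum_uniq//.
by rewrite mem_enum.
Qed.

Lemma conv_approx_Cm m phi (d : R) : sp phi -> 0 < d ->
  exists m0 : nat, forall s, (forall j, (m0 <= count_mem j s)%N) ->
    Cm_le m d (fun x => (T (kern s))^-1 * torus_conv (kern s) phi x - phi x).
Proof.
have base f : sp f -> 0 < d -> exists m0 : nat, forall s, (forall j, (m0 <= count_mem j s)%N) ->
    forall x, `|(T (kern s))^-1 * torus_conv (kern s) f x - f x| <= d.
  move=> sf d0; have [m0 H] := conv_approx sf d0; exists m0 => s ms x.
  have T0 := kern_mass_gt0 s.
  rewrite -(ler_pM2r T0) -[X in _ * X <= _](gtr0_norm T0) -normrM mulrBl mulrAC.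
  by rewrite mulVf ?gt_eqF// mul1r H.
move=> + d0; elim: m phi => [|m IH] phi sphi.
  by have [m0 H] := base _ sphi d0; exists m0 => s ms; apply/Cm_le0 => x; exact: H.
have [m0 H0] := base _ sphi d0.
have [m1 H1] := choice (fun j => IH _ (sp_partial j sphi)).
exists (m0 + \sum_j m1 j)%N => s ms; apply/Cm_leS; split=> [x|j].
  by apply: H0 => i; apply: leq_trans (ms i); rewrite leq_addr.
have sk := kern_sp s; have sc := conv_sp sk sphi.
rewrite partialB ?partialZ ?partial_conv//; last exact: spZ.
apply: H1 => i; apply: leq_trans (ms i).
by rewrite (bigD1 j)//= addnCA leq_addr.
Qed.

(** [L] vanishes on the kernel averages of [phi], which converge to [phi] in the [C^m] norm for the
    order [m] of [L]. *)
Theorem rdist_wave_eq0 L phi : rdist L -> (forall k th, L (wave k th) = 0) ->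
  sp phi -> L phi = 0.
Proof.
move=> [lL [C [m [C0 LC]]]] L0 sphi; apply/eqP; rewrite -normr_le0.
apply/ler_addgt0Pr => e e0; rewrite add0r.
have d0 : 0 < e / (C + 1) by rewrite divr_gt0// ltr_wpDl.
have [m0 H] := conv_approx_Cm m sphi d0; have [s sm] := ex_count m0.
have /LC := H s (fun j => eq_leq (esym (sm j))).
have sk := kern_sp s; have sc := conv_sp sk sphi.
rewrite linB ?linZ//; last exact: spZ.
rewrite (lin_conv_trig lL L0 (kern_trig s) sphi) mulr0 sub0r normrN => /(_ _)/le_trans; apply.
  by apply: spB => //; exact: spZ.
by rewrite mulrA ler_pdivrMr ?ltr_wpDl// mulrC ler_pM2l// lerDl.
Qed.

Lemma rdist_eq L L' phi : rdist L -> rdist L' ->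
  (forall k th, L (wave k th) = L' (wave k th)) -> sp phi -> L phi = L' phi.
Proof.
move=> dL dL' E sphi; apply: subr0_eq.
apply: (rdist_wave_eq0 (rdistB dL dL')) => // k th.
by rewrite E subrr.
Qed.

(** The averages of [f] against a bounded nonnegative kernel lie between 0 and a multiple of
    [T f = 0], and they approximate [f] uniformly. *)
Lemma T_eq0 f : sp f -> (forall x, 0 <= f x) -> T f = 0 -> f = fun=> 0.
Proof.
move=> sf f0 Tf; apply/funext => x; apply/eqP; rewrite eq_le f0 andbT.
apply/ler_addgt0Pr => e e0; rewrite add0r.
have [m0 H] := conv_approx_Cm 0 sf e0; have [s sm] := ex_count m0.
have /Cm_le0/(_ x) := H s (fun j => eq_leq (esym (sm j))).
have sk := kern_sp s; have [B B0 kB] := boundedP (sp_bounded sk).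
suff -> : torus_conv (kern s) f x = 0 by rewrite mulr0 sub0r normrN => /(le_trans (ler_norm _)).
have s1 : sp (fun y => f (y + x) * kern s y) by exact: spMtr.
apply/eqP; rewrite eq_le T_ge0//= ?andbT; last by move=> y; rewrite mulr_ge0// kern_ge0.
have -> : 0 = T (fun y => B * f (y + x)) :> R.
  by rewrite TZ ?T_translate ?Tf ?mulr0//; exact: sp_translate.
apply: T_le => //; first exact/spZ/sp_translate.
by move=> y; rewrite mulrC ler_wpM2r// (le_trans (ler_norm _)).
Qed.

(* Weakly symmetric on waves, hence everywhere by density. *)
Lemma partialC i j f : sp f -> partial i (partial j f) = partial j (partial i f).
Proof.
move=> sf; have s1 := sp_partial i (sp_partial j sf); have s2 := sp_partial j (sp_partial i sf).
pose g x := partial i (partial j f) x - partial j (partial i f) x.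
have sg : sp g by apply: spB.
suff Tg : T (fun x => g x * g x) = 0.
  have g0 x : 0 <= g x * g x by rewrite -expr2 sqr_ge0.
  have H := T_eq0 (spM sg sg) g0 Tg.
  apply/funext => x; apply: subr0_eq; have /eqP := congr1 (@^~ x) H.
  by rewrite /= mulf_eq0 orbb => /eqP.
apply: (rdist_wave_eq0 (T_rdist sg)) => // k th; have sw := @wave_sp R N k th.
have spi := sp_partial i sf; have spj := sp_partial j sf.
have D a b : T (fun x => wave k th x * partial a (partial b f) x) =
    (k 0 a)%:~R * (k 0 b)%:~R * T (fun x => wave k (th + pi / 2 + pi / 2) x * f x).
  have sw' := @wave_sp R N k (th + pi / 2).
  have sw'' := @wave_sp R N k (th + pi / 2 + pi / 2).
  rewrite (T_parts a sw (sp_partial b sf)) partial_wave (T_parts b (spZ _ sw') sf) opprK.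
  rewrite (partialZ b _ sw') partial_wave -TZ; last exact: spM.
  by congr T; apply/funext => x; ring.
have -> : T (fun x => g x * wave k th x) = T (fun x => wave k th x * partial i (partial j f) x)
    - T (fun x => wave k th x * partial j (partial i f) x).
  rewrite -(TB (spM sw s1) (spM sw s2)); congr T; apply/funext => x.
  by rewrite /g mulrBl [X in X - _]mulrC [X in _ - X]mulrC.
apply/eqP; rewrite subr_eq0; apply/eqP.
apply: (etrans (D i j)); apply: (etrans _ (esym (D j i))).
by congr (_ * _); exact: mulrC.
Qed.

(* Fubini for convolutions, obtained without iterated integrals from the density of waves. *)
Lemma T_conv W phi : sp W -> sp phi -> T (torus_conv W phi) = T phi * T W.
Proof.
move=> sW sphi.
have TW1 : rdist (fun phi => T W * T (fun x => 1 * phi x)).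
  have [l [C [m [C0 b]]]] := T_rdist (sp_cst N (1 : R)); split.
    by move=> c f g sf sg; rewrite l//; ring.
  exists (`|T W| * C), m; split; first exact: mulr_ge0.
  by move=> f M sf H; rewrite normrM -mulrA ler_wpM2l// b.
have TW2 : rdist (fun phi => T (torus_conv W phi)).
  split.
    move=> c f g sf sg; have cf := conv_sp sW sf; have cg := conv_sp sW sg.
    rewrite -(TZ c cf) -(TD (spZ c cf) cg); congr T; apply/funext => x.
    have mf := spMtr x sW sf; have mg := spMtr x sW sg.
    rewrite /torus_conv -(TZ c mf) -(TD (spZ c mf) mg).
    by congr T; apply/funext => y; ring.
  have [B B0 WB] := boundedP (sp_bounded sW).
  exists (B * (2 * pi) ^+ N * (2 * pi) ^+ N), 0%N; split.
    by rewrite !mulr_ge0 ?(ltW B0)// exprn_ge0// ltW// twopi_gt0.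
  move=> f M sf /Cm_le0 fM; rewrite mulrAC; apply: T_bound; first exact: conv_sp.
  move=> x; rewrite mulrAC; apply: T_bound; first exact: spMtr.
  by move=> y; rewrite mulrC normrM ler_pM.
rewrite (rdist_eq TW2 TW1 _ sphi) => [|k th].
  by rewrite mulrC; congr (T _ * _); apply/funext => x; rewrite mul1r.
under [in RHS]eq_fun do rewrite mul1r.
pose a th := T (fun y => wave k th y * W y).
have sw t : sp (wave k t) by exact: wave_sp.
rewrite (_ : torus_conv W _ = fun x => a th * wave k 0 x + a (th + pi / 2) * wave k (- (pi / 2)) x).
  rewrite TD ?TZ//; [|exact: spZ|exact: spZ].
  rewrite !T_wave; case: eqP => [k0|_]; last by rewrite !mulr0 addr0.
  rewrite cos0 cosN cos_pihalf (_ : a th = cos th * T W); first by ring.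
  rewrite /a -(TZ _ sW); congr T; apply/funext => x.
  by rewrite k0 /wave dotz0l add0r.
apply/funext => x; have m1 := spM (sw th) sW; have m2 := spM (sw (th + pi / 2)) sW.
rewrite /torus_conv /a (mulrC _ (wave k 0 x)) (mulrC _ (wave k (- (pi / 2)) x)).
rewrite -(TZ _ m1) -(TZ _ m2) -(TD (spZ _ m1) (spZ _ m2)).
congr T; apply/funext => y; rewrite waveD.
have -> : wave k 0 x = cos (dotz k x) by rewrite /wave addr0.
have -> : wave k (- (pi / 2)) x = sin (dotz k x) by rewrite /wave cosBpihalf.
have -> : wave k (th - pi / 2) y = - wave k (th + pi / 2) y.
  by rewrite /wave !addrA cosBpihalf cosDpihalf opprK.
ring.
Qed.

End Density.

(** * Fourier synthesis *)

Section Series.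
Variables (R : realType) (N : nat).
Implicit Types (x y : 'rV[R]_N) (j : 'I_N) (f g : 'rV[R]_N -> R).

Local Notation e_ k := (delta_mx 0 k : 'rV[R]_N).
Local Notation sp := (@smooth_torus R N).
Local Notation T := (@torus_integral R N).

Lemma le_harmonic (a b c : R) : (forall n : nat, a <= b + c / n.+1%:R) -> a <= b.
Proof.
move=> H; apply/ler_addgt0Pr => e e0.
have c0 : 0 < `|c| + 1 by rewrite ltr_wpDl.
pose n := Num.truncn ((`|c| + 1) / e).
rewrite (le_trans (H n))// lerD2l ler_pdivrMr// mulrC -ler_pdivrMr//.
have /ltW := truncnS_gt ((`|c| + 1) / e); rewrite -/n; apply: le_trans.
by rewrite ler_pM2r ?invr_gt0// (le_trans (ler_norm c))// lerDl.
Qed.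

(** A telescoping majorant of order [1 / K^2]: its sums are at most 1 and its tails are explicit. *)
Definition tele (K : nat) : R := (K.+1%:R * K.+2%:R)^-1.

Lemma teleE K : tele K = K.+1%:R^-1 - K.+2%:R^-1.
Proof.
rewrite /tele -[K.+2]addn1 natrD; have : K.+1%:R != 0 :> R by rewrite pnatr_eq0.
have : K.+1%:R + 1%:R != 0 :> R by rewrite -natrD pnatr_eq0.
by move: (K.+1%:R) => a a1 a0; field; rewrite a0 a1.
Qed.

Lemma sum_tele n : \sum_(K < n) tele K = 1 - n.+1%:R^-1.
Proof.
elim: n => [|n IH]; first by rewrite big_ord0 invr1 subrr.
by rewrite big_ord_recr /= IH teleE; ring.
Qed.

(** Since [tele] is a difference of reciprocals, the intervals [s n -/+ C / n.+1] are nested; the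
    limit is the supremum of their left ends. The explicit rate makes the convergence uniform when
    [g] depends on a point. *)
Lemma dominated_series (g : nat -> R) C : (forall K, `|g K| <= C * tele K) ->
  exists S, forall n, `|S - \sum_(K < n) g K| <= C / n.+1%:R.
Proof.
move=> gC.
pose s n := \sum_(K < n) g K; pose a n := s n - C / n.+1%:R; pose b n := s n + C / n.+1%:R.
have C0 : 0 <= C.
  have := le_trans (normr_ge0 _) (gC 0%N).
  by rewrite pmulr_lge0// /tele invr_gt0 mulr_gt0.
have st n : s n.+1 = s n + g n by rewrite /s big_ord_recr.
have gt n : - (C / n.+1%:R - C / n.+2%:R) <= g n <= C / n.+1%:R - C / n.+2%:R.
  by rewrite -ler_norml (le_trans (gC n))// teleE mulrBr.
have aS n : a n <= a n.+1.
  have /andP[+ _] := gt n; rewrite /a st.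
  by move: (C / n.+1%:R) (C / n.+2%:R) => u v; lra.
have bS n : b n.+1 <= b n.
  have /andP[_ +] := gt n; rewrite /b st.
  by move: (C / n.+1%:R) (C / n.+2%:R) => u v; lra.
have am n p : a n <= a (n + p)%N.
  by elim: p => [|p IH]; rewrite ?addn0// addnS (le_trans IH).
have bm n p : b (n + p)%N <= b n.
  by elim: p => [|p IH]; rewrite ?addn0// addnS (le_trans _ IH).
have ab n p : a n <= b p.
  rewrite (le_trans (am n p))// (le_trans _ (bm p n))// addnC /a /b.
  have : 0 <= C / (p + n).+1%:R by rewrite divr_ge0.
  by move: (C / (p + n).+1%:R) (s (p + n)%N) => u v; lra.
have hs : has_sup (range a).
  by split; [exists (a 0%N), 0%N|exists (b 0%N) => _ [n _ <-]].
exists (sup (range a)) => n; rewrite -/(s n) ler_norml.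
have : a n <= sup (range a) by apply: ub_le_sup; [case: hs|exists n].
have : sup (range a) <= b n by apply: sup_le_ub; [case: hs|move=> _ [p _ <-]].
by rewrite /a /b; move: (C / n.+1%:R) => u H1 H2; apply/andP; split; lra.
Qed.

Definition summable_family (G : nat -> 'rV[R]_N -> R) := (forall K, sp (G K)) /\
  forall s, exists C : R, forall K x, `|partials s (G K) x| <= C * tele K.

Definition sums_to (G : nat -> 'rV[R]_N -> R) f :=
  exists C : R, forall n x, `|f x - \sum_(K < n) G K x| <= C / n.+1%:R.

Lemma summable_sums G : summable_family G -> exists f, sums_to G f.
Proof.
move=> [_ /(_ [::])[C GC]].
have [f fP] := choice (fun x => @dominated_series (fun K => G K x) C (fun K => GC K x)).
by exists f, C => n x; exact: fP.
Qed.

Lemma summable_partial j G : summable_family G -> summable_family (fun K => partial j (G K)).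
Proof.
move=> [sG bG]; split=> [K|s]; first exact: sp_partial.
by have [C GC] := bG (rcons s j); exists C => K x; rewrite -partials_rcons.
Qed.

(** The second derivatives of the terms sum to at most [B], so all partial sums share the remainder
    [B h^2]; it survives the limit. *)
Lemma sums_qderiv j G f f' : summable_family G -> sums_to G f ->
  sums_to (fun K => partial j (G K)) f' -> qderiv j f f'.
Proof.
move=> [sG bG] [C fC] [C' fC'].
have [B GB] := bG [:: j; j].
have B0 : 0 <= B.
  have := le_trans (normr_ge0 _) (GB 0%N 0).
  by rewrite pmulr_lge0// /tele invr_gt0 mulr_gt0.
exists B => x h; apply: (@le_harmonic _ _ (C + C + `|h| * C')) => n.
pose s y := \sum_(K < n) G K y; pose s' y := \sum_(K < n) partial j (G K) y.
set y := x + _.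
have -> : f y - f x - h * f' x = (f y - s y) - (f x - s x) - h * (f' x - s' x)
   + (s y - s x - h * s' x) by ring.
have E : `|s y - s x - h * s' x| <= B * h ^+ 2.
  rewrite /s /s' mulr_sumr -!sumrB (le_trans (ler_norm_sum _ _ _))//.
  apply: (@le_trans _ _ (\sum_(K < n) B * h ^+ 2 * tele K)).
    apply: ler_sum => K _; rewrite mulrAC; apply: sp_taylor => // z.
    exact: GB.
  have i1 : 1 - n.+1%:R^-1 <= 1 :> R by rewrite gerBl.
  by rewrite -mulr_sumr sum_tele ler_piMr// mulr_ge0// sqr_ge0.
have H1 := fC n y; have H2 := fC n x; have H3 := fC' n x.
have H4 : `|h * (f' x - s' x)| <= `|h| * (C' / n.+1%:R) by rewrite normrM ler_wpM2l.
rewrite (_ : B * _ + _ = C / n.+1%:R + C / n.+1%:R + `|h| * (C' / n.+1%:R) + B * h ^+ 2).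
  rewrite (le_trans (ler_normD _ _))// lerD//.
  rewrite (le_trans (ler_normB _ _))// lerD//.
  by rewrite (le_trans (ler_normB _ _))// lerD.
by rewrite !mulrDl -mulrA addrC.
Qed.

Lemma sums_sp G f : summable_family G -> sums_to G f -> sp f.
Proof.
move=> GG Gf; apply: (@sp_coind _ _ (fun f => exists2 G, summable_family G & sums_to G f)).
- move=> {GG Gf} {}f [{}G [sG bG] [C fC]]; split.
    move=> x k; apply/eqP; rewrite -subr_eq0 -normr_le0.
    apply: (@le_harmonic _ _ (C + C)) => n; rewrite add0r.
    set y := x + _.
    have E : \sum_(K < n) G K y = \sum_(K < n) G K x.
      by apply: eq_bigr => K _; rewrite /y (sG K).2.
    rewrite -(subrKA (\sum_(K < n) G K y)) mulrDl (le_trans (ler_normD _ _))// lerD//.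
    by rewrite E distrC.
  exists C => x; have := fC 0%N x.
  by rewrite big_ord0 subr0 invr1 mulr1.
- move=> {GG Gf} {}f j [{}G GG Gf]; have GG' := summable_partial j GG.
  have [f' Gf'] := summable_sums GG'.
  by exists f'; [exists (fun K => partial j (G K))|exact: sums_qderiv Gf'].
- by exists G.
Qed.

Lemma T_sums G f phi : summable_family G -> sums_to G f -> sp phi ->
  exists C : R, forall n, `|T (fun x => f x * phi x) - \sum_(K < n) T (fun x => G K x * phi x)|
    <= C / n.+1%:R.
Proof.
move=> GG Gf sphi; have sf := sums_sp GG Gf; have [C fC] := Gf; have [sG _] := GG.
have [B B0 pB] := boundedP (sp_bounded sphi).
exists (C * B * (2 * pi) ^+ N) => n.
have sS : sp (fun x => \sum_(K < n) G K x) by apply: sp_sum.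
have -> : \sum_(K < n) T (fun x => G K x * phi x) =
  T (fun x => (\sum_(K < n) G K x) * phi x).
  rewrite -T_sum; last by move=> K _; exact: spM.
  by congr T; apply/funext => x; rewrite mulr_suml.
rewrite -TB; [|exact: spM|exact: spM].
rewrite mulrAC; apply: T_bound; first by apply: spB; exact: spM.
move=> x; rewrite -mulrBl normrM mulrAC; apply: ler_pM => //.
Qed.

End Series.

(** * Frequencies grouped by their maximum norm *)

Section Shells.
Variables (R : realType) (N : nat).
Implicit Types (k l : 'rV[int]_N).

Definition maxn_mx k : nat := \max_j absz (k 0%R j).

Lemma maxn_mxN k : maxn_mx (- k) = maxn_mx k.
Proof. by apply: eq_bigr => j _; rewrite mxE abszN. Qed.

Definition box_pt K (c : {ffun 'I_N -> 'I_K.*2.+1}) : 'rV[int]_N :=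
  \row_i ((c i)%:Z - K%:Z).

Lemma box_pt_inj K : injective (@box_pt K).
Proof.
move=> c d /rowP E; apply/ffunP => i; apply/val_inj => /=.
have := E i; rewrite !mxE => /addIr; by case.
Qed.

(** Turns a sum over the lattice into an ordinary series of finite sums. A shell is stable under
    [k -> - k], which the real modes require. *)
Definition shell K := [seq k <- map (@box_pt K) (enum {: {ffun 'I_N -> 'I_K.*2.+1}}) | maxn_mx k == K].

Lemma shell_uniq K : uniq (shell K).
Proof. by rewrite filter_uniq// map_inj_uniq ?enum_uniq//; exact: box_pt_inj. Qed.

Lemma mem_shell K k : (k \in shell K) = (maxn_mx k == K).
Proof.
rewrite mem_filter; case: eqP => //= kK; apply/mapP.
have H i : (absz (k 0 i + K%:Z)%R < K.*2.+1)%N.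
  have : (absz (k 0%R i) <= K)%N by rewrite -kK; exact: (leq_bigmax i).
  lia.
exists [ffun i => Ordinal (H i)]; first by rewrite mem_enum.
apply/rowP => i; rewrite !mxE ffunE /=.
have : (absz (k 0%R i) <= K)%N by rewrite -kK; exact: (leq_bigmax i).
lia.
Qed.

Lemma size_shell K : (size (shell K) <= (K.*2.+1) ^ N)%N.
Proof.
rewrite size_filter (leq_trans (count_size _ _))// size_map -cardE.
by rewrite card_ffun !card_ord.
Qed.

Lemma shell_wt K k : maxn_mx k = K -> K.+1%:R <= wt R k.
Proof.
move=> <-; rewrite -natr1 addrC lerD2l.
apply: (@le_trans _ _ (\sum_j absz (k 0%R j))%N%:R).
  rewrite ler_nat; apply/bigmax_leqP => j _.
  by rewrite (bigD1 j)//= leq_addr.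
rewrite natr_sum; apply: ler_sum => j _.
by rewrite -intr_norm natr_absz.
Qed.

End Shells.

(** * Distributions with rapidly decreasing coefficients are smooth functions *)

Section Fourier.
Variables (R : realType) (N : nat).
Implicit Types (x y : 'rV[R]_N) (j : 'I_N) (k l : 'rV[int]_N) (f g : 'rV[R]_N -> R) (th : R).

Local Notation sp := (@smooth_torus R N).
Local Notation T := (@torus_integral R N).

Lemma partialsD s f g : sp f -> sp g ->
  partials s (fun x => f x + g x) = fun x => partials s f x + partials s g x.
Proof.
move=> sf sg; elim/last_ind: s f g sf sg => [//|s j IH] f g sf sg.
by rewrite !partials_rcons partialD// IH//; exact: sp_partial.
Qed.

Lemma partialsZ s c f : sp f -> partials s (fun x => c * f x) = fun x => c * partials s f x.
Proof.
move=> sf; elim/last_ind: s f sf => [//|s j IH] f sf.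
by rewrite !partials_rcons partialZ// IH//; exact: sp_partial.
Qed.

Lemma partials_sum (I : Type) (r : seq I) s (F : I -> 'rV[R]_N -> R) :
  (forall i, sp (F i)) ->
  partials s (fun x => \sum_(i <- r) F i x) = fun x => \sum_(i <- r) partials s (F i) x.
Proof.
move=> sF; elim: r => [|i r IH].
  rewrite (_ : (fun x => _) = fun x => 0 * (0 : R)).
    rewrite (partialsZ s 0 (@sp_cst R N 0)).
    by apply/funext => x; rewrite big_nil mul0r.
  by apply/funext => x; rewrite big_nil mul0r.
rewrite (_ : (fun x => _) = fun x => F i x + \sum_(i <- r) F i x).
  by rewrite partialsD ?IH//; [apply/funext => x; rewrite big_cons|exact: sp_sum].
by apply/funext => x; rewrite big_cons.
Qed.

Definition rapid (L : ('rV[R]_N -> R) -> R) :=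
  forall m, exists C : R, forall k th, `|L (wave k th)| * wt R k ^+ m <= C.

Section Synthesis.
Variable L : ('rV[R]_N -> R) -> R.
Hypotheses (dL : rdist L) (rL : rapid L).

(* [mode k x] is [L] applied to [y |-> cos (k . (x - y))]. *)
Definition mode k x := L (wave k 0) * wave k 0 x + L (wave k (- (pi / 2))) * wave k (- (pi / 2)) x.

Lemma mode_sp k : sp (mode k).
Proof. by apply: spD; apply/spZ/wave_sp. Qed.

Definition shell_mode K x := ((2 * pi) ^+ N)^-1 * \sum_(k <- shell N K) mode k x.

Lemma shell_mode_sp K : sp (shell_mode K).
Proof. by apply/spZ/sp_sum => k _; exact: mode_sp. Qed.

Lemma shell_mode_summable : summable_family shell_mode.
Proof.
split=> [|s]; first exact: shell_mode_sp.
(* The exponent pays for the derivatives [s], for the number of points of a shell ([N]), and for the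
   majorant [tele] (2). *)
have [C LC] := rL (size s + N.+2).
have C0 : 0 <= C by rewrite (le_trans _ (LC 0 0))// mulr_ge0// exprn_ge0// ltW// wt_gt0.
have p0 : 0 < (2 * pi) ^+ N :> R by rewrite exprn_gt0// twopi_gt0.
(* [2 ^ N] comes from [2 K + 1 <= 2 (K + 1)], [C + C] from the two terms of a mode, and the last 2
   from [K + 2 <= 2 (K + 1)]. *)
exists (((2 * pi) ^+ N)^-1 * (2 ^+ N * (C + C) * 2)) => K x.
have K0 : 0 < K.+1%:R :> R by rewrite ltr0n.
rewrite partialsZ; last by apply: sp_sum => k _; exact: mode_sp.
rewrite partials_sum; last exact: mode_sp.
rewrite normrM gtr0_norm ?invr_gt0// -[leRHS]mulrA ler_pM2l ?invr_gt0//.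
have M k : k \in shell N K -> `|partials s (mode k) x| <= (C + C) / K.+1%:R ^+ N.+2.
  rewrite mem_shell => /eqP/(shell_wt R) kK.
  have wk := wt_gt0 R k.
  have H t : `|L (wave k t)| * wt R k ^+ size s <= C / K.+1%:R ^+ N.+2.
    have := LC k t; rewrite exprD mulrA => H; rewrite ler_pdivlMr ?exprn_gt0//.
    apply: le_trans H; rewrite ler_wpM2l ?mulr_ge0 ?exprn_ge0 ?(ltW wk)//.
    by rewrite lerXn2r ?nnegrE// ltW.
  have sw t := @wave_sp R N k t.
  rewrite /mode (partialsD s (spZ _ (sw 0)) (spZ _ (sw (- (pi / 2))))).
  rewrite (partialsZ s _ (sw 0)) (partialsZ s _ (sw (- (pi / 2)))).
  rewrite (le_trans (ler_normD _ _))// [leRHS]mulrDl !normrM.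
  apply: lerD; [apply: le_trans (H 0)|apply: le_trans (H (- (pi / 2)))];
    (rewrite ler_wpM2l//; exact: partials_wave_le).
rewrite (le_trans (ler_norm_sum _ _ _))//.
apply: (@le_trans _ _ (\sum_(k <- shell N K) (C + C) / K.+1%:R ^+ N.+2)).
  by rewrite big_seq [leRHS]big_seq; apply: ler_sum.
rewrite big_const_seq count_predT iter_addr_0.
have Q0 : 0 <= (C + C) / K.+1%:R ^+ N.+2 by rewrite divr_ge0 ?addr_ge0// exprn_ge0// ltW.
apply: (@le_trans _ _ ((2 * K.+1%:R) ^+ N * ((C + C) / K.+1%:R ^+ N.+2))).
  rewrite -(mulr_natl _ (size (shell N K))) ler_wpM2r//.
  apply: (@le_trans _ _ ((K.*2.+1) ^ N)%:R); first by rewrite ler_nat size_shell.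
  rewrite natrX lerXn2r ?nnegrE ?mulr_ge0//.
  by rewrite -natrM ler_nat; lia.
rewrite exprMn -[N.+2]addn2 exprD invfM.
have Kn : K.+1%:R ^+ N != 0 :> R by rewrite expf_neq0// gt_eqF.
rewrite (_ : _ * _ = 2 ^+ N * (C + C) * (K.+1%:R ^+ 2)^-1); last by field; rewrite Kn gt_eqF.
rewrite -[leRHS]mulrA ler_wpM2l ?mulr_ge0 ?addr_ge0 ?exprn_ge0//.
rewrite /tele expr2 !invfM [leRHS]mulrCA ler_pM2l ?invr_gt0//.
by rewrite ler_pdivlMr ?ltr0n// mulrC ler_pdivrMr// -natrM ler_nat; lia.
Qed.

Lemma L_wave l th : L (wave l th) =
  L (wave l 0) * cos th - L (wave l (- (pi / 2))) * sin th.
Proof.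
have [lL _] := dL; have sw t := @wave_sp R N l t.
rewrite (_ : wave l th = fun x => cos th * wave l 0 x + - sin th * wave l (- (pi / 2)) x).
  by rewrite linD ?linZ//; [ring|exact: spZ|exact: spZ].
by apply/funext => x; rewrite /wave cosBpihalf addr0 cosD; ring.
Qed.

(** [k] and [- k] carry the same mode, so over a symmetric set of frequencies each mode is met twice
    (for [l = 0] both indicators hit the same [k]). This compensates the factor 1/2, and no half of
    the lattice has to be selected. *)
Lemma T_mode k l th : T (fun x => mode k x * wave l th x) =
  2^-1 * (2 * pi) ^+ N * (((k == - l)%:R + (k == l)%:R) * L (wave l th)).
Proof.
have sw l' t := @wave_sp R N l' t.
rewrite (_ : (fun x => _) = fun x => L (wave k 0) * (wave k 0 x * wave l th x) +
   L (wave k (- (pi / 2))) * (wave k (- (pi / 2)) x * wave l th x)); last first.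
  by apply/funext => x; rewrite /mode; ring.
rewrite TD; [|by apply/spZ/spM|by apply/spZ/spM].
rewrite !TZ; [|exact: spM|exact: spM].
rewrite !T_waveM add0r sub0r cosN.
rewrite [- (pi / 2) + th]addrC cosBpihalf -opprD cosN [pi / 2 + th]addrC cosDpihalf.
have E1 : k = - l -> L (wave k 0) * cos th + L (wave k (- (pi / 2))) * sin th = L (wave l th).
  move=> ->; rewrite (L_wave l th) (_ : wave (- l) 0 = wave l 0); last first.
    by apply/funext => x; rewrite waveN oppr0.
  rewrite (_ : wave (- l) (- (pi / 2)) = fun x => - wave l (- (pi / 2)) x).
    by case: dL => lL _; rewrite (linN lL (sw l _)) mulNr.
  by apply/funext => x; rewrite waveN opprK /wave cosDpihalf cosBpihalf.
have E2 : k = l -> L (wave k 0) * cos th - L (wave k (- (pi / 2))) * sin th = L (wave l th).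
  by move=> ->; rewrite (L_wave l th).
move: E1 E2; move: (L (wave l th)) => u.
case: (k =P - l) => [kl /(_ kl) H1|_ _]; case: (k =P l) => [kl' /(_ kl') H2|_ _] /=.
- have <- : L (wave k 0) * cos th = u by lra.
  by ring.
- by rewrite -H1; ring.
- by rewrite -H2; ring.
- by ring.
Qed.

Lemma T_shell_mode K l th : T (fun x => shell_mode K x * wave l th x) =
  (maxn_mx l == K)%:R * L (wave l th).
Proof.
have sw := @wave_sp R N l th.
rewrite (_ : (fun x => _) = fun x => ((2 * pi) ^+ N)^-1 *
    \sum_(k <- shell N K) mode k x * wave l th x); last first.
  by apply/funext => x; rewrite /shell_mode -mulrA mulr_suml.
rewrite TZ; last by apply: sp_sum => k _; apply: spM => //; exact: mode_sp.
rewrite T_sum; last by move=> k _; apply: spM => //; exact: mode_sp.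
under eq_bigr do rewrite T_mode.
rewrite -mulr_sumr -mulr_suml big_split/=.
have C l' : \sum_(k <- shell N K) (k == l')%:R = (maxn_mx l' == K)%:R :> R.
  rewrite -natr_sum -mem_shell -count_uniq_mem ?shell_uniq// -sum1_count.
  by rewrite [in RHS]big_mkcond/=; congr (_%:R); apply: eq_bigr => k _; case: eqP.
rewrite !C maxn_mxN; have : (2 * pi) ^+ N != 0 :> R by rewrite expf_neq0// gt_eqF// twopi_gt0.
by move=> p0; field.
Qed.

Theorem rapid_rsmooth : rsmooth L.
Proof.
have SS := shell_mode_summable; have [f Sf] := summable_sums SS.
have sf := sums_sp SS Sf; exists f => // phi sphi.
apply: (rdist_eq dL (T_rdist sf)) => // l th.
have [C TC] := T_sums SS Sf (wave_sp l th).
apply/eqP; rewrite eq_sym -subr_eq0 -normr_le0.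
apply: (@le_harmonic _ _ _ C) => n; rewrite add0r.
(* With at least this many shells the one of [l] is included, and it is the only one that
   contributes. *)
have := TC ((maxn_mx l).+1 + n)%N.
rewrite (eq_bigr (fun K : 'I__ => (maxn_mx l == K)%:R * L (wave l th))); last first.
  by move=> K _; rewrite T_shell_mode.
rewrite -mulr_suml (_ : \sum_K _ = 1) ?mul1r.
  move=> H; rewrite (le_trans H)// ler_pdivrMr// mulrAC ler_pdivlMr//.
  have C0 : 0 <= C by have := le_trans (normr_ge0 _) H; rewrite pmulr_lge0// invr_gt0.
  by rewrite ler_wpM2l// ler_nat; lia.
have lt : (maxn_mx l < (maxn_mx l).+1 + n)%N by lia.
rewrite (bigD1 (Ordinal lt))//= eqxx big1 ?addr0// => K /negbTE.
by rewrite -val_eqE /= eq_sym => ->.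
Qed.

End Synthesis.

End Fourier.

(** * Shears and tube vector fields *)

Section Tube.
Variables (R : realType) (n : nat).
Implicit Types (p q : 'rV[R]_(n + 1)) (t : 'rV[R]_n) (j : 'I_n).
Implicit Types (phi psi f : 'rV[R]_(n + 1) -> R) (g A b : 'rV[R]_n -> R).

Local Notation sp1 := (@smooth_torus R (n + 1)).
Local Notation spn := (@smooth_torus R n).
Local Notation T1 := (@torus_integral R (n + 1)).
Local Notation Tn := (@torus_integral R n).
Definition xdir : 'I_(n + 1) := rshift n ord0.
Local Notation ex := (delta_mx 0 xdir : 'rV[R]_(n + 1)).
Local Notation et j := (delta_mx 0 (lshift 1 j) : 'rV[R]_(n + 1)).

Lemma tube_dirP (i : 'I_(n + 1)) : (exists j, i = lshift 1 j) \/ i = xdir.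
Proof.
case: (split_ordP i) => [j ->|j ->]; first by left; exists j.
by right; rewrite (ord1 j).
Qed.

Lemma lsubmx_et p (h : R) j : lsubmx (p + h *: et j) = lsubmx p + h *: delta_mx 0 j.
Proof.
by apply/rowP => i; rewrite !mxE/=; congr (_ + _ * _%:R); rewrite -!val_eqE.
Qed.

Lemma lsubmx_ex p (h : R) : lsubmx (p + h *: ex) = lsubmx p.
Proof.
apply/rowP => i; rewrite !mxE/=.
by rewrite (_ : _ == _ = false) ?mulr0 ?addr0// -val_eqE/= addn0 ltn_eqF.
Qed.

Definition pull g p := g (lsubmx p).

Lemma pull_qderiv g j : spn g -> qderiv (lshift 1 j) (pull g) (pull (partial j g)).
Proof.
move=> sg; have [B gB] := sp_qderiv j sg; exists B => p h.
by rewrite /pull lsubmx_et gB.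
Qed.

Lemma pull_qderivx g : qderiv xdir (pull g) (fun=> 0).
Proof. by exists 0 => p h; rewrite /pull lsubmx_ex mulr0 subr0 subrr normr0 mul0r. Qed.

Lemma pull_sp g : spn g -> sp1 (pull g).
Proof.
move=> sg; apply: (@sp_coind _ _ (fun f => exists2 g, spn g & f = pull g)); last by exists g.
- move=> _ {sg}[{}g sg ->]; split; last by have [B gB] := sp_bounded sg; exists B => p; exact: gB.
  move=> p i; case: (tube_dirP i) => [[j ->]|->]; rewrite /pull.
    by rewrite lsubmx_et sg.2.
  by rewrite lsubmx_ex.
- move=> _ i {sg}[{}g sg ->]; case: (tube_dirP i) => [[j ->]|->].
    exists (pull (partial j g)); last exact: pull_qderiv.
    by exists (partial j g) => //; exact: sp_partial.
  by exists (fun=> 0); [exists (fun=> 0) => //; exact: sp_cst|exact: pull_qderivx].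
Qed.

Lemma partial_pull g j : spn g -> partial (lshift 1 j) (pull g) = pull (partial j g).
Proof. by move=> sg; apply/qderiv_partial/pull_qderiv. Qed.

Lemma partialx_pull g : partial xdir (pull g) = fun=> 0.
Proof. exact/qderiv_partial/pull_qderivx. Qed.

Definition shear A phi p := phi (p + A (lsubmx p) *: ex).

Lemma shearK A phi : shear (fun t => - A t) (shear A phi) = phi.
Proof.
by apply/funext => p; rewrite /shear lsubmx_ex -addrA -scalerDl addNr scale0r addr0.
Qed.

Lemma shearKV A phi : shear A (shear (fun t => - A t) phi) = phi.
Proof.
by apply/funext => p; rewrite /shear lsubmx_ex -addrA -scalerDl addrN scale0r addr0.
Qed.

Lemma shearM A phi psi :
  shear A (fun p => phi p * psi p) = fun p => shear A phi p * shear A psi p.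
Proof. by []. Qed.

Lemma shear_qderivx A phi : sp1 phi -> qderiv xdir (shear A phi) (shear A (partial xdir phi)).
Proof.
move=> sphi; have [B fB] := sp_qderiv xdir sphi; exists B => p h.
by rewrite /shear lsubmx_ex (addrAC p) fB.
Qed.

Lemma shear_qderiv A phi j : spn A -> sp1 phi ->
  qderiv (lshift 1 j) (shear A phi)
    (fun p => shear A (partial (lshift 1 j) phi) p
              + pull (partial j A) p * shear A (partial xdir phi) p).
Proof.
move=> sA sphi; have spx := sp_partial xdir sphi.
have [B1 B10 H1] := qderivP (sp_qderiv xdir sphi).
have [B2 B20 H2] := qderivP (sp_qderiv (lshift 1 j) sphi).
have [B3 B30 H3] := sp_lip (lshift 1 j) spx.
have [B4 B40 H4] := qderivP (sp_qderiv j sA).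
have [B5 B50 H5] := sp_lip j sA.
have [B6 B60 H6] := boundedP (sp_bounded spx).
exists (B1 * B5 ^+ 2 + B2 + B5 * B3 + B4 * B6) => p h.
rewrite /shear /pull lsubmx_et; set t := lsubmx p.
pose d := A (t + h *: delta_mx 0 j) - A t.
have -> : p + h *: et j + A (t + h *: delta_mx 0 j) *: ex =
    p + A t *: ex + h *: et j + d *: ex.
  by apply/rowP => i; rewrite !mxE /d; ring.
set q := p + A t *: ex.
have Hd : `|d| <= B5 * `|h| by exact: H5.
have K1 := H1 (q + h *: et j) d; have K2 := H2 q h; have K3 := H3 q h.
have K4 := H4 t h; have K6 := H6 q; rewrite -/d in K4.
move: (phi _) (phi (q + h *: et j)) (phi q) (partial xdir phi (q + _)) (partial xdir phi q)
  (partial (lshift 1 j) phi q) (partial j A t) K1 K2 K3 K4 K6 => a1 a2 a3 c1 c2 c3 c4 K1 K2 K3 K4 K6.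
(* Four errors of order [h^2]: the move by [d] in [x], the move by [h] in [t_j], the change of the
   [x]-derivative between the two base points, and the Taylor remainder of [A]. Each uses [d = O(h)]
   where [d] occurs quadratically. *)
have -> : a1 - a3 - h * (c3 + c4 * c2) = (a1 - a2 - d * c1) + (a2 - a3 - h * c3)
  + d * (c1 - c2) + (d - h * c4) * c2 by ring.
have h2 : `|h| * `|h| = h ^+ 2 by rewrite -expr2 real_normK ?num_real.
rewrite [leRHS](_ : _ = B1 * B5 ^+ 2 * h ^+ 2 + B2 * h ^+ 2 + B5 * B3 * h ^+ 2
  + B4 * B6 * h ^+ 2); last by ring.
rewrite (le_trans (ler_normD _ _))// lerD//; last first.
  by rewrite normrM mulrAC ler_pM.
rewrite (le_trans (ler_normD _ _))// lerD//; last first.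
  rewrite normrM -h2 (_ : B5 * B3 * _ = (B5 * `|h|) * (B3 * `|h|)); last by ring.
  exact: ler_pM.
rewrite (le_trans (ler_normD _ _))// lerD// (le_trans K1)// -mulrA ler_pM2l//.
rewrite -(real_normK (num_real d)) -(real_normK (num_real h)) -exprMn.
by rewrite lerXn2r ?nnegrE// mulr_ge0// ltW.
Qed.

Lemma shear_sp A phi : spn A -> sp1 phi -> sp1 (shear A phi).
Proof.
move=> sA sphi.
(* The chain rule multiplies a sheared function by a derivative of [A], so both kinds of functions
   are taken as generators. *)
pose P f := sp1 f \/ exists2 phi, sp1 phi & f = shear A phi.
suff : alg P (shear A phi).
  apply: alg_sp => [f|f i] [sf|[psi spsi ->]].
  - by split; [case: sf|exact: sp_bounded].
  - split; last by have [B pB] := sp_bounded spsi; exists B => p; exact: pB.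
    move=> p i; rewrite /shear; case: (tube_dirP i) => [[j ->]|->].
      by rewrite lsubmx_et sA.2 (addrAC p) spsi.2.
    by rewrite lsubmx_ex (addrAC p) spsi.2.
  - exists (partial i f); last exact: sp_qderiv.
    by apply: alg_gen; left; exact: sp_partial.
  - case: (tube_dirP i) => [[j ->]|->].
      exists (fun p => shear A (partial (lshift 1 j) psi) p
                + pull (partial j A) p * shear A (partial xdir psi) p).
        apply: alg_add; first by apply: alg_gen; right; exists (partial (lshift 1 j) psi) => //; exact: sp_partial.
        apply: alg_mul; first by apply: alg_gen; left; exact/pull_sp/sp_partial.
        by apply: alg_gen; right; exists (partial xdir psi) => //; exact: sp_partial.
      exact: shear_qderiv.
    exists (shear A (partial xdir psi)); last exact: shear_qderivx.
    by apply: alg_gen; right; exists (partial xdir psi) => //; exact: sp_partial.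
by apply: alg_gen; right; exists phi.
Qed.

Lemma partialx_shear A phi : sp1 phi -> partial xdir (shear A phi) = shear A (partial xdir phi).
Proof. by move=> sphi; apply/qderiv_partial/shear_qderivx. Qed.

Lemma partial_shear A phi j : spn A -> sp1 phi -> partial (lshift 1 j) (shear A phi) =
  fun p => shear A (partial (lshift 1 j) phi) p
           + pull (partial j A) p * shear A (partial xdir phi) p.
Proof. by move=> sA sphi; apply/qderiv_partial/shear_qderiv. Qed.

Lemma shear_Cm_le A m : spn A -> exists2 C : R, 0 <= C &
  forall phi (M : R), sp1 phi -> Cm_le m M phi -> Cm_le m (C * M) (shear A phi).
Proof.
move=> sA; elim: m => [|m [C C0 IH]].
  exists 1 => // phi M sphi /Cm_le0 H; apply/Cm_le0 => p; rewrite mul1r; exact: H.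
have H j : exists K : R, 0 < K /\ Cm_le m K (pull (partial j A)).
  by have [K K0 ?] := sp_Cm_le m (pull_sp (sp_partial j sA)); exists K.
have [K KP] := choice H.
have K0 : 0 <= \sum_j K j by apply: sumr_ge0 => j _; rewrite ltW//; case: (KP j).
pose D := 2 ^+ m * ((\sum_j K j) * C).
have D0 : 0 <= D by rewrite !mulr_ge0// exprn_ge0.
exists (1 + C + D); first by rewrite !addr_ge0.
move=> phi M sphi HM; have M0 := Cm_le_ge0 HM.
have [HM0 HM'] := (Cm_leS _ _ _).1 HM.
apply/Cm_leS; split=> [p|i].
  rewrite (le_trans (HM0 _))// !mulrDl mul1r -addrA lerDl.
  by rewrite addr_ge0// mulr_ge0.
case: (tube_dirP i) => [[j ->]|->].
  rewrite partial_shear//.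
  apply: (@Cm_le_weak _ _ m m (C * M + 2 ^+ m * ((\sum_j K j) * (C * M)))) => //.
    have : 0 <= M by []. rewrite /D; move: (2 ^+ m) (\sum_j K j) => a b'; lra.
  have s1 := shear_sp sA (sp_partial (lshift 1 j) sphi).
  have s2 := shear_sp sA (sp_partial xdir sphi).
  have s3 := pull_sp (sp_partial j sA).
  have I1 := IH _ _ (sp_partial (lshift 1 j) sphi) (HM' _).
  have I2 := IH _ _ (sp_partial xdir sphi) (HM' _).
  have I3 : Cm_le m (\sum_j K j) (pull (partial j A)).
    apply: Cm_le_weak (KP j).2 => //.
    by rewrite (bigD1 j)//= lerDl sumr_ge0// => i' _; rewrite ltW//; case: (KP i').
  exact: (Cm_leD s1 (spM s3 s2) I1 (Cm_leM s3 s2 I3 I2)).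
rewrite partialx_shear//.
apply: (@Cm_le_weak _ _ m m (C * M)) => //; last by apply: IH => //; exact: sp_partial.
by rewrite !mulrDl mul1r addrAC lerDr addr_ge0// mulr_ge0.
Qed.

Lemma shear_rdist A L : spn A -> rdist L -> rdist (fun phi => L (shear A phi)).
Proof.
move=> sA [lL [C [m [C0 LC]]]]; split.
  move=> c phi psi s1 s2; rewrite -lL; [|exact: shear_sp|exact: shear_sp].
  by [].
have [D D0 H] := shear_Cm_le m sA.
exists (C * D), m; split; first exact: mulr_ge0.
move=> phi M sphi HM; rewrite -mulrA; apply: LC; first exact: shear_sp.
exact: H.
Qed.

(** On waves: with no frequency in [x] the shear does nothing, and otherwise wave and sheared wave
    are both derivatives in [x], so both integrals vanish. *)
Lemma T_shear A phi : spn A -> sp1 phi -> T1 (shear A phi) = T1 phi.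
Proof.
move=> sA sphi; apply: (rdist_eq (shear_rdist sA (@T_rdist1 R _)) (@T_rdist1 R _)) => // k th.
have [k0|k0] := eqVneq (k 0 xdir) 0.
  congr T1; apply/funext => p.
  by rewrite /shear /wave dotzD dotzZ dotz_delta k0 mulr0 addr0.
rewrite T_wave; case: eqP => [E|_]; first by rewrite E mxE eqxx in k0.
have sw th0 := @wave_sp R (n + 1) k th0.
have := T_partial xdir (shear_sp sA (sw (th - pi / 2))).
rewrite partialx_shear// partial_wave subrK.
rewrite (_ : shear A _ = fun p => (k 0 xdir)%:~R * shear A (wave k th) p)//.
rewrite TZ; last exact: shear_sp.
by move=> /eqP; rewrite mulf_eq0 intr_eq0 (negbTE k0)/= => /eqP.
Qed.

Lemma pull_Cm_le m g M : spn g -> Cm_le m M g -> Cm_le m M (pull g).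
Proof.
elim: m g M => [|m IH] g M sg H.
  by apply/Cm_le0 => p; exact: ((Cm_le0 _ _).1 H).
have M0 := Cm_le_ge0 H; have [H0 H1] := (Cm_leS _ _ _).1 H.
apply/Cm_leS; split=> [p|i]; first exact: H0.
case: (tube_dirP i) => [[j ->]|->].
  by rewrite partial_pull//; apply: IH => //; exact: sp_partial.
rewrite partialx_pull => s x _; rewrite (_ : partials s _ = fun=> 0) ?normr0//.
by elim: s => //= k s ->; rewrite partial_cst.
Qed.

(** Both sides are distributions in [g], so it is enough that they agree on waves. *)
Lemma T_pull g : spn g -> T1 (pull g) = 2 * pi * Tn g.
Proof.
move=> sg.
have d1 : rdist (fun g => T1 (pull g)).
  have [l [C [m [C0 H]]]] := @T_rdist1 R (n + 1); split.
    by move=> c g1 g2 s1 s2; rewrite -l; [|exact: pull_sp|exact: pull_sp].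
  exists C, m; split=> // h M sh HM; apply: H; first exact: pull_sp.
  exact: pull_Cm_le.
have d2 : rdist (fun g => 2 * pi * Tn g).
  have [l [C [m [C0 H]]]] := @T_rdist1 R n; split.
    by move=> c g1 g2 s1 s2; rewrite l//; ring.
  exists (2 * pi * C), m; split; first by rewrite mulr_ge0// ltW// twopi_gt0.
  move=> h M sh HM; rewrite normrM gtr0_norm ?twopi_gt0// -mulrA ler_pM2l ?twopi_gt0//.
  exact: H.
apply: (rdist_eq d1 d2) => // k th.
have -> : pull (wave k th) = wave (row_mx k 0) th.
  apply/funext => p; rewrite /pull /wave; congr (cos (_ + _)).
  rewrite /dotz big_split_ord/= big_ord1 row_mxEr mxE mul0r addr0.
  by apply: eq_bigr => i _; rewrite row_mxEl mxE.
rewrite !T_wave (_ : (row_mx k 0 == 0) = (k == 0)).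
  by case: eqP => _; rewrite ?mulr0// exprD expr1; ring.
apply/eqP/eqP => [|->]; last by rewrite row_mx0.
by rewrite -row_mx0 => /eq_row_mx[].
Qed.

Definition tube_deriv j b phi p :=
  partial (lshift 1 j) phi p + b (lsubmx p) * partial xdir phi p.

Lemma tube_deriv_sp j b phi : spn b -> sp1 phi -> sp1 (tube_deriv j b phi).
Proof.
move=> sb sphi; apply: spD; first exact: sp_partial.
by apply: (spM (pull_sp sb)); exact: sp_partial.
Qed.

Lemma tube_deriv_lin j b c phi psi : sp1 phi -> sp1 psi ->
  tube_deriv j b (fun p => c * phi p + psi p) =
  fun p => c * tube_deriv j b phi p + tube_deriv j b psi p.
Proof.
move=> s1 s2; apply/funext => p; rewrite /tube_deriv !partialD ?partialZ//; try exact: spZ.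
by move: (partial _ phi p) (partial xdir phi p) (partial _ psi p) (partial xdir psi p) => *; ring.
Qed.

Lemma tube_deriv_shear j b A phi : spn A -> sp1 phi ->
  tube_deriv j b (shear A phi) = shear A (tube_deriv j (fun t => b t + partial j A t) phi).
Proof.
move=> sA sphi; apply/funext => p.
rewrite /tube_deriv partial_shear// partialx_shear// /shear /pull lsubmx_ex.
by rewrite mulrDl -addrA [X in _ + X]addrC.
Qed.

Lemma tube_deriv_skew j b phi psi : spn b -> sp1 phi -> sp1 psi ->
  T1 (fun p => phi p * tube_deriv j b psi p) = - T1 (fun p => tube_deriv j b phi p * psi p).
Proof.
move=> sb s1 s2; have sB := pull_sp sb.
have d1 := sp_partial (lshift 1 j) s1; have d2 := sp_partial (lshift 1 j) s2.
have x1 := sp_partial xdir s1; have x2 := sp_partial xdir s2.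
have E : (fun p => phi p * tube_deriv j b psi p) =
  (fun p => phi p * partial (lshift 1 j) psi p + (pull b p * phi p) * partial xdir psi p).
  by apply/funext => p; rewrite /tube_deriv /pull mulrDr; congr (_ + _); rewrite mulrCA mulrA.
have E' : (fun p => tube_deriv j b phi p * psi p) =
  (fun p => partial (lshift 1 j) phi p * psi p + partial xdir (fun p => pull b p * phi p) p * psi p).
  apply/funext => p; rewrite partialM// partialx_pull /tube_deriv /pull mul0r add0r.
  by rewrite mulrDl.
rewrite E E' (TD (spM s1 d2) (spM (spM sB s1) x2)).
rewrite (TD (spM d1 s2) (spM (sp_partial xdir (spM sB s1)) s2)) opprD.
by rewrite (T_parts (lshift 1 j) s1 s2) (T_parts xdir (spM sB s1) s2).
Qed.

End Tube.

(** * Closed coefficients and finite type *)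

Section Potential.
Variables (R : realType) (n : nat).
Implicit Types (t : 'rV[R]_n) (j k : 'I_n) (f g : 'rV[R]_n -> R) (s : seq 'I_n).

Local Notation sp := (@smooth_torus R n).

Definition avg j f t := (2 * pi)^-1 * wavg (fun=> 1) j f t.
Definition prim j f t := (2 * pi)^-1 * wavg id j f t.

Lemma id_cont : continuous (id : R -> R). Proof. by move=> x; exact: cvg_id. Qed.

Lemma avg_sp j f : sp f -> sp (avg j f).
Proof. by move=> sf; apply/spZ/wavg_sp => //; exact: cont_cst. Qed.

Lemma prim_sp j f : sp f -> sp (prim j f).
Proof. by move=> sf; apply/spZ/wavg_sp => //; exact: id_cont. Qed.

Lemma partial_avg j k f : sp f -> partial k (avg j f) = avg j (partial k f).
Proof.
move=> sf; have c1 := @cont_cst R 1.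
by rewrite /avg (partialZ k _ (wavg_sp j c1 sf)) (partial_wavg j k c1 sf).
Qed.

Lemma partial_prim j k f : sp f -> partial k (prim j f) = prim j (partial k f).
Proof.
move=> sf.
by rewrite /prim (partialZ k _ (wavg_sp j id_cont sf)) (partial_wavg j k id_cont sf).
Qed.

Lemma avg_partial j f : sp f -> avg j (partial j f) = fun=> 0.
Proof. by move=> sf; apply/funext => t; rewrite /avg wavg1_partial// mulr0. Qed.

Lemma prim_partial j f : sp f -> prim j (partial j f) = fun t => f t - avg j f t.
Proof.
move=> sf; apply/funext => t; rewrite /prim /avg (wavg_id_partial j sf).
by rewrite mulrBr mulKf// gt_eqF// twopi_gt0.
Qed.

Lemma averageE j f : sp f -> average j f = avg j f.
Proof. by move=> sf; apply/funext => t; rewrite /average integrate_coordE. Qed.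

Lemma avgB j f g : sp f -> sp g -> avg j (fun t => f t - g t) = fun t => avg j f t - avg j g t.
Proof.
move=> sf sg; rewrite -!averageE//; last exact: spB.
apply/funext => t; rewrite /average.
rewrite (_ : (fun t => f t - g t) = fun t => f t + -1 * g t); last first.
  by apply/funext => u; rewrite mulN1r.
by rewrite (icD j sf (spZ _ sg)) (icZ j _ sg) mulN1r mulrBr.
Qed.

Lemma avgD j f g : sp f -> sp g -> avg j (fun t => f t + g t) = fun t => avg j f t + avg j g t.
Proof.
move=> sf sg; rewrite -!averageE//; last exact: spD.
by apply/funext => t; rewrite /average (icD j sf sg) mulrDr.
Qed.

Lemma avg_cst j (c : R) : avg j (fun=> c) = fun=> c.
Proof.
rewrite -averageE; last exact: sp_cst.
apply/funext => t; rewrite /average ic_cst mulrC mulfK// gt_eqF// twopi_gt0//.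
Qed.

Definition iter_avg s f := foldr avg f s.

Lemma iter_avg_sp s f : sp f -> sp (iter_avg s f).
Proof. by move=> sf; elim: s => //= j s; exact: avg_sp. Qed.

Lemma partial_iter_avg s k f : sp f -> k \in s -> partial k (iter_avg s f) = fun=> 0.
Proof.
move=> sf; elim: s => //= j s IH; have ss := iter_avg_sp s sf.
rewrite inE partial_avg//; case: eqVneq => [-> _|_ /IH ->]; first exact: avg_partial.
exact: avg_cst.
Qed.

Variable a : 'I_n -> 'rV[R]_n -> R.
Hypothesis sa : forall j, sp (a j).

(** Integration of the form one coordinate at a time: [prim j (a j)] accounts for the oscillation in
    [t_j], and the potential built from the other coordinates is averaged in [t_j]. *)
Definition potential s := foldr (fun j P t => prim j (a j) t + avg j P t) (fun=> 0) s.

Lemma potential_sp s : sp (potential s).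
Proof.
elim: s => [|j s IH] /=; first exact: sp_cst.
by apply: spD; [exact: prim_sp|exact: avg_sp].
Qed.

Definition closed_form := forall j k, partial j (a k) = partial k (a j).

(** Closedness gives [d_k (prim j a_j) = prim j (d_j a_k) = a_k - avg j a_k]; the averaged potential
    contributes [avg j a_k] minus the iterated average, and the middle terms cancel. *)
Lemma partial_potential s k : closed_form ->
  partial k (potential s) = fun t => a k t - iter_avg s (a k) t.
Proof.
move=> cl; elim: s => [|j s IH] /=.
  by rewrite partial_cst; apply/funext => t; rewrite subrr.
have sP := potential_sp s.
rewrite (partialD k (prim_sp j (sa j)) (avg_sp j sP)) (partial_prim j k (sa j)).
rewrite (partial_avg j k sP) IH (avgB j (sa k) (iter_avg_sp s (sa k))) (cl k j).
by rewrite (prim_partial j (sa k)); apply/funext => t; rewrite addrA subrK.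
Qed.

Lemma closed_exact : closed_form -> exists (A : 'rV[R]_n -> R) (c : 'I_n -> R),
  [/\ sp A, forall k t, a k t = c k + partial k A t &
      forall k t, average k (a k) t = c k].
Proof.
move=> cl; pose s := enum 'I_n; have sA := potential_sp s.
have D k : a k = fun t => iter_avg s (a k) 0 + partial k (potential s) t.
  apply/funext => t; rewrite partial_potential//.
  (* Averaged over every coordinate, [a k] has no derivative left and is the constant [c k]. *)
  rewrite (@constant_of_qderiv0 _ _ (iter_avg s (a k)) _ 0 t) ?subrKC// => i.
  have := sp_qderiv i (iter_avg_sp s (sa k)).
  by rewrite (partial_iter_avg (sa k)) ?mem_enum.
exists (potential s), (fun k => iter_avg s (a k) 0); split=> // k t.
  by rewrite {1}D.
rewrite averageE// {1}D (avgD k (@sp_cst R n _) (sp_partial k sA)) avg_cst.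
by rewrite (avg_partial k sA) addr0.
Qed.

End Potential.

(** * The Lie algebra generated by the tube fields *)

Section FiniteType.
Variables (R : realType) (n : nat).
Variable a : 'I_n -> 'rV[R]_n -> R.
Hypothesis sa : forall j, smooth_torus (a j).
Implicit Types (t w : 'rV[R]_n) (p v : 'rV[R]_(n + 1)) (j k : 'I_n) (c d : 'I_n -> R).

Local Notation ex := (delta_mx 0 (xdir n) : 'rV[R]_(n + 1)).

(** Brackets differentiate in arbitrary directions, whereas smoothness speaks of coordinate
    directions. Each further coordinate is handled at the shifted base point, the change of its
    derivative being Lipschitz. *)
Lemma directional_taylor (f : 'rV[R]_n -> R) (w : 'I_n -> R) (s : seq 'I_n) : smooth_torus f ->
  exists B : R, forall t h,
  `|f (t + h *: \sum_(i <- s) w i *: delta_mx 0 i) - f t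
     - h * \sum_(i <- s) w i * partial i f t| <= B * h ^+ 2.
Proof.
move=> sf; elim: s => [|i s [B IH]].
  by exists 0 => t h; rewrite !big_nil scaler0 addr0 subrr mulr0 subr0 normr0 mul0r.
have [B1 B10 H1] := qderivP (sp_qderiv i sf).
have [B2 HB2] := sp_lip_all (sp_partial i sf).
pose S := \sum_(k <- s) B2 k * `|w k|.
exists (B1 * w i ^+ 2 + B + `|w i| * S) => t h; rewrite !big_cons.
set W := \sum_(k <- s) _; set D := \sum_(k <- s) _ * _.
set t' := t + h *: W.
have -> : t + h *: (w i *: delta_mx 0 i + W) = t' + (h * w i) *: delta_mx 0 i.
  by rewrite /t' scalerDr scalerA addrA addrAC.
have K1 := H1 t' (h * w i); have K2 := IH t h; rewrite -/W -/D -/t' in K2.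
have K3 : `|partial i f t' - partial i f t| <= `|h| * S.
  rewrite /t' /W scaler_sumr.
  rewrite (eq_bigr (fun k => (h * w k) *: delta_mx 0 k)); last by move=> k _; rewrite scalerA.
  apply: (le_trans (telescope_coord s (fun k => h * w k) t HB2)).
  by rewrite /S mulr_sumr; apply: ler_sum => k _; rewrite normrM mulrCA.
move: (f (t' + _)) (f t') (f t) (partial i f t') (partial i f t) K1 K2 K3
  => a1 a2 a3 c1 c2 K1 K2 K3.
have -> : a1 - a3 - h * (w i * c2 + D) = (a1 - a2 - h * w i * c1) + (a2 - a3 - h * D)
   + h * w i * (c1 - c2) by ring.
rewrite [leRHS](_ : _ = B1 * (h * w i) ^+ 2 + B * h ^+ 2 + (`|h| * `|w i|) * (`|h| * S)).
  rewrite (le_trans (ler_normD _ _))// lerD//; last first.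
    by rewrite !normrM ler_wpM2l// mulr_ge0.
  by rewrite (le_trans (ler_normD _ _))// lerD.
have h2 : `|h| * `|h| = h ^+ 2 by rewrite -expr2 real_normK ?num_real.
rewrite (_ : `|h| * `|w i| * _ = (`|h| * `|h|) * (`|w i| * S)); last by ring.
by rewrite h2; ring.
Qed.

Lemma pull_is_derive f p v : smooth_torus f ->
  is_derive p v (fun p => f (lsubmx p)) (\sum_i v 0 (lshift 1 i) * partial i f (lsubmx p)).
Proof.
move=> sf.
have [B HB] := directional_taylor (fun i => v 0 (lshift 1 i)) (index_enum _) sf.
apply: (@quad_is_derive _ _ _ _ _ _ B) => h.
have -> : lsubmx (p + h *: v) = lsubmx p + h *: \sum_i v 0 (lshift 1 i) *: delta_mx 0 i.
  apply/rowP => i; rewrite !mxE summxE (bigD1 i)//= big1 ?addr0 => [|k ki].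
    by rewrite !mxE !eqxx mulr1.
  by rewrite !mxE/= eq_sym (negbTE ki) mulr0.
exact: HB.
Qed.

Definition lin_field c : vector_field R (n + 1) :=
  fun p => \sum_j c j *: tube_field j (a j) p.

Lemma lin_field_l c p i : lin_field c p 0 (lshift 1 i) = c i.
Proof.
rewrite /lin_field summxE (bigD1 i)//= big1 ?addr0 => [|k /negbTE ki].
  by rewrite !mxE !eqxx eq_lrshift /= mulr0 addr0 mulr1.
by rewrite !mxE eq_lrshift eq_lshift eq_sym ki !andbF/= !(mulr0, addr0).
Qed.

Lemma lin_field_r c p : lin_field c p 0 (xdir n) = \sum_j c j * a j (lsubmx p).
Proof.
rewrite /lin_field summxE; apply: eq_bigr => j _.
by rewrite !mxE !eqxx /xdir eq_rlshift/= add0r mulr1.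
Qed.

Lemma lin_field_derive c p v : 'D_v (lin_field c) p =
  (\sum_j c j * \sum_i v 0 (lshift 1 i) * partial i (a j) (lsubmx p)) *: ex.
Proof.
have coord (i : 'I_1) (l : 'I_(n + 1)) : is_derive p v (fun p => lin_field c p i l)
   (((\sum_j c j * \sum_i v 0 (lshift 1 i) * partial i (a j) (lsubmx p)) *: ex) i l).
  rewrite (ord1 i) !mxE eqxx/=; case: (tube_dirP l) => [[k ->]|->].
    rewrite (_ : (fun p => _) = cst (c k)); last by apply/funext => q; rewrite lin_field_l.
    rewrite /xdir eq_lrshift mulr0; exact: is_derive_cst.
  rewrite eqxx mulr1.
  rewrite (_ : (fun p => _) = \sum_j (fun p => c j * a j (lsubmx p))); last first.
    by apply/funext => q; rewrite lin_field_r fct_sumE.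
  apply: is_derive_sum => j.
  have := pull_is_derive p v (sa j); move=> d.
  exact: (@is_deriveZ _ _ _ (fun p => a j (lsubmx p)) (c j) p v _ d).
rewrite derive_mx; last by apply/derivable_mxP => i l; case: (coord i l).
by apply/matrixP => i l; rewrite mxE; case: (coord i l).
Qed.

Lemma lie_bracket_lin_field c d p : lie_bracket (lin_field c) (lin_field d) p =
  (\sum_i \sum_j c i * d j * (partial i (a j) (lsubmx p) - partial j (a i) (lsubmx p))) *: ex.
Proof.
rewrite /lie_bracket !lin_field_derive -scalerBl; congr (_ *: _).
have -> : \sum_j d j * \sum_i lin_field c p 0 (lshift 1 i) * partial i (a j) (lsubmx p) =
   \sum_i \sum_j c i * d j * partial i (a j) (lsubmx p).
  rewrite exchange_big/=; apply: eq_bigr => j _; rewrite mulr_sumr; apply: eq_bigr => i _.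
  by rewrite lin_field_l mulrCA mulrA.
have -> : \sum_j c j * \sum_i lin_field d p 0 (lshift 1 i) * partial i (a j) (lsubmx p) =
   \sum_i \sum_j c i * d j * partial j (a i) (lsubmx p).
  apply: eq_bigr => j _; rewrite mulr_sumr; apply: eq_bigr => i _.
  by rewrite lin_field_l mulrA.
rewrite -sumrB; apply: eq_bigr => i _; rewrite -sumrB; apply: eq_bigr => j _.
by rewrite mulrBr.
Qed.

Lemma tube_field_lin j : tube_field j (a j) = lin_field (fun i => (i == j)%:R).
Proof.
apply/funext => p; rewrite /lin_field (bigD1 j)//= big1 ?addr0 => [|k /negbTE ->].
  by rewrite eqxx scale1r.
by rewrite scale0r.
Qed.

Local Notation gens := [set X | exists j, X = tube_field j (a j)].

Lemma lin_field_lie c : lie_algebra gens (lin_field c).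
Proof.
rewrite /lin_field; elim: (index_enum _) => [|j s IH].
  rewrite (_ : (fun p => _) = fun=> 0); first exact: lie_zero.
  by apply/funext => p; rewrite big_nil.
rewrite (_ : (fun p => _) = fun p => c j *: tube_field j (a j) p +
   \sum_(i <- s) c i *: tube_field i (a i) p); last by apply/funext => p; rewrite big_cons.
by apply: lie_add => //; apply: lie_scale; apply: lie_gen; exists j.
Qed.

(** Brackets of constant combinations of the generators have only an [x]-component, a combination of
    curls, and this is 0; so these combinations already form a Lie algebra. *)
Lemma lie_closed X : closed_form a -> lie_algebra gens X -> exists c, X = lin_field c.
Proof.
move=> cl; elim=> {X} [X [j ->]||X Y _ [c ->] _ [d ->]|e X _ [c ->]|X Y _ [c ->] _ [d ->]].
- by exists (fun i => (i == j)%:R); exact: tube_field_lin.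
- exists (fun=> 0); apply/funext => p; rewrite /lin_field big1// => j _.
  by rewrite scale0r.
- exists (fun i => c i + d i); apply/funext => p; rewrite /lin_field -big_split/=.
  by apply: eq_bigr => j _; rewrite scalerDl.
- exists (fun i => e * c i); apply/funext => p; rewrite /lin_field scaler_sumr.
  by apply: eq_bigr => j _; rewrite scalerA.
- exists (fun=> 0); apply/funext => p; rewrite lie_bracket_lin_field /lin_field.
  rewrite [RHS]big1 => [|j _]; last by rewrite scale0r.
  rewrite big1 ?scale0r// => i _; rewrite big1// => j _.
  by rewrite cl subrr mulr0.
Qed.

Lemma finite_typeP : (exists t, finite_type a t) <-> ~ closed_form a.
Proof.
split=> [[t ft] cl|ncl].
  (* The [t]-components of [lin_field c] are the [c i]. To be the [x]-direction they must all
     vanish, but then so does the [x]-component. *)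
  have [Z /(lie_closed cl)[c ->] E] := ft 0 ex.
  have c0 i : c i = 0.
    by rewrite -(lin_field_l c (row_mx t 0)) E !mxE /xdir eq_lrshift andbF.
  have /eqP := lin_field_r c (row_mx t 0).
  rewrite E !mxE !eqxx/= big1 ?oner_eq0// => j _.
  by rewrite c0 mul0r.
have [j [k [t jk]]] : exists j k t, partial j (a k) t != partial k (a j) t.
  apply: contrapT => H; apply: ncl => j k; apply/funext => t.
  by apply/eqP; apply: contrapT => /negP jk; apply: H; exists j, k, t.
exists t => x v.
set p := row_mx t x.
pose b := partial j (a k) t - partial k (a j) t.
have b0 : b != 0 by rewrite subr_eq0.
pose c i := v 0 (lshift 1 i).
(* The generators match the [t]-components of [v]; one bracket, of value [b] in the [x]-direction,
   corrects the remaining component. *)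
pose al := (v 0 (xdir n) - lin_field c p 0 (xdir n)) / b.
exists (fun q => lin_field c q + al *: lie_bracket (tube_field j (a j)) (tube_field k (a k)) q).
  apply: lie_add; first exact: lin_field_lie.
  apply: lie_scale; apply: lie_bracketed; apply: lie_gen; first by exists j.
  by exists k.
rewrite !tube_field_lin lie_bracket_lin_field.
have -> : \sum_i \sum_l (i == j)%:R * (l == k)%:R *
    (partial i (a l) (lsubmx p) - partial l (a i) (lsubmx p)) = b.
  rewrite (bigD1 j)//= [X in _ + X]big1 ?addr0 => [|i /negbTE ij]; last first.
    by apply: big1 => l _; rewrite ij mul0r mul0r.
  rewrite (bigD1 k)//= big1 ?addr0 => [|l /negbTE lk]; last first.
    by rewrite lk mulr0 mul0r.
  by rewrite !eqxx !mul1r /p row_mxKl.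
apply/rowP => l; rewrite 3!mxE [ex _ _]mxE eqxx/=; case: (tube_dirP l) => [[i ->]|->].
  by rewrite lin_field_l /xdir eq_lrshift !mulr0 addr0.
by rewrite eqxx mulr1 /al divfK// addrC subrK.
Qed.

End FiniteType.

(** * Reduction to real distributions *)

Section RealReduction.
Local Open Scope complex_scope.
Variables (R : realType) (N : nat).
Implicit Types (x : 'rV[R]_N) (f g : 'rV[R]_N -> R) (phi psi : 'rV[R]_N -> R[i]).
Implicit Types (u : functional R N) (L : ('rV[R]_N -> R) -> 'rV[R]_N -> R).

Local Notation sp := (@smooth_torus R N).
Local Notation Csp := (@Csmooth_torus R N).
Local Notation T := (@torus_integral R N).

Definition clinear u := forall (c : R[i]) phi psi, Csp phi -> Csp psi ->
  u (fun x => c * phi x + psi x) = c * u phi + u psi.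

Definition cplx f : 'rV[R]_N -> R[i] := fun x => (f x)%:C.

Lemma Csp_re phi : Csp phi -> sp (re_fun phi).
Proof. by move=> [s1 _ p]; split=> // x k; rewrite /re_fun p. Qed.

Lemma Csp_im phi : Csp phi -> sp (im_fun phi).
Proof. by move=> [_ s1 p]; split=> // x k; rewrite /im_fun p. Qed.

Lemma CspP phi : sp (re_fun phi) -> sp (im_fun phi) -> Csp phi.
Proof.
move=> [s1 p1] [s2 p2]; split=> // x k; apply/eqP; rewrite eq_complex.
by apply/andP; split; apply/eqP; [exact: p1|exact: p2].
Qed.

Lemma Csp_cplx f : sp f -> Csp (cplx f).
Proof. by move=> sf; apply: CspP => //; exact: sp_cst. Qed.

Lemma re_lin (c : R[i]) phi psi : re_fun (fun x => c * phi x + psi x) =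
  fun x => (complex.Re c * re_fun phi x - complex.Im c * im_fun phi x) + re_fun psi x.
Proof. by apply/funext => x; rewrite /re_fun /im_fun; case: c (phi x) (psi x) => [? ?] [? ?] [? ?]. Qed.

Lemma im_lin (c : R[i]) phi psi : im_fun (fun x => c * phi x + psi x) =
  fun x => (complex.Re c * im_fun phi x + complex.Im c * re_fun phi x) + im_fun psi x.
Proof. by apply/funext => x; rewrite /re_fun /im_fun; case: c (phi x) (psi x) => [? ?] [? ?] [? ?]. Qed.

Lemma clinD u phi psi : clinear u -> Csp phi -> Csp psi ->
  u (fun x => phi x + psi x) = u phi + u psi.
Proof.
move=> lu s1 s2; rewrite -[u phi]mul1r -lu//; congr u.
by apply/funext => x; rewrite mul1r.
Qed.

Lemma Csp0 : Csp (fun=> 0).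
Proof. by apply: CspP; exact: sp_cst. Qed.

Lemma clin0 u : clinear u -> u (fun=> 0) = 0.
Proof.
move=> lu; have := clinD lu Csp0 Csp0; rewrite (_ : (fun=> 0 + 0) = fun=> 0).
  by move/eqP; rewrite -subr_eq0 opprD addNKr oppr_eq0 => /eqP.
by apply/funext => x; rewrite addr0.
Qed.

Lemma clinZ u (c : R[i]) phi : clinear u -> Csp phi -> u (fun x => c * phi x) = c * u phi.
Proof.
move=> lu s1; rewrite -[RHS]addr0 -{1}(clin0 lu) -lu//; last exact: Csp0.
by congr u; apply/funext => x; rewrite addr0.
Qed.

Lemma clin_split u phi : clinear u -> Csp phi ->
  u phi = u (cplx (re_fun phi)) + 'i * u (cplx (im_fun phi)).
Proof.
move=> lu sphi; have s1 := Csp_cplx (Csp_re sphi); have s2 := Csp_cplx (Csp_im sphi).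
rewrite addrC -lu//; congr u; apply/funext => x.
rewrite /cplx /re_fun /im_fun; case: (phi x) => a b /=.
by apply/eqP; rewrite eq_complex /=; apply/andP; split; apply/eqP; ring.
Qed.

Lemma Cpartials_re s phi : re_fun (Cpartials s phi) = partials s (re_fun phi).
Proof. by elim: s => //= k s IH; rewrite -IH. Qed.

Lemma Cpartials_im s phi : im_fun (Cpartials s phi) = partials s (im_fun phi).
Proof. by elim: s => //= k s IH; rewrite -IH. Qed.

Lemma normc_re_le (z : R[i]) (M : R) : `|z| <= M%:C -> `|complex.Re z| <= M.
Proof. by move=> H; rewrite -lecR (le_trans _ H)// normc_ge_Re. Qed.

Lemma normc_im_le (z : R[i]) (M : R) : `|z| <= M%:C -> `|complex.Im z| <= M.
Proof.
move=> H; rewrite -normrN -ReiNIm; apply: normc_re_le.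
by rewrite normrM (_ : `|'i| = 1) ?mulr1// normc_def /= expr0n expr1n add0r sqrtr1.
Qed.

Lemma normc_le (a b M : R) : `|a| + `|b| <= M -> `|a +i* b| <= M%:C.
Proof.
move=> H; rewrite normc_def lecR /=.
have M0 : 0 <= M by rewrite (le_trans _ H)// addr_ge0.
rewrite -(ger0_norm M0) -sqrtr_sqr ler_sqrt ?sqr_ge0//.
rewrite -(real_normK (num_real a)) -(real_normK (num_real b)).
have := normr_ge0 a; have := normr_ge0 b; move: (`|a|) (`|b|) H => c d H d0 c0.
have H2 : (c + d) ^+ 2 <= M ^+ 2 by rewrite lerXn2r// nnegrE addr_ge0.
apply: le_trans H2; have := mulr_ge0 c0 d0; lra.
Qed.

Definition real_part u : ('rV[R]_N -> R) -> R := fun f => complex.Re (u (cplx f)).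
Definition imag_part u : ('rV[R]_N -> R) -> R := fun f => complex.Im (u (cplx f)).

Lemma cplx_lin (c : R) f g : cplx (fun x => c * f x + g x) = fun x => c%:C * cplx f x + cplx g x.
Proof. by apply/funext => x; rewrite /cplx rmorphD rmorphM. Qed.

Lemma cplx_Cpartials s f x : Cpartials s (cplx f) x = (partials s f x)%:C.
Proof.
have := congr1 (@^~ x) (Cpartials_re s (cplx f)).
have := congr1 (@^~ x) (Cpartials_im s (cplx f)).
rewrite /re_fun /im_fun /= => Ei Er; apply/eqP; rewrite eq_complex /= Er eqxx/= Ei.
by rewrite (_ : partials s _ = fun=> 0)//; elim: s {Ei Er} => //= k s ->; rewrite partial_cst.
Qed.

Lemma real_part_rdist u : distribution_torus u -> rdist (real_part u) /\ rdist (imag_part u).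
Proof.
move=> [lu [C [m uC]]].
have H f M : sp f -> Cm_le m M f -> `|u (cplx f)| <= (`|C| * M)%:C.
  move=> sf HM; have M0 := Cm_le_ge0 HM.
  apply: (@le_trans _ _ (C * M)%:C).
    apply: uC => [|s x sm]; first exact: Csp_cplx.
    by rewrite cplx_Cpartials normc_def /= expr0n addr0 sqrtr_sqr lecR HM.
  by rewrite lecR ler_wpM2r// ler_norm.
have l c f g : sp f -> sp g ->
    u (cplx (fun x => c * f x + g x)) = c%:C * u (cplx f) + u (cplx g).
  by move=> sf sg; rewrite cplx_lin lu//; exact: Csp_cplx.
split; split.
- move=> c f g sf sg; rewrite /real_part l//.
  by case: (u (cplx f)) (u (cplx g)) => [? ?] [? ?] /=; ring.
- exists `|C|, m; split=> // f M sf HM; apply: normc_re_le; exact: H.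
- move=> c f g sf sg; rewrite /imag_part l//.
  by case: (u (cplx f)) (u (cplx g)) => [? ?] [? ?] /=; ring.
- exists `|C|, m; split=> // f M sf HM; apply: normc_im_le; exact: H.
Qed.

Definition complexify (v : ('rV[R]_N -> R) -> R) : functional R N :=
  fun phi => v (re_fun phi) +i* v (im_fun phi).

Lemma complexify_lin v : linear_form v -> clinear (complexify v).
Proof.
move=> lv c phi psi s1 s2.
have r1 := Csp_re s1; have r2 := Csp_re s2; have i1 := Csp_im s1; have i2 := Csp_im s2.
rewrite /complexify re_lin im_lin.
rewrite (linD lv (spB (spZ _ r1) (spZ _ i1)) r2) (linB lv (spZ _ r1) (spZ _ i1)).
rewrite (linD lv (spD (spZ _ i1) (spZ _ r1)) i2) (linD lv (spZ _ i1) (spZ _ r1)).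
by rewrite !(linZ _ lv)//; case: c.
Qed.

Lemma complexify_dist v : rdist v -> distribution_torus (complexify v).
Proof.
move=> [lv [C [m [C0 vC]]]]; split; first exact: complexify_lin.
exists (C + C), m => phi M sphi HM; rewrite /complexify; apply: normc_le.
rewrite mulrDl; apply: lerD; apply: vC.
- exact: Csp_re.
- by move=> s x sm; rewrite -Cpartials_re; apply: normc_re_le; exact: HM.
- exact: Csp_im.
- by move=> s x sm; rewrite -Cpartials_im; apply: normc_im_le; exact: HM.
Qed.

Lemma complexify_cplx v f : linear_form v -> complexify v (cplx f) = (v f)%:C.
Proof. by move=> lv; rewrite /complexify (_ : im_fun _ = fun=> 0)// lin0. Qed.

Definition real_hypoelliptic (S : set (('rV[R]_N -> R) -> 'rV[R]_N -> R)) :=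
  forall v, rdist v -> (forall L, S L -> rsmooth (fun f => v (L f))) -> rsmooth v.

(** [L] is the real operator acting on test functions through which [Q] is defined by duality.
    Linearity of [Q u] lets its values on real functions determine all the others. *)
Definition transposes (Q : dist_op R N) L := (forall f, sp f -> sp (L f)) /\
  forall u, clinear u -> clinear (Q u) /\ forall f, sp f -> Q u (cplx f) = u (cplx (L f)).

Lemma re_mul_cplx phi f : re_fun (fun x => phi x * cplx f x) = fun x => re_fun phi x * f x.
Proof. by apply/funext => x; rewrite /re_fun /cplx; case: (phi x) => a b /=; ring. Qed.

Lemma im_mul_cplx phi f : im_fun (fun x => phi x * cplx f x) = fun x => im_fun phi x * f x.
Proof. by apply/funext => x; rewrite /im_fun /cplx; case: (phi x) => a b /=; ring. Qed.

Lemma smooth_of_parts u f1 f2 : clinear u -> sp f1 -> sp f2 ->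
  (forall g, sp g -> u (cplx g) = T (fun x => f1 x * g x) +i* T (fun x => f2 x * g x)) ->
  smooth_distribution u.
Proof.
move=> lu s1 s2 H; exists (fun x => f1 x +i* f2 x); first exact: CspP.
move=> phi sphi; rewrite (clin_split lu sphi).
have r1 := Csp_re sphi; have i1 := Csp_im sphi; rewrite !H//.
rewrite /Ctorus_integral.
have -> : re_fun (fun x => (f1 x +i* f2 x) * phi x) =
    fun x => f1 x * re_fun phi x - f2 x * im_fun phi x.
  by apply/funext => x; rewrite /re_fun /im_fun; case: (phi x).
have -> : im_fun (fun x => (f1 x +i* f2 x) * phi x) =
    fun x => f1 x * im_fun phi x + f2 x * re_fun phi x.
  by apply/funext => x; rewrite /re_fun /im_fun; case: (phi x).
rewrite (TB (spM s1 r1) (spM s2 i1)) (TD (spM s1 i1) (spM s2 r1)).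
by apply/eqP; rewrite eq_complex /=; apply/andP; split; apply/eqP; ring.
Qed.

(** A real distribution is complexified and the real part of its density is kept; a complex one is
    split into two real ones. Matching the operators in both directions allows different indexings
    of the two systems. *)
Lemma hypoelliptic_realP (S : set (dist_op R N)) (S' : set (('rV[R]_N -> R) -> 'rV[R]_N -> R)) :
  (forall Q, S Q -> exists2 L, S' L & transposes Q L) ->
  (forall L, S' L -> exists2 Q, S Q & transposes Q L) ->
  globally_hypoelliptic S <-> real_hypoelliptic S'.
Proof.
move=> SS' S'S; split=> [H v dv Hv|H u du Hu].
  have lv := dv.1; have cu := complexify_lin lv.
  have [Q SQ|F sF FE] := H _ (complexify_dist dv).
    have [L S'L [sL tQ]] := SS' _ SQ; have [lQ QE] := tQ _ cu.
    have [f sf fE] := Hv _ S'L.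
    apply: (smooth_of_parts lQ sf (sp_cst N 0)) => g sg.
    rewrite QE// complexify_cplx// fE// (_ : (fun x => 0 * g x) = fun=> 0).
      by rewrite T_cst mul0r.
    by apply/funext => x; rewrite mul0r.
  exists (re_fun F); first exact: Csp_re.
  move=> g sg; have := FE _ (Csp_cplx sg).
  by rewrite complexify_cplx// /Ctorus_integral re_mul_cplx => -[].
have lu := du.1; have [dr di] := real_part_rdist du.
have Hp L : S' L -> rsmooth (fun f => real_part u (L f)) /\ rsmooth (fun f => imag_part u (L f)).
  move=> S'L; have [Q SQ [sL tQ]] := S'S _ S'L; have [lQ QE] := tQ _ lu.
  have [F sF FE] := Hu _ SQ.
  split; [exists (re_fun F); first exact: Csp_re|exists (im_fun F); first exact: Csp_im];
    move=> g sg.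
  - by rewrite /real_part -QE// (FE _ (Csp_cplx sg)) /Ctorus_integral (re_mul_cplx F g).
  - by rewrite /imag_part -QE// (FE _ (Csp_cplx sg)) /Ctorus_integral (im_mul_cplx F g).
have [f1 s1 E1] := H _ dr (fun L S'L => (Hp L S'L).1).
have [f2 s2 E2] := H _ di (fun L S'L => (Hp L S'L).2).
apply: (smooth_of_parts lu s1 s2) => g sg; rewrite -E1// -E2// /real_part /imag_part.
by case: (u (cplx g)).
Qed.

End RealReduction.

(** * Real transposes of the tube operators *)

Section TubeOperators.
Local Open Scope complex_scope.
Variables (R : realType) (n : nat).
Implicit Types (phi psi : 'rV[R]_(n + 1) -> R[i]) (f : 'rV[R]_(n + 1) -> R).
Implicit Types (b : 'rV[R]_n -> R) (j : 'I_n) (u : functional R (n + 1)).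

Local Notation Csp := (@Csmooth_torus R (n + 1)).
Local Notation sp1 := (@smooth_torus R (n + 1)).

Definition Ctube_deriv j b phi p :=
  tube_deriv j b (re_fun phi) p +i* tube_deriv j b (im_fun phi) p.

Lemma Ctube_deriv_sp j b phi : smooth_torus b -> Csp phi -> Csp (Ctube_deriv j b phi).
Proof.
move=> sb sphi.
by apply: CspP; apply: tube_deriv_sp => //; [exact: Csp_re|exact: Csp_im].
Qed.

Lemma Ctube_deriv_lin j b (c : R[i]) phi psi : smooth_torus b -> Csp phi -> Csp psi ->
  Ctube_deriv j b (fun x => c * phi x + psi x) =
  fun x => c * Ctube_deriv j b phi x + Ctube_deriv j b psi x.
Proof.
move=> sb s1 s2; apply/funext => p; rewrite /Ctube_deriv re_lin im_lin.
have r1 := Csp_re s1; have r2 := Csp_re s2; have i1 := Csp_im s1; have i2 := Csp_im s2.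
rewrite (_ : (fun x => complex.Re c * re_fun phi x - complex.Im c * im_fun phi x + re_fun psi x) =
  fun x => complex.Re c * re_fun phi x + (- complex.Im c * im_fun phi x + re_fun psi x)); last first.
  by apply/funext => x; ring.
rewrite (_ : (fun x => complex.Re c * im_fun phi x + complex.Im c * re_fun phi x + im_fun psi x) =
  fun x => complex.Re c * im_fun phi x + (complex.Im c * re_fun phi x + im_fun psi x)); last first.
  by apply/funext => x; ring.
rewrite (tube_deriv_lin j b _ r1 (spD (spZ _ i1) r2)) (tube_deriv_lin j b _ i1 r2).
rewrite (tube_deriv_lin j b _ i1 (spD (spZ _ r1) i2)) (tube_deriv_lin j b _ r1 i2).
move: (tube_deriv _ _ _ p) (tube_deriv _ _ _ p) (tube_deriv _ _ _ p) (tube_deriv _ _ _ p).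
case: c => c1 c2 d1 d2 d3 d4 /=.
by apply/eqP; rewrite eq_complex /=; apply/andP; split; apply/eqP; ring.
Qed.

Lemma Cpartial_mulr k (c : 'rV[R]_(n + 1) -> R) phi :
  Cpartial k (fun p => (c p)%:C * phi p) =
  fun p => partial k (fun p => c p * re_fun phi p) p +i* partial k (fun p => c p * im_fun phi p) p.
Proof.
rewrite /Cpartial; apply/funext => p; congr (partial k _ _ +i* partial k _ _);
  by apply/funext => q; rewrite /re_fun /im_fun; case: (phi q) => x y /=; ring.
Qed.

(** By duality the coefficient is multiplied onto [phi] before differentiation. As [b] does not
    depend on [x] it commutes with [d_x], so the transpose is just minus the field. *)
Lemma vf_op_tube j b u phi : clinear u -> smooth_torus b -> Csp phi ->
  vf_op (tube_field j b) u phi = - u (Ctube_deriv j b phi).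
Proof.
move=> lu sb sphi; have r1 := Csp_re sphi; have i1 := Csp_im sphi.
pose F1 : 'rV[R]_(n + 1) -> R[i] :=
  fun p => partial (lshift 1 j) (re_fun phi) p +i* partial (lshift 1 j) (im_fun phi) p.
pose F2 : 'rV[R]_(n + 1) -> R[i] := fun p => pull b p * partial (xdir n) (re_fun phi) p
  +i* (pull b p * partial (xdir n) (im_fun phi) p).
have sF1 : Csp F1 by apply: CspP; exact: sp_partial.
have sB := pull_sp sb.
have sF2 : Csp F2 by apply: CspP; apply: (spM sB); exact: sp_partial.
have -> : Ctube_deriv j b phi = fun p => F1 p + F2 p.
  by apply/funext => p.
rewrite (clinD lu sF1 sF2) opprD.
rewrite /vf_op big_split_ord/= big_ord1; congr (_ + _); last first.
  rewrite /dist_mul /dist_partial; congr (- u _).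
  rewrite Cpartial_mulr; apply/funext => p; rewrite /F2.
  have E f : sp1 f -> partial (rshift n ord0)
      (fun p0 => tube_field j b p0 0 (rshift n ord0) * f p0) p = pull b p * partial (xdir n) f p.
    move=> sf; rewrite (_ : (fun p0 => _) = fun p0 => pull b p0 * f p0); last first.
      by apply/funext => q; rewrite !mxE !eqxx eq_rlshift/= add0r mulr1.
    by rewrite partialM// partialx_pull mul0r add0r.
  by rewrite E// E.
rewrite (bigD1 j)//= big1 ?addr0 => [|i ij]; rewrite /dist_mul /dist_partial.
  congr (- u _); rewrite Cpartial_mulr; apply/funext => p; rewrite /F1.
  have E f : (fun p0 => tube_field j b p0 0 (lshift 1 j) * f p0) = f.
    by apply/funext => q; rewrite !mxE !eqxx eq_lrshift/= mulr0 addr0 mul1r.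
  by rewrite !E.
rewrite Cpartial_mulr (_ : (fun p => _) = fun=> 0) ?clin0 ?oppr0//.
apply/funext => p.
have E f : (fun p0 => tube_field j b p0 0 (lshift 1 i) * f p0) = fun=> 0.
  apply/funext => q; rewrite !mxE eq_lrshift eq_lshift (negbTE ij) !andbF/=.
  by rewrite mulr0 addr0 mul0r.
by rewrite !E partial_cst.
Qed.

Lemma vf_op_tube_lin j b u : clinear u -> smooth_torus b ->
  clinear (vf_op (tube_field j b) u).
Proof.
move=> lu sb c phi psi s1 s2.
have s3 : Csp (fun x => c * phi x + psi x).
  have r1 := Csp_re s1; have r2 := Csp_re s2; have i1 := Csp_im s1; have i2 := Csp_im s2.
  apply: CspP; first by rewrite re_lin; apply: (spD (spB (spZ _ r1) (spZ _ i1)) r2).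
  by rewrite im_lin; apply: (spD (spD (spZ _ i1) (spZ _ r1)) i2).
rewrite !vf_op_tube// Ctube_deriv_lin// lu; [|exact: Ctube_deriv_sp|exact: Ctube_deriv_sp].
by rewrite opprD mulrN.
Qed.

Lemma Ctube_deriv_cplx j b f : Ctube_deriv j b (cplx f) = cplx (tube_deriv j b f).
Proof.
apply/funext => p; rewrite /Ctube_deriv /cplx.
rewrite (_ : re_fun _ = f)// (_ : im_fun _ = fun=> 0)// /tube_deriv !partial_cst.
by rewrite mulr0 addr0.
Qed.

Lemma vf_op_transposes j b : smooth_torus b ->
  transposes (vf_op (tube_field j b)) (fun f p => - tube_deriv j b f p).
Proof.
move=> sb; split=> [f sf|u lu]; first exact/spN/tube_deriv_sp.
split=> [|f sf]; first exact: vf_op_tube_lin.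
have sd := tube_deriv_sp j sb sf.
rewrite vf_op_tube//; last exact: Csp_cplx.
rewrite Ctube_deriv_cplx -mulN1r -clinZ//; last exact: Csp_cplx.
by congr u; apply/funext => p; rewrite /cplx rmorphN mulN1r.
Qed.

Definition sq_sum (a : 'I_n -> 'rV[R]_n -> R) f p :=
  \sum_j tube_deriv j (a j) (tube_deriv j (a j) f) p.

Lemma sum_squares_transposes (a : 'I_n -> 'rV[R]_n -> R) : (forall j, smooth_torus (a j)) ->
  transposes (sum_squares a) (sq_sum a).
Proof.
move=> sa; have sD j f : sp1 f -> sp1 (tube_deriv j (a j) f) by exact: tube_deriv_sp.
split=> [f sf|u lu]; first by apply: sp_sum => j _; exact/sD/sD.
have l1 j := vf_op_tube_lin j lu (sa j).
split=> [c phi psi s1 s2|f sf].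
  rewrite /sum_squares mulr_sumr -big_split; apply: eq_bigr => j _.
  exact: (vf_op_tube_lin j (l1 j) (sa j)).
rewrite /sum_squares /sq_sum.
have E j : vf_op (tube_field j (a j)) (vf_op (tube_field j (a j)) u) (cplx f) =
    u (cplx (tube_deriv j (a j) (tube_deriv j (a j) f))).
  rewrite (vf_op_tube j (l1 j) (sa j) (Csp_cplx sf)) Ctube_deriv_cplx.
  rewrite (vf_op_tube j lu (sa j) (Csp_cplx (sD j _ sf))) Ctube_deriv_cplx.
  by rewrite opprK.
under eq_bigr do rewrite E.
elim: (index_enum _) => [|j s IH].
  by rewrite big_nil -[LHS](clin0 lu); congr u; apply/funext => p; rewrite /cplx big_nil.
have s1 : sp1 (fun p => \sum_(i <- s) tube_deriv i (a i) (tube_deriv i (a i) f) p).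
  by apply: sp_sum => i _; exact/sD/sD.
rewrite big_cons IH -(clinD lu (Csp_cplx (sD j _ (sD j _ sf))) (Csp_cplx s1)).
by congr u; apply/funext => p; rewrite /cplx big_cons; exact: (esym (rmorphD _ _ _)).
Qed.

End TubeOperators.

(** * The magnetic energy *)

Section Poincare.
Variables (R : realType) (N : nat).
Implicit Types (x y : 'rV[R]_N) (j : 'I_N) (f g m chi : 'rV[R]_N -> R).

Local Notation e_ k := (delta_mx 0 k : 'rV[R]_N).
Local Notation sp := (@smooth_torus R N).
Local Notation T := (@torus_integral R N).

(** By periodicity at most one period is crossed, so the bound does not grow with [h]. *)
Lemma sp_osc j f (B : R) x h : sp f -> (forall y, `|partial j f y| <= B) ->
  `|f (x + h *: e_ j) - f x| <= B * (2 * pi).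
Proof.
move=> sf fB; have p2 := twopi_gt0 R.
pose z := Num.floor (h / (2 * pi)); pose h' := h - 2 * pi * z%:~R.
have hh : `|h'| <= 2 * pi.
  have := floor_itv (h / (2 * pi)); rewrite -/z => /andP[z1 z2].
  have E : h = h / (2 * pi) * (2 * pi) by rewrite divfK// gt_eqF.
  rewrite intrD in z2; rewrite ler_norml /h'.
  move: (h / (2 * pi)) z1 z2 E => u z1 z2 E.
  have H1 : z%:~R * (2 * pi) <= u * (2 * pi) by rewrite ler_pM2r.
  have H2 : u * (2 * pi) <= (z%:~R + 1) * (2 * pi) by rewrite ler_pM2r// ltW.
  by apply/andP; split; lra.
have -> : f (x + h *: e_ j) = f (x + h' *: e_ j).
  by rewrite -(periodic_addz j z (x + h' *: e_ j) sf.2) -addrA -scalerDl subrK.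
have [c _] := mvt0 (fun t => line_is_derive j x t sf) h'.
by rewrite /= scale0r addr0 => ->; rewrite normrM mulrC ler_pM.
Qed.

(* [torus_conv chi m] is the [chi]-weighted mass of the translates of [m]: it oscillates
   little when the derivatives of [m] are small, and its mean is [T m * T chi]. *)
Lemma poincare_L1 chi : sp chi -> (forall x, 0 <= chi x) -> 0 < T chi ->
  exists2 C : R, 0 < C & forall m (G : 'I_N -> 'rV[R]_N -> R), sp m ->
    (forall x, 0 <= m x) -> (forall j, sp (G j)) -> (forall j x, `|partial j m x| <= G j x) ->
    T m <= C * (T (fun x => m x * chi x) + \sum_j T (G j)).
Proof.
move=> schi chi0 Tchi; have [B B0 cB] := boundedP (sp_bounded schi).
have p2 := twopi_gt0 R; have pN : 0 < (2 * pi) ^+ N :> R by rewrite exprn_gt0.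
pose K := 1 + B * (2 * pi).
have K1 : 1 <= K by rewrite lerDl mulr_ge0// ltW.
exists ((2 * pi) ^+ N * K / T chi); first by rewrite divr_gt0// mulr_gt0// (lt_le_trans _ K1).
move=> m G sm m0 sG mG; have sM := conv_sp schi sm.
have G0 j : 0 <= T (G j) by apply: T_ge0 => // x; rewrite (le_trans _ (mG j x)).
(* Averaging turns the integral bound on the gradient of [m] into a pointwise bound on the gradient
   of the average. *)
have dM j y : `|partial j (torus_conv chi m) y| <= B * T (G j).
  rewrite partial_conv// /torus_conv; have sj := sp_partial j sm.
  have s1 := spMtr y schi sj; have s2 := spZ B (sp_translate y (sG j)).
  have E : T (fun x => B * G j (x + y)) = B * T (G j).
    by rewrite (TZ _ (sp_translate y (sG j))) (T_translate y (sG j)).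
  have b x : `|partial j m (x + y) * chi x| <= B * G j (x + y).
    by rewrite normrM mulrC ler_pM.
  by rewrite -E; exact: T_norm_le s1 s2 b.
have osc y : torus_conv chi m y <= T (fun x => m x * chi x) + \sum_j B * T (G j) * (2 * pi).
  have H := @coord_bound R N (fun j _ => B * T (G j) * (2 * pi)) (torus_conv chi m) 0 y.
  have E0 : torus_conv chi m 0 = T (fun x => m x * chi x).
    by rewrite /torus_conv; congr T; apply/funext => x; rewrite addr0.
  rewrite -lerBlDl -E0; apply: le_trans (ler_norm _) _; rewrite -{1}[y]add0r.
  by apply: H => j x h; apply: sp_osc.
have : T (torus_conv chi m) <= (T (fun x => m x * chi x) + \sum_j B * T (G j) * (2 * pi)) * (2 * pi) ^+ N.
  by rewrite -T_cst; apply: T_le => //; exact: sp_cst.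
rewrite T_conv// -ler_pdivlMr//; move/le_trans; apply.
rewrite -mulr_suml -mulr_sumr.
have S0 : 0 <= \sum_j T (G j) by apply: sumr_ge0.
have X0 : 0 <= T (fun x => m x * chi x).
  by apply: T_ge0 => [|x]; [exact: spM|exact: mulr_ge0].
move: (T (fun x => m x * chi x)) (\sum_j T (G j)) X0 S0 => X S X0 S0.
rewrite [leRHS](_ : _ = ((X + S) * K) * ((2 * pi) ^+ N / T chi)); last by ring.
rewrite -[leLHS]mulrA ler_pM2r ?divr_gt0// /K.
have c0 : 0 <= B * (2 * pi) by rewrite mulr_ge0// ltW.
have := mulr_ge0 X0 c0; lra.
Qed.

End Poincare.

Lemma young (R : realFieldType) (s t eps : R) : 0 < eps ->
  `|2 * (s * t)| <= eps * (s * s) + eps^-1 * (t * t).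
Proof.
move=> e0; have e1 : eps * eps^-1 = 1 by rewrite divff// gt_eqF.
have K (r : R) : eps * (s * s) + eps^-1 * (r * r) - 2 * (s * r) = eps * (s - eps^-1 * r) ^+ 2.
  rewrite (_ : eps * _ ^+ 2 = eps * (s * s) + (eps * eps^-1) * (eps^-1 * (r * r))
    - 2 * ((eps * eps^-1) * (s * r))); last by ring.
  by rewrite e1; ring.
have P r : 0 <= eps * (s - eps^-1 * r) ^+ 2 by rewrite mulr_ge0 ?sqr_ge0// ltW.
have := P t; have := P (- t); rewrite -!K ler_norml => *.
by apply/andP; split; lra.
Qed.

Lemma norm_le_young (R : realFieldType) (s eps : R) : 0 < eps -> `|s| <= eps * (s * s) + eps^-1.
Proof.
move=> e0; have := young s 1 e0; rewrite !mulr1 normrM ger0_norm//.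
by have := normr_ge0 s; lra.
Qed.

(** * Coercivity of the magnetic energy, uniformly in the frequency *)

Section Coercivity.
Variables (R : realType) (n : nat).
Variable a : 'I_n -> 'rV[R]_n -> R.
Hypothesis sa : forall j, smooth_torus (a j).
Implicit Types (x y : 'rV[R]_n) (j k : 'I_n) (p q : 'rV[R]_n -> R) (xi : R).

Local Notation sp := (@smooth_torus R n).
Local Notation T := (@torus_integral R n).

(* Real and imaginary parts of [(d_j + i xi a_j) (p - i q)]. *)
Definition mag_re j xi p q x := partial j p x + xi * (a j x * q x).
Definition mag_im j xi p q x := partial j q x - xi * (a j x * p x).

Definition dens p q x := p x * p x + q x * q x.
Definition energy xi p q x := \sum_j dens (mag_re j xi p q) (mag_im j xi p q) x.

Lemma dens_sp p q : sp p -> sp q -> sp (dens p q).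
Proof. by move=> s1 s2; apply: spD; exact: spM. Qed.

Lemma dens_ge0 p q x : 0 <= dens p q x.
Proof. by rewrite addr_ge0// -expr2 sqr_ge0. Qed.

Lemma mag_re_sp j xi p q : sp p -> sp q -> sp (mag_re j xi p q).
Proof. by move=> s1 s2; apply: spD; [exact: sp_partial|apply: spZ; exact: spM]. Qed.

Lemma mag_im_sp j xi p q : sp p -> sp q -> sp (mag_im j xi p q).
Proof. by move=> s1 s2; apply: spB; [exact: sp_partial|apply: spZ; exact: spM]. Qed.

Lemma energy_sp xi p q : sp p -> sp q -> sp (energy xi p q).
Proof.
by move=> s1 s2; apply: sp_sum => j _; apply: dens_sp; [exact: mag_re_sp|exact: mag_im_sp].
Qed.

Lemma dens_le_energy j xi p q x : dens (mag_re j xi p q) (mag_im j xi p q) x <= energy xi p q x.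
Proof. by rewrite /energy (bigD1 j)//= lerDl sumr_ge0// => i _; exact: dens_ge0. Qed.

Lemma partial_dens j p q x : sp p -> sp q ->
  partial j (dens p q) x = 2 * (p x * partial j p x + q x * partial j q x).
Proof.
move=> s1 s2; rewrite (partialD j (spM s1 s1) (spM s2 s2)) (partialM j s1 s1) (partialM j s2 s2).
move: (partial j p x) (partial j q x) (p x) (q x) => *; ring.
Qed.

(* Diamagnetic inequality: the [a_j] drop out of [d_j |v|^2]. *)
Lemma diamagnetic j xi p q x (eps : R) : sp p -> sp q -> 0 < eps ->
  `|partial j (dens p q) x| <= eps * dens p q x + eps^-1 * energy xi p q x.
Proof.
move=> s1 s2 e0; rewrite partial_dens//.
apply: (@le_trans _ _ (eps * dens p q x
    + eps^-1 * dens (mag_re j xi p q) (mag_im j xi p q) x)); last first.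
  by rewrite lerD2l ler_wpM2l ?invr_ge0 ?(ltW e0)// dens_le_energy.
have -> : 2 * (p x * partial j p x + q x * partial j q x) =
    2 * (p x * mag_re j xi p q x + q x * mag_im j xi p q x).
  by rewrite /mag_re /mag_im; move: (partial j p x) (partial j q x) => u v; ring.
rewrite /dens; move: (p x) (q x) (mag_re j xi p q x) (mag_im j xi p q x) => c d u v.
rewrite mulrDr (le_trans (ler_normD _ _))//.
have := lerD (young c u e0) (young d v e0); lra.
Qed.

Definition curl j k x := partial j (a k) x - partial k (a j) x.

Lemma curl_sp j k : sp (curl j k).
Proof. by apply: spB; exact: sp_partial. Qed.

(** The magnetic current: the imaginary part of [conj v * (d_k + i xi a_k) v] for [v = p - i q]. *)
Definition current k xi p q x := q x * mag_re k xi p q x - p x * mag_im k xi p q x.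

Lemma current_sp k xi p q : sp p -> sp q -> sp (current k xi p q).
Proof.
move=> s1 s2; have sP := mag_re_sp k xi s1 s2; have sQ := mag_im_sp k xi s1 s2.
by apply: spB; exact: spM.
Qed.

Lemma currentE k xi p q : current k xi p q =
  fun x => (q x * partial k p x - p x * partial k q x) + xi * (a k x * dens p q x).
Proof.
apply/funext => x; rewrite /current /mag_re /mag_im /dens.
by move: (partial k p x) (partial k q x) => u v; ring.
Qed.

Lemma partial_current j k xi p q x : sp p -> sp q -> partial j (current k xi p q) x =
  partial j q x * partial k p x + q x * partial j (partial k p) x
  - (partial j p x * partial k q x + p x * partial j (partial k q) x)
  + xi * (partial j (a k) x * dens p q x + a k x * (2 * (p x * partial j p x + q x * partial j q x))).
Proof.
move=> s1 s2; have d1 := sp_partial k s1; have d2 := sp_partial k s2; have sd := dens_sp s1 s2.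
rewrite currentE (partialD j (spB (spM s2 d1) (spM s1 d2)) (spZ _ (spM (sa k) sd))).
rewrite (partialB j (spM s2 d1) (spM s1 d2)) (partialM j s2 d1) (partialM j s1 d2).
by rewrite (partialZ j _ (spM (sa k) sd)) (partialM j (sa k) sd) -partial_dens.
Qed.

(* The commutator of [d_j + i xi a_j] and [d_k + i xi a_k] is [i xi curl j k]. *)
Lemma commutator_identity j k xi p q x : sp p -> sp q ->
  xi * (curl j k x * dens p q x) =
  partial j (current k xi p q) x - partial k (current j xi p q) x
  + 2 * (mag_re j xi p q x * mag_im k xi p q x - mag_im j xi p q x * mag_re k xi p q x).
Proof.
move=> s1 s2; rewrite !partial_current// (partialC j k s1) (partialC j k s2).
rewrite /curl /mag_re /mag_im /dens.
move: (partial j p x) (partial j q x) (partial k p x) (partial k q x)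
 (partial j (a k) x) (partial k (a j) x) (partial k (partial j p) x) (partial k (partial j q) x).
move: (p x) (q x) (a j x) (a k x) => *; ring.
Qed.

(** The commutator identity is multiplied by the curl and integrated; the derivatives of the
    currents are moved onto the curl. This bounds [xi] times the left-hand side, so [|xi| >= 1]
    gives constants independent of [xi]. The parameter [d] makes the mass on the right as small as
    desired. *)
Lemma curl_mass j k : exists2 C : R, 0 < C & forall (d : R) xi p q, 0 < d -> 1 <= `|xi| ->
  sp p -> sp q -> T (fun x => dens p q x * (curl j k x * curl j k x)) <=
    C * d * T (dens p q) + (C + C / d) * T (energy xi p q).
Proof.
have sb := curl_sp j k.
have [B B0 bB] := boundedP (sp_bounded sb).
have [B1 B10 bB1] := boundedP (sp_bounded (sp_partial j sb)).
have [B2 B20 bB2] := boundedP (sp_bounded (sp_partial k sb)).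
exists (B + B + (B1 + B2)); first by rewrite !addr_gt0.
move=> d xi p q d0 xi1 s1 s2.
set b := curl j k in sb bB bB1 bB2 *.
have sP i := mag_re_sp i xi s1 s2; have sQ i := mag_im_sp i xi s1 s2.
have sJ i := current_sp i xi s1 s2; have sm := dens_sp s1 s2; have sE := energy_sp xi s1 s2.
(* What remains besides exact derivatives: a term quadratic in the magnetic derivatives, bounded by
   the energy, and currents with bounded coefficients. *)
pose F x := 2 * (b x * (mag_re j xi p q x * mag_im k xi p q x - mag_im j xi p q x * mag_re k xi p q x))
  - partial j b x * current k xi p q x + partial k b x * current j xi p q x.
have sF : sp F.
  have s3 := spB (spM (sP j) (sQ k)) (spM (sQ j) (sP k)).
  exact: (spD (spB (spZ 2 (spM sb s3)) (spM (sp_partial j sb) (sJ k))) (spM (sp_partial k sb) (sJ j))).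
have E : (fun x => xi * (dens p q x * (b x * b x))) =
  fun x => partial j (fun x => b x * current k xi p q x) x
    - partial k (fun x => b x * current j xi p q x) x + F x.
  apply/funext => x; rewrite (partialM j sb (sJ k)) (partialM k sb (sJ j)) /F.
  rewrite (_ : xi * _ = b x * (xi * (b x * dens p q x))); last by ring.
  rewrite /b (commutator_identity j k xi x s1 s2) -/b.
  move: (partial j _ x) (partial k _ x) (partial j b x) (partial k b x) => *; ring.
have TE : xi * T (fun x => dens p q x * (b x * b x)) = T F.
  rewrite -TZ; last by apply: spM => //; exact: spM.
  have sj := spM sb (sJ k); have sk := spM sb (sJ j).
  rewrite E (TD (spB (sp_partial j sj) (sp_partial k sk)) sF).
  by rewrite (TB (sp_partial j sj) (sp_partial k sk)) !T_partial// subrr add0r.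
have X0 : 0 <= T (fun x => dens p q x * (b x * b x)).
  apply: T_ge0 => [|x]; first by apply: spM => //; exact: spM.
  by rewrite mulr_ge0 ?dens_ge0// -expr2 sqr_ge0.
pose C := B + B + (B1 + B2).
pose G x := C * d * dens p q x + (C + C / d) * energy xi p q x.
have sG : sp G by apply: spD; apply: spZ.
have FG x : `|F x| <= G x.
  have Hj := dens_le_energy j xi p q x; have Hk := dens_le_energy k xi p q x.
  have := bB x; have := bB1 x; have := bB2 x.
  rewrite /F /G /current; move: Hj Hk; rewrite /dens.
  move: (partial j b x) (partial k b x) (b x) (energy xi p q x) (mag_re j xi p q x)
   (mag_im j xi p q x) (mag_re k xi p q x) (mag_im k xi p q x) (p x) (q x).
  move=> b1 b2 b0 e pj qj pk qk c s Hj Hk h2 h1 h0.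
  (* A current is a product of [v] and a magnetic derivative, so Young's inequality trades mass
     against energy. *)
  have cross u v : u * u + v * v <= e -> `|s * u - c * v| <= d * (c * c + s * s) + d^-1 * e.
    move=> ue; have i0 : 0 <= d^-1 by rewrite invr_ge0 ltW.
    have := young s u d0; have := young (- c) v d0.
    have := ler_wpM2l i0 ue; rewrite !ler_norml => H0 /andP[H1 H2] /andP[H3 H4].
    by apply/andP; split; lra.
  have J : `|2 * (pj * qk - qj * pk)| <= e + e.
    have := young pj qk ltr01; have := young (- qj) pk ltr01.
    by rewrite invr1 !ler_norml => /andP[H1 H2] /andP[H3 H4]; apply/andP; split; lra.
  have Kj := cross _ _ Hj; have Kk := cross _ _ Hk.
  have L0 : `|2 * (b0 * (pj * qk - qj * pk))| <= B * (e + e).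
    by rewrite mulrCA normrM ler_pM.
  have L1 : `|b1 * (s * pk - c * qk)| <= B1 * (d * (c * c + s * s) + d^-1 * e).
    by rewrite normrM ler_pM.
  have L2 : `|b2 * (s * pj - c * qj)| <= B2 * (d * (c * c + s * s) + d^-1 * e).
    by rewrite normrM ler_pM.
  rewrite (le_trans (ler_normD _ _))//.
  rewrite (le_trans (lerD (ler_normB _ _) L2))//.
  have := lerD L0 L1.
  have e0 : 0 <= e by apply: le_trans Hj; rewrite addr_ge0// -expr2 sqr_ge0.
  have di0 : 0 <= d^-1 by rewrite invr_ge0 ltW.
  have m0 : 0 <= d * (c * c + s * s).
    by rewrite mulr_ge0 ?(ltW d0)// addr_ge0// -expr2 sqr_ge0.
  have := mulr_ge0 (addr_ge0 (ltW B0) (ltW B0)) m0.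
  have := mulr_ge0 (addr_ge0 (ltW B0) (ltW B0)) (mulr_ge0 di0 e0).
  have := mulr_ge0 (addr_ge0 (ltW B10) (ltW B20)) e0.
  rewrite /C; lra.
have TG : T G = C * d * T (dens p q) + (C + C / d) * T (energy xi p q).
  by rewrite /G (TD (spZ _ sm) (spZ _ sE)) (TZ _ sm) (TZ _ sE).
rewrite -/C -TG; apply: le_trans (T_norm_le sF sG FG).
by rewrite -TE normrM (ger0_norm X0) ler_peMl.
Qed.

(** [poincare_L1] for [m = |v|^2] with the square of a nonzero curl as weight: the diamagnetic
    inequality bounds the gradient, [curl_mass] the weighted mass. *)
Theorem magnetic_coercive : ~ closed_form a ->
  exists2 C : R, 0 < C & forall xi p q, 1 <= `|xi| -> sp p -> sp q ->
    T (dens p q) <= C * T (energy xi p q).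
Proof.
move=> ncl.
have [j [k bjk]] : exists j k, curl j k <> fun=> 0.
  apply: contrapT => H; apply: ncl => j k; apply/funext => x; apply: subr0_eq.
  have -> // : partial j (a k) x - partial k (a j) x = (fun=> 0) x.
  rewrite -[LHS]/(curl j k x); congr (_ x); apply: contrapT => bjk.
  by apply: H; exists j, k.
have sb := curl_sp j k; pose chi x := curl j k x * curl j k x.
have schi : sp chi by exact: spM.
have chi0 x : 0 <= chi x by rewrite /chi -expr2 sqr_ge0.
have Tchi : 0 < T chi.
  rewrite lt_neqAle T_ge0// andbT eq_sym; apply/negP => /eqP /(T_eq0 schi chi0) E.
  apply: bjk; apply/funext => x; have /eqP := congr1 (@^~ x) E.
  by rewrite /chi mulf_eq0 orbb => /eqP.
have [C0 C00 HP] := poincare_L1 schi chi0 Tchi.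
have [C1 C10 HC] := curl_mass j k.
(* Each choice leaves at most a quarter of the mass on the right; the half is absorbed, hence the
   leading 2 in the constant. *)
pose d := (C0 * C1 * 4)^-1; pose e := (C0 * (n.+1%:R * 4))^-1.
have d0 : 0 < d by rewrite invr_gt0 !mulr_gt0.
have e0 : 0 < e by rewrite invr_gt0 !mulr_gt0.
exists (2 * (C0 * (C1 + C1 / d + n%:R / e))) => [|xi p q xi1 s1 s2].
  rewrite !mulr_gt0// ltr_wpDr ?divr_ge0 ?(ltW e0)// addr_gt0// divr_gt0//.
have sm := dens_sp s1 s2; have sE := energy_sp xi s1 s2.
pose G x := e * dens p q x + e^-1 * energy xi p q x.
have sG : sp G by apply: spD; apply: spZ.
have := HP _ (fun=> G) sm (dens_ge0 p q) (fun=> sG) (fun j x => diamagnetic j xi x s1 s2 e0).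
have TG : T G = e * T (dens p q) + e^-1 * T (energy xi p q).
  by rewrite /G (TD (spZ _ sm) (spZ _ sE)) (TZ _ sm) (TZ _ sE).
rewrite sumr_const card_ord TG /chi -[(_ + _) *+ n]mulr_natl => H1.
have H2 := HC d xi p q d0 xi1 s1 s2.
have H3 : C0 * (C1 * d) = 4^-1.
  rewrite /d; field; rewrite !gt_eqF//.
have H4 : C0 * (n%:R * e) <= 4^-1.
  rewrite [leLHS](_ : _ = n%:R / n.+1%:R / 4).
    by rewrite ler_pdivrMr// mulVf// ler_pdivrMr// mul1r ler_nat.
  rewrite /e; move: (n.+1%:R) (@ltr0Sn R n) => u u0; field.
  by rewrite !gt_eqF.
have M0 : 0 <= T (dens p q) by apply: T_ge0 => // x; exact: dens_ge0.
move: (T (fun x => dens p q x * _)) H1 H2 => X H1 H2.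
move: (T (dens p q)) (T (energy xi p q)) H1 H2 M0 => M S H1 H2 M0.
have A1 := ler_wpM2l (ltW C00) H2; have A2 := ler_wpM2r M0 H4.
have A3 : C0 * (C1 * d) * M = 4^-1 * M by rewrite H3.
by move: H1 A1 A2 A3; lra.
Qed.

End Coercivity.

(** * Hypoellipticity for non-closed coefficients *)

(** One power of [wt] is a sum of [1] and the [|k_j|], and each [|k_j|] is traded for a derivative
    of [F] by parts. *)
Lemma T_rapid (R : realType) (N : nat) (F : 'rV[R]_N -> R) : smooth_torus F ->
  rapid (fun phi => torus_integral (fun x => F x * phi x)).
Proof.
move=> + m; elim: m F => [|m IH] F sF.
  have [B B0 FB] := boundedP (sp_bounded sF).
  exists (B * (2 * pi) ^+ N) => k th; rewrite expr0 mulr1.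
  apply: T_bound => [|x]; first exact: spM sF (wave_sp k th).
  by rewrite normrM -[leRHS]mulr1 ler_pM ?wave_le1.
have [C HC] := IH F sF.
have [D HD] := choice (fun j => IH _ (sp_partial j sF)).
exists (C + \sum_j D j) => k th.
rewrite exprS mulrCA {1}/wt mulrDl mul1r lerD// mulr_suml; apply: ler_sum => j _.
rewrite mulrCA mulrC.
have sw := @wave_sp R N k (th - pi / 2).
have := T_parts j sF sw; rewrite partial_wave subrK => E.
have : `|(k 0 j)%:~R| * `|torus_integral (fun x => F x * wave k th x)| =
    `|torus_integral (fun x => partial j F x * wave k (th - pi / 2) x)|.
  rewrite -normrM -(TZ _ (spM sF (wave_sp k th))) -[in RHS]normrN -E; congr `|_|.
  by congr torus_integral; apply/funext => x; rewrite mulrCA.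
by rewrite mulrC => H; have := HD j k (th - pi / 2); rewrite -H; lra.
Qed.

(** * Decay in the frequencies of [t] by ellipticity *)

Section Bootstrap.
Variables (R : realType) (n : nat).
Implicit Types (k : 'rV[int]_(n + 1)) (j : 'I_n) (th : R) (g : 'rV[R]_n -> R).
Implicit Types (h : 'rV[int]_(n + 1) -> R -> R) (s m : nat).

Local Notation sp1 := (@smooth_torus R (n + 1)).
Local Notation sp := (@smooth_torus R n).
Local Notation T1 := (@torus_integral R (n + 1)).

Definition tau k j : R := (k 0 (lshift 1 j))%:~R.
Definition xi k : R := (k 0 (xdir n))%:~R.
Definition wtau k : R := 1 + \sum_j `|tau k j|.
Definition wxi k : R := 1 + `|xi k|.

Lemma wtE k : wt R k = wtau k + `|xi k|.
Proof. by rewrite /wt big_split_ord/= big_ord1 addrA. Qed.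

Lemma wtau_ge1 k : 1 <= wtau k. Proof. by rewrite lerDl sumr_ge0. Qed.
Lemma wxi_ge1 k : 1 <= wxi k. Proof. by rewrite lerDl. Qed.
Lemma wtau_ge0 k : 0 <= wtau k. Proof. exact: le_trans (wtau_ge1 k). Qed.
Lemma wxi_ge0 k : 0 <= wxi k. Proof. exact: le_trans (wxi_ge1 k). Qed.

Lemma wt_le k : wt R k <= wtau k * wxi k.
Proof. by rewrite wtE /wxi mulrDr mulr1 lerD2l ler_peMl// wtau_ge1. Qed.

Lemma wtau_le_wt k : wtau k <= wt R k.
Proof. by rewrite wtE lerDl. Qed.

Lemma tau_le k j : `|tau k j| <= wtau k.
Proof. by rewrite /wtau (bigD1 j)//= addrCA lerDl addr_ge0// sumr_ge0. Qed.

(** Cauchy-Schwarz for the [n + 1] numbers [1] and [|tau k j|]: the weight is controlled by the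
    symbol of [1] minus the Laplacian in [t]. *)
Lemma wtau_sqr k : wtau k ^+ 2 <= n.+1%:R * (1 + \sum_j tau k j ^+ 2).
Proof.
have H (s : seq 'I_n) : (1 + \sum_(j <- s) `|tau k j|) ^+ 2 <=
    (size s).+1%:R * (1 + \sum_(j <- s) tau k j ^+ 2).
  elim: s => [|j s IH]; first by rewrite !big_nil !addr0 expr1n mul1r.
  rewrite !big_cons /= -(real_normK (num_real (tau k j))).
  move: IH; rewrite -[(size s).+2]addn1 natrD.
  have c0 : 0 < (size s).+1%:R :> R by rewrite ltr0n.
  move: (\sum_(i <- s) `|tau k i|) (\sum_(i <- s) tau k i ^+ 2) ((size s).+1%:R) `|tau k j| c0.
  move=> S Q c x c0 IH; rewrite -(ler_pM2l c0) -subr_ge0.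
  rewrite [leRHS](_ : _ = (c + 1) * (c * (1 + Q) - (1 + S) ^+ 2) + (1 + S - c * x) ^+ 2).
    by rewrite addr_ge0 ?sqr_ge0// mulr_ge0 ?subr_ge0// addr_ge0// ltW.
  ring.
by have := H (enum 'I_n); rewrite !big_enum/= size_enum_ord.
Qed.

(* For [h = coef g], what matters is that the loss [m] does not depend on the gain [s]. *)
Definition tame s m h := exists (C : R) (M : nat), 0 <= C /\
  forall k th, `|h k th| * wtau k ^+ s <= C * (wxi k ^+ M * wtau k ^+ m).

Lemma wxi_weak k (M M' : nat) : (M <= M')%N -> wxi k ^+ M <= wxi k ^+ M'.
Proof. by move=> MM; apply: ler_weXn2l => //; exact: wxi_ge1. Qed.

Lemma tameD s m h1 h2 : tame s m h1 -> tame s m h2 -> tame s m (fun k th => h1 k th + h2 k th).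
Proof.
move=> [C1 [M1 [C10 H1]]] [C2 [M2 [C20 H2]]].
exists (C1 + C2), (M1 + M2)%N; split=> [|k th]; first exact: addr_ge0.
have w0 := exprn_ge0 s (wtau_ge0 k); have w1 := exprn_ge0 m (wtau_ge0 k).
apply: (@le_trans _ _ (`|h1 k th| * wtau k ^+ s + `|h2 k th| * wtau k ^+ s)).
  by rewrite -mulrDl ler_wpM2r// ler_normD.
rewrite mulrDl lerD//.
  by rewrite (le_trans (H1 k th))// ler_wpM2l// ler_wpM2r// wxi_weak// leq_addr.
by rewrite (le_trans (H2 k th))// ler_wpM2l// ler_wpM2r// wxi_weak// leq_addl.
Qed.

Lemma tame_sum s m (H : 'I_n -> 'rV[int]_(n + 1) -> R -> R) : (forall j, tame s m (H j)) ->
  tame s m (fun k th => \sum_j H j k th).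
Proof.
move=> tH; elim: (index_enum _) => [|j l IH].
  exists 0, 0%N; split=> // k th; rewrite big_nil normr0 !mul0r//.
have := tameD (tH j) IH; congr (tame s m _).
by apply/funext => k; apply/funext => th; rewrite big_cons.
Qed.

Lemma tame_mul s m m' h (c : 'rV[int]_(n + 1) -> R) (e : nat) : (m <= m')%N ->
  (forall k, `|c k| <= wxi k ^+ e * wtau k ^+ (m' - m)) -> tame s m h ->
  tame s m' (fun k th => c k * h k th).
Proof.
move=> mm cb [C [M [C0 H]]]; exists C, (e + M)%N; split=> // k th.
have w1 := exprn_ge0 m (wtau_ge0 k).
rewrite normrM -mulrA (_ : C * _ = (wxi k ^+ e * wtau k ^+ (m' - m)) * (C * (wxi k ^+ M * wtau k ^+ m))).
  by apply: ler_pM => //; rewrite mulr_ge0// exprn_ge0// wtau_ge0.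
by rewrite exprD -{1}(subnK mm) exprD; ring.
Qed.

Lemma tame_shift s m h c : tame s m h -> tame s m (fun k th => h k (th + c)).
Proof. by move=> [C [M [C0 H]]]; exists C, M; split=> // k th; exact: H. Qed.

Lemma tame_tau s m h j : tame s m h -> tame s m.+1 (fun k th => tau k j * h k th).
Proof.
apply: (@tame_mul _ _ _ _ (fun k => tau k j) 0) => // k.
by rewrite subSn// subnn expr0 mul1r expr1 tau_le.
Qed.

Lemma tame_xi s m h : tame s m h -> tame s m (fun k th => xi k * h k th).
Proof.
apply: (@tame_mul _ _ _ _ xi 1) => // k.
by rewrite subnn expr0 mulr1 expr1 lerDr.
Qed.

Lemma tame_weak s m h : tame s m h -> tame s m.+1 h.
Proof.
move=> /(@tame_mul _ _ m.+1 _ (fun=> 1) 0) H.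
have := H (leqnSn m); rewrite (_ : (fun k th => 1 * h k th) = h).
  by apply=> k; rewrite normr1 subSn// subnn expr0 mul1r expr1 wtau_ge1.
by apply/funext => k; apply/funext => th; rewrite mul1r.
Qed.

(** The elliptic symbol is worth two powers of [wtau]; one compensates the loss [m.+1], the other is
    the gain. *)
Lemma tame_gain s m h :
  tame s m.+1 (fun k th => (1 + \sum_j tau k j ^+ 2) * h k th) -> tame s.+1 m h.
Proof.
move=> [C [M [C0 H]]]; exists (n.+1%:R * C), M; split=> [|k th]; first exact: mulr_ge0.
have w1 := wtau_ge1 k; have w0 : 0 < wtau k := lt_le_trans ltr01 w1.
rewrite -(ler_pM2r w0) -!mulrA -!exprSr.
have S0 : 0 <= 1 + \sum_j tau k j ^+ 2.
  by rewrite addr_ge0// sumr_ge0// => j _; exact: sqr_ge0.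
apply: (@le_trans _ _ (n.+1%:R * (`|(1 + \sum_j tau k j ^+ 2) * h k th| * wtau k ^+ s))).
  rewrite normrM (ger0_norm S0) -[s.+2]addn2 exprD.
  rewrite (_ : n.+1%:R * _ = `|h k th| * (wtau k ^+ s * (n.+1%:R * (1 + \sum_j tau k j ^+ 2)))).
    by rewrite ler_wpM2l// ler_wpM2l ?exprn_ge0 ?(ltW w0)// wtau_sqr.
  by ring.
by rewrite ler_wpM2l.
Qed.

Variable a : 'I_n -> 'rV[R]_n -> R.
Hypothesis sa : forall j, sp (a j).
Variables (v : ('rV[R]_(n + 1) -> R) -> R) (f : 'rV[R]_(n + 1) -> R).
Hypotheses (dv : rdist v) (sf : sp1 f).
Hypothesis vf : forall phi, sp1 phi -> v (sq_sum a phi) = T1 (fun p => f p * phi p).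

Definition pwave g k th (p : 'rV[R]_(n + 1)) := pull g p * wave k th p.

Lemma pwave_sp g k th : sp g -> sp1 (pwave g k th).
Proof. by move=> sg; apply: (spM (pull_sp sg)); exact: wave_sp. Qed.

Lemma partial_pwave g k th j : sp g -> partial (lshift 1 j) (pwave g k th) =
  fun p => pwave (partial j g) k th p + tau k j * pwave g k (th + pi / 2) p.
Proof.
move=> sg; rewrite (partialM _ (pull_sp sg) (wave_sp k th)) partial_pull// partial_wave.
by apply/funext => p; rewrite /pwave mulrCA.
Qed.

Lemma partialx_pwave g k th : sp g -> partial (xdir n) (pwave g k th) =
  fun p => xi k * pwave g k (th + pi / 2) p.
Proof.
move=> sg; rewrite (partialM _ (pull_sp sg) (wave_sp k th)) partialx_pull partial_wave.
by apply/funext => p; rewrite /pwave mul0r add0r mulrCA.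
Qed.

Lemma tube_deriv_pwave j g k th : sp g -> tube_deriv j (a j) (pwave g k th) =
  fun p => pwave (partial j g) k th p + (tau k j * pwave g k (th + pi / 2) p +
    xi k * pwave (fun t => a j t * g t) k (th + pi / 2) p).
Proof.
move=> sg; apply/funext => p.
rewrite /tube_deriv partial_pwave// partialx_pwave// -addrA; congr (_ + (_ + _)).
by rewrite /pwave /pull; ring.
Qed.

Definition coef g k th := v (pwave g k th).

Lemma v_tube_deriv_pwave j g k th : sp g -> v (tube_deriv j (a j) (pwave g k th)) =
  coef (partial j g) k th + tau k j * coef g k (th + pi / 2)
  + xi k * coef (fun t => a j t * g t) k (th + pi / 2).
Proof.
move=> sg; have lv := dv.1; have sag := spM (sa j) sg.
have s1 := pwave_sp k th (sp_partial j sg).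
have s2 := pwave_sp k (th + pi / 2) sg; have s3 := pwave_sp k (th + pi / 2) sag.
rewrite tube_deriv_pwave// (linD lv s1 (spD (spZ _ s2) (spZ _ s3))).
by rewrite (linD lv (spZ _ s2) (spZ _ s3)) (linZ _ lv s2) (linZ _ lv s3) addrA.
Qed.

Lemma v_tube_deriv2_pwave j g k th : sp g ->
  v (tube_deriv j (a j) (tube_deriv j (a j) (pwave g k th))) =
  v (tube_deriv j (a j) (pwave (partial j g) k th))
  + tau k j * v (tube_deriv j (a j) (pwave g k (th + pi / 2)))
  + xi k * v (tube_deriv j (a j) (pwave (fun t => a j t * g t) k (th + pi / 2))).
Proof.
move=> sg; have lv := dv.1; have sag := spM (sa j) sg.
have s1 := pwave_sp k th (sp_partial j sg).
have s2 := pwave_sp k (th + pi / 2) sg; have s3 := pwave_sp k (th + pi / 2) sag.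
have d phi : sp1 phi -> sp1 (tube_deriv j (a j) phi) by exact: tube_deriv_sp.
rewrite (tube_deriv_pwave j k th sg).
rewrite (_ : (fun p => _) = fun p => tau k j * pwave g k (th + pi / 2) p +
   (xi k * pwave (fun t => a j t * g t) k (th + pi / 2) p + pwave (partial j g) k th p)); last first.
  by apply/funext => p; ring.
rewrite (tube_deriv_lin j (a j) _ s2 (spD (spZ _ s3) s1)) (tube_deriv_lin j (a j) _ s3 s1).
rewrite (lv _ _ _ (d _ s2) (spD (spZ _ (d _ s3)) (d _ s1))) (lv _ _ _ (d _ s3) (d _ s1)).
by ring.
Qed.

Lemma coef_shift2 g k th : sp g -> coef g k (th + pi / 2 + pi / 2) = - coef g k th.
Proof.
move=> sg; rewrite /coef -(linN dv.1 (pwave_sp k th sg)); congr v; apply/funext => p.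
by rewrite /pwave /wave !addrA cosDpihalf sinDpihalf mulrN.
Qed.

(* The lower-order part of [X_j ^ 2], as seen on [pwave g k th]: at most one factor [tau], at
   the cost of factors [xi]. *)
Definition remainder j g k th :=
  coef (partial j (partial j g)) k th
  + tau k j * (2 * coef (partial j g) k (th + pi / 2))
  + xi k * (coef (fun t => a j t * partial j g t) k (th + pi / 2)
            + coef (partial j (fun t => a j t * g t)) k (th + pi / 2))
  + xi k * (tau k j * (2 * coef (fun t => a j t * g t) k (th + pi / 2 + pi / 2)))
  + xi k * (xi k * coef (fun t => a j t * (a j t * g t)) k (th + pi / 2 + pi / 2)).

(** In [X_j ^ 2] the two derivatives of the wave in [t_j] produce [tau^2] and a phase shift by pi,
    that is a sign. Moved to the left, these leading terms form the elliptic symbol. *)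
Lemma coef_elliptic g k th : sp g -> (1 + \sum_j tau k j ^+ 2) * coef g k th =
  coef g k th - T1 (fun p => f p * pwave g k th p) + \sum_j remainder j g k th.
Proof.
move=> sg; rewrite -vf; last exact: pwave_sp.
have d phi j : sp1 phi -> sp1 (tube_deriv j (a j) phi) by exact: tube_deriv_sp.
rewrite /sq_sum (lin_sum _ dv.1); last by move=> j; exact/d/d/pwave_sp.
rewrite mulrDl mul1r -addrA; congr (_ + _).
rewrite addrC -sumrB mulr_suml; apply: eq_bigr => j _.
have sag := spM (sa j) sg; have sj := sp_partial j sg.
rewrite v_tube_deriv2_pwave// !v_tube_deriv_pwave// coef_shift2// /remainder; ring.
Qed.

(** The loss [m] is the order of [v]. The induction on [s] must treat all amplitudes [g] at once,
    since the remainder involves derivatives of [g] and its products with the [a_j]; it contains at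
    most one [tau], just what [tame_gain] can afford. *)
Lemma coef_tame : exists m, forall s g, sp g -> tame s m (coef g).
Proof.
have [lv [C [m [C0 vC]]]] := dv; exists m.
elim=> [|s IH] g sg.
  have [A A0 HA] := sp_Cm_le m (pull_sp sg).
  exists (C * (2 ^+ m * A)), m; split=> [|k th].
    by rewrite !mulr_ge0// ?exprn_ge0// ltW.
  rewrite expr0 mulr1.
  have wk := wt_gt0 R k.
  apply: (@le_trans _ _ (C * (2 ^+ m * (A * wt R k ^+ m)))).
    apply: vC; first exact: pwave_sp.
    apply: Cm_leM => //; [exact: pull_sp|exact: wave_sp|].
    by move=> l x sl; exact: partials_wave_le.
  rewrite -!mulrA ler_wpM2l// ler_wpM2l ?exprn_ge0// ler_pM2l// -exprMn.
  by rewrite lerXn2r ?nnegrE ?mulr_ge0 ?wxi_ge0 ?wtau_ge0 ?(ltW wk)// mulrC wt_le.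
apply: tame_gain.
rewrite (_ : (fun k th => _) = (fun k th => coef g k th +
   (- T1 (fun p => f p * pwave g k th p) + \sum_j remainder j g k th))); last first.
  by apply/funext => k; apply/funext => th; rewrite coef_elliptic// addrA.
apply: tameD; first exact/tame_weak/IH.
have sh2 h : tame s m h -> tame s m (fun k th => 2 * h k th).
  move=> th; have := tameD th th; congr (tame s m _).
  by apply/funext => k; apply/funext => t; ring.
apply: tameD; last first.
  apply: tame_sum => j; have sj := sp_partial j sg; have sag := spM (sa j) sg.
  apply: tameD; first apply: tameD; first apply: tameD; first apply: tameD.
  - exact/tame_weak/IH/sp_partial.
  - apply: tame_tau; apply: sh2; apply: (tame_shift (h := coef (partial j g))); exact: IH.
  - apply: tame_xi; apply: tame_weak; apply: tameD.
      apply: (tame_shift (h := coef (fun t => a j t * partial j g t))).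
      by apply: IH; apply: spM (sa j) sj.
    apply: (tame_shift (h := coef (partial j (fun t => a j t * g t)))).
    by apply: IH; apply: sp_partial.
  - apply: tame_xi; apply: tame_tau; apply: sh2.
    apply: (tame_shift (h := fun k th => coef (fun t => a j t * g t) k (th + pi / 2))).
    by apply: (tame_shift (h := coef (fun t => a j t * g t))); exact: IH.
  - apply: tame_xi; apply: tame_xi; apply: tame_weak.
    apply: (tame_shift (h := fun k th => coef (fun t => a j t * (a j t * g t)) k (th + pi / 2))).
    apply: (tame_shift (h := coef (fun t => a j t * (a j t * g t)))).
    by apply: IH; apply: spM (sa j) sag.
have sfg : sp1 (fun p => f p * pull g p) by apply: spM => //; exact: pull_sp.
have [D HD] := T_rapid sfg s.
have D0 : 0 <= D.
  by rewrite (le_trans _ (HD 0 0))// mulr_ge0// exprn_ge0// ltW// wt_gt0.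
exists D, 0%N; split=> // k th; rewrite normrN expr0 mul1r.
apply: (@le_trans _ _ D); last by rewrite ler_peMr// exprn_ege1// wtau_ge1.
apply: le_trans (HD k th).
rewrite (_ : (fun p => f p * pwave g k th p) = fun p => f p * pull g p * wave k th p).
  rewrite ler_wpM2l// lerXn2r ?nnegrE ?wtau_ge0 ?wtau_le_wt// ltW// wt_gt0//.
by apply/funext => p; rewrite /pwave mulrA.
Qed.

Lemma v_wave_tangential (s : nat) : exists (C : R) (M : nat), 0 <= C /\
  forall k th, `|v (wave k th)| * wtau k ^+ s <= C * wxi k ^+ M.
Proof.
(* The additional [m] powers cancel the fixed loss. *)
have [m Hm] := coef_tame; have [C [M [C0 H]]] := Hm (s + m)%N _ (sp_cst n (1 : R)).
exists C, M; split=> // k th; have := H k th; rewrite exprD !mulrA ler_pM2r; last first.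
  by rewrite exprn_gt0// (lt_le_trans _ (wtau_ge1 k)).
rewrite /coef (_ : pwave _ k th = wave k th)//.
by apply/funext => p; rewrite /pwave /pull mul1r.
Qed.

End Bootstrap.

(** * Partial Fourier coefficients in [x] and their decay *)

Section NotClosed.
Variables (R : realType) (n : nat).
Implicit Types (z : int) (k : 'rV[int]_(n + 1)) (j : 'I_n) (th : R) (g p q : 'rV[R]_n -> R).

Local Notation sp1 := (@smooth_torus R (n + 1)).
Local Notation sp := (@smooth_torus R n).
Local Notation T1 := (@torus_integral R (n + 1)).
Local Notation Tn := (@torus_integral R n).

Definition zx z : 'rV[int]_(n + 1) := row_mx 0 (const_mx z).

Lemma xi_zx z : xi R (zx z) = z%:~R.
Proof. by rewrite /xi row_mxEr mxE. Qed.

Lemma tau_zx z j : tau R (zx z) j = 0.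
Proof. by rewrite /tau row_mxEl mxE. Qed.

Lemma zx_split k : k = row_mx (lsubmx k) 0 + zx (k 0 (xdir n)).
Proof.
rewrite add_row_mx addr0 add0r -[LHS]hsubmxK; congr row_mx.
by apply/rowP => i; rewrite !mxE (ord1 i).
Qed.

Lemma pull_wave (l : 'rV[int]_n) th : pull (wave l th) = wave (row_mx l 0) th :> ('rV[R]_(n + 1) -> R).
Proof.
apply/funext => x; rewrite /pull /wave; congr (cos (_ + _)).
rewrite /dotz big_split_ord/= big_ord1 row_mxEr mxE mul0r addr0.
by apply: eq_bigr => i _; rewrite row_mxEl mxE.
Qed.

Lemma pwave_shift g k th (x : 'rV[R]_(n + 1)) :
  pwave g k (th + pi / 2 + pi / 2) x = - pwave g k th x.
Proof. by rewrite /pwave /wave !addrA cosDpihalf sinDpihalf mulrN. Qed.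

(** Integration by parts in [x] does not touch [g], so [F'], the [M]-th [x]-derivative of [F],
    serves all amplitudes; only the phase changes. *)
Lemma xi_parts (F : 'rV[R]_(n + 1) -> R) (M : nat) : sp1 F -> exists2 F', sp1 F' &
  forall g z th, sp g -> exists th', `|z%:~R| ^+ M * `|T1 (fun x => F x * pwave g (zx z) th x)| =
    `|T1 (fun x => F' x * pwave g (zx z) th' x)|.
Proof.
elim: M F => [|M IH] F sF.
  by exists F => // g z th sg; exists th; rewrite expr0 mul1r.
have [F' sF' HF] := IH _ (sp_partial (xdir n) sF); exists F' => // g z th sg.
have [th' E] := HF g z (th - pi / 2) sg; exists th'; rewrite -E exprSr -mulrA; congr (_ * _).
have s1 := pwave_sp (zx z) (th - pi / 2) sg; have s2 := pwave_sp (zx z) th sg.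
rewrite -normrM -(TZ _ (spM sF s2)) -[in RHS]normrN -(T_parts _ sF s1).
rewrite partialx_pwave// subrK xi_zx; congr `|_|; congr T1; apply/funext => x.
by rewrite mulrCA.
Qed.

(** Linear dependence on [g] is traded for a quadratic one, comparable with the mass; [d] stays free
    so that it can later depend on the frequency. *)
Lemma xi_decay (F : 'rV[R]_(n + 1) -> R) (M : nat) : sp1 F -> exists2 B : R, 0 < B &
  forall g z th (d : R), sp g -> 0 < d ->
    `|z%:~R| ^+ M * `|T1 (fun x => F x * pwave g (zx z) th x)| <=
    B * (d * Tn (fun t => g t * g t) + d^-1).
Proof.
move=> sF; have [F' sF' HF] := xi_parts M sF.
have [A A0 FA] := boundedP (sp_bounded sF').
have p2 := twopi_gt0 R; have pN : 0 < (2 * pi) ^+ (n + 1) :> R by rewrite exprn_gt0.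
exists (A * (2 * pi + (2 * pi) ^+ (n + 1))); first by rewrite mulr_gt0// addr_gt0.
move=> g z th d sg d0; have [th' ->] := HF g z th sg.
have sgg := spM sg sg; have sw := pwave_sp (zx z) th' sg.
pose G (x : 'rV[R]_(n + 1)) := A * (d * pull (fun t => g t * g t) x + d^-1).
have sG : sp1 G by apply: spZ; apply: spD; [apply: spZ; exact: pull_sp|exact: sp_cst].
have TG : T1 G = A * (d * (2 * pi * Tn (fun t => g t * g t)) + d^-1 * (2 * pi) ^+ (n + 1)).
  have s1 := spZ d (pull_sp sgg).
  rewrite /G (TZ _ (spD s1 (sp_cst _ _))) (TD s1 (sp_cst _ _)) (TZ _ (pull_sp sgg)).
  by rewrite T_cst (T_pull sgg).
have FG x : `|F' x * pwave g (zx z) th' x| <= G x.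
  rewrite normrM ler_pM// /pwave normrM.
  apply: (@le_trans _ _ `|pull g x|); first by rewrite ler_piMr// wave_le1.
  exact: norm_le_young.
have Tgg : 0 <= Tn (fun t => g t * g t).
  by apply: T_ge0 => // t; rewrite -expr2 sqr_ge0.
apply: (le_trans (T_norm_le (spM sF' sw) sG FG)).
rewrite TG -[leRHS]mulrA ler_pM2l//.
have i0 : 0 <= d^-1 by rewrite invr_ge0 ltW.
have := mulr_ge0 (ltW pN) (mulr_ge0 (ltW d0) Tgg); have := mulr_ge0 (ltW p2) i0.
lra.
Qed.

Variable a : 'I_n -> 'rV[R]_n -> R.
Hypothesis sa : forall j, sp (a j).
Variables (v : ('rV[R]_(n + 1) -> R) -> R) (f : 'rV[R]_(n + 1) -> R).
Hypotheses (dv : rdist v) (sf : sp1 f).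
Hypothesis vf : forall phi, sp1 phi -> v (sq_sum a phi) = T1 (fun x => f x * phi x).

Local Notation vcoef := (coef v).

Lemma slice_rdist k th : rdist (fun g => vcoef g k th).
Proof.
have [lv [C [m [C0 vC]]]] := dv; split.
  move=> c g1 g2 s1 s2; rewrite /coef -(lv _ _ _ (pwave_sp k th s1) (pwave_sp k th s2)).
  by congr v; apply/funext => x; rewrite /pwave /pull; ring.
have [A A0 HA] := sp_Cm_le m (wave_sp k th).
exists (C * (2 ^+ m * A)), m; split; first by rewrite !mulr_ge0// ?exprn_ge0// ltW.
move=> g M sg HM; rewrite -!mulrA [A * M]mulrC; apply: vC; first exact: pwave_sp.
apply: Cm_leM => //; [exact: pull_sp|exact: wave_sp|exact: pull_Cm_le].
Qed.

(** A wave in [t] times a wave in [x] is half the sum of two waves with the same weights [wtau] and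
    [wxi]. The constant depends on [z], which is harmless as only smoothness of each slice is
    wanted. *)
Lemma slice_rapid z th : rapid (fun g => vcoef g (zx z) th).
Proof.
move=> m; have [C [M [C0 HC]]] := v_wave_tangential sa dv sf vf m.
exists (C * wxi R (zx z) ^+ M) => l th'.
have lv := dv.1.
have E : vcoef (wave l th') (zx z) th =
   2^-1 * (v (wave (row_mx l 0 + zx z) (th' + th)) + v (wave (row_mx l 0 - zx z) (th' - th))).
  rewrite -(linD lv (wave_sp _ _) (wave_sp _ _)) -(linZ _ lv (spD (wave_sp _ _) (wave_sp _ _))).
  by congr v; apply/funext => x; rewrite /pwave pull_wave waveM.
have addE (A B : 'rV[int]_(n + 1)) i : (A + B) 0 i = A 0 i + B 0 i by rewrite mxE.
have oppE (A : 'rV[int]_(n + 1)) i : (- A) 0 i = - A 0 i by rewrite mxE.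
have W (s : bool) t : `|v (wave (row_mx l 0 + (if s then zx z else - zx z)) t)| * wt R l ^+ m <=
    C * wxi R (zx z) ^+ M.
  have := HC (row_mx l 0 + (if s then zx z else - zx z)) t.
  rewrite (_ : wtau _ _ = wt R l); last first.
    rewrite /wtau /wt; congr (_ + _); apply: eq_bigr => j _; congr (`|_%:~R|).
    by rewrite addE row_mxEl; case: s; rewrite ?oppE row_mxEl mxE ?oppr0 addr0.
  rewrite (_ : wxi _ _ = wxi R (zx z))// /wxi /xi; congr (_ + _).
  rewrite addE row_mxEr mxE add0r.
  by case: s; rewrite ?oppE// intrN normrN.
rewrite E normrM ger0_norm ?invr_ge0//.
have := W true (th' + th); have := W false (th' - th).
have := ler_normD (v (wave (row_mx l 0 + zx z) (th' + th))) (v (wave (row_mx l 0 - zx z) (th' - th))).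
have w0 : 0 <= wt R l ^+ m by rewrite exprn_ge0// ltW// wt_gt0.
move=> /(ler_wpM2r w0) => H1 H2 H3; rewrite mulrDl in H1; rewrite -mulrA.
by have := le_trans H1 (lerD H3 H2); lra.
Qed.

(** [p] and [q] are the coefficients against [cos (z x)] and [sin (z x)], so [p - i q] is the
    partial Fourier coefficient [u_z]. *)
Lemma slice_density z : exists p q, [/\ sp p, sp q,
  forall g, sp g -> vcoef g (zx z) 0 = Tn (fun t => p t * g t) &
  forall g, sp g -> vcoef g (zx z) (- (pi / 2)) = Tn (fun t => q t * g t)].
Proof.
have [p sp_ Ep] := rapid_rsmooth (slice_rdist (zx z) 0) (@slice_rapid z 0).
have [q sq Eq] := rapid_rsmooth (slice_rdist (zx z) (- (pi / 2))) (@slice_rapid z (- (pi / 2))).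
by exists p, q.
Qed.

Lemma coef_pihalf g k : sp g -> vcoef g k (0 + pi / 2) = - vcoef g k (- (pi / 2)).
Proof.
move=> sg; rewrite /coef -(linN dv.1 (pwave_sp k (- (pi / 2)) sg)); congr v.
by apply/funext => x; rewrite -pwave_shift addNr.
Qed.

Lemma tube_deriv_pihalf j g k : sp g ->
  v (tube_deriv j (a j) (pwave g k (0 + pi / 2))) =
  - v (tube_deriv j (a j) (pwave g k (- (pi / 2)))).
Proof.
move=> sg; have s1 := pwave_sp k (- (pi / 2)) sg.
have sd := tube_deriv_sp j (sa j) s1; have s0 := @sp_cst R (n + 1) 0.
rewrite -(linN dv.1 sd); congr v.
rewrite (_ : pwave g k (0 + pi / 2) = fun x => -1 * pwave g k (- (pi / 2)) x + 0); last first.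
  by apply/funext => x; rewrite -[X in pwave _ _ (X + _)](addNr (pi / 2)) pwave_shift mulN1r addr0.
rewrite (tube_deriv_lin j (a j) _ s1 s0); apply/funext => x.
by rewrite /tube_deriv !partial_cst mulr0 !addr0 mulN1r.
Qed.

Local Opaque partial tube_deriv pwave torus_integral.

(** The equation is tested on [p cos (z x) + q sin (z x)], that is on the slice itself, which is
    admissible because [p] and [q] are smooth; integration by parts completes the squares. *)
Lemma energy_identity z p q : sp p -> sp q ->
  (forall g, sp g -> vcoef g (zx z) 0 = Tn (fun t => p t * g t)) ->
  (forall g, sp g -> vcoef g (zx z) (- (pi / 2)) = Tn (fun t => q t * g t)) ->
  Tn (energy a z%:~R p q) = - (T1 (fun x => f x * pwave p (zx z) 0 x)
                              + T1 (fun x => f x * pwave q (zx z) (- (pi / 2)) x)).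
Proof.
move=> s1 s2 Ep Eq; have lv := dv.1.
have sw1 := pwave_sp (zx z) 0 s1; have sw2 := pwave_sp (zx z) (- (pi / 2)) s2.
have d j phi : sp1 phi -> sp1 (tube_deriv j (a j) phi) by exact: tube_deriv_sp.
have S phi : sp1 phi -> v (sq_sum a phi) = \sum_j v (tube_deriv j (a j) (tube_deriv j (a j) phi)).
  by move=> sphi; exact: (lin_sum _ lv (fun j => d j _ (d j _ sphi))).
have V1 := etrans (esym (vf sw1)) (S _ sw1); have V2 := etrans (esym (vf sw2)) (S _ sw2).
apply: (etrans _ (esym (congr2 (fun x y : R => - (x + y)) V1 V2))) => {S V1 V2}.
rewrite /energy T_sum; last by move=> j _; apply: dens_sp; [exact: mag_re_sp|exact: mag_im_sp].
rewrite -big_split -sumrN; apply: eq_bigr => j _.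
have DC g : sp g -> v (tube_deriv j (a j) (pwave g (zx z) 0)) =
    - Tn (fun t => partial j p t * g t) - z%:~R * Tn (fun t => q t * (a j t * g t)).
  move=> sg; have sag := spM (sa j) sg; rewrite (v_tube_deriv_pwave sa dv j _ _ sg) tau_zx xi_zx.
  rewrite mul0r addr0 (Ep _ (sp_partial j sg)) (coef_pihalf _ sag) (Eq _ sag) mulrN.
  by congr (_ - _); exact: T_parts.
have DS g : sp g -> v (tube_deriv j (a j) (pwave g (zx z) (- (pi / 2)))) =
    - Tn (fun t => partial j q t * g t) + z%:~R * Tn (fun t => p t * (a j t * g t)).
  move=> sg; have sag := spM (sa j) sg; rewrite (v_tube_deriv_pwave sa dv j _ _ sg) tau_zx xi_zx.
  rewrite mul0r addr0 (Eq _ (sp_partial j sg)) addNr (Ep _ sag).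
  by congr (_ + _); exact: T_parts.
have p1 := sp_partial j s1; have q1 := sp_partial j s2.
have ap := spM (sa j) s1; have aq := spM (sa j) s2.
have ap1 := spM (sa j) p1; have aq1 := spM (sa j) q1.
have W1 := v_tube_deriv2_pwave sa dv j (zx z) 0 s1.
have W2 := v_tube_deriv2_pwave sa dv j (zx z) (- (pi / 2)) s2.
rewrite tau_zx xi_zx mul0r addr0 (tube_deriv_pihalf j (zx z) ap) (DC _ p1) (DS _ ap) in W1.
rewrite tau_zx xi_zx mul0r addr0 addNr (DS _ q1) (DC _ aq) in W2.
apply: (etrans _ (esym (congr2 (fun x y : R => - (x + y)) W1 W2))) => {W1 W2 DC DS}.
pose A2 t := q t * (a j t * partial j p t); pose A5 t := p t * (a j t * partial j q t).
have sA2 : sp A2 by exact: spM. have sA5 : sp A5 by exact: spM.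
have E2 : Tn (fun t => partial j p t * (a j t * q t)) = Tn A2.
  by congr Tn; apply/funext => t; rewrite /A2 mulrC -!mulrA mulrCA; congr (_ * _); rewrite mulrC.
have E5 : Tn (fun t => partial j q t * (a j t * p t)) = Tn A5.
  by congr Tn; apply/funext => t; rewrite /A5 mulrC -!mulrA mulrCA; congr (_ * _); rewrite mulrC.
have sA1 := spM p1 p1; have sA4 := spM q1 q1.
have sA3 := spM s2 (spM (sa j) aq); have sA6 := spM s1 (spM (sa j) ap).
have -> : dens (mag_re a j z%:~R p q) (mag_im a j z%:~R p q) = fun t =>
   partial j p t * partial j p t + (partial j q t * partial j q t +
   (2 * z%:~R * A2 t + (- (2 * z%:~R) * A5 t + (z%:~R ^+ 2 * (q t * (a j t * (a j t * q t))) +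
   z%:~R ^+ 2 * (p t * (a j t * (a j t * p t))))))).
  apply/funext => t; rewrite /dens /mag_re /mag_im /A2 /A5.
  move: (partial j p t) (partial j q t) => *; ring.
have D1 := TD sA1 (spD sA4 (spD (spZ _ sA2) (spD (spZ _ sA5) (spD (spZ _ sA3) (spZ _ sA6))))).
have D2 := TD sA4 (spD (spZ _ sA2) (spD (spZ _ sA5) (spD (spZ _ sA3) (spZ _ sA6)))).
have D3 := TD (spZ _ sA2) (spD (spZ _ sA5) (spD (spZ _ sA3) (spZ _ sA6))).
have D4 := TD (spZ _ sA5) (spD (spZ _ sA3) (spZ _ sA6)).
have D5 := TD (spZ _ sA3) (spZ _ sA6).
apply: (etrans (D1 _ _ _ _)); rewrite D2 D3 D4 D5 (TZ _ sA2) (TZ _ sA5) (TZ _ sA3) (TZ _ sA6).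
rewrite -E2 -E5 /A2 /A5.
move: (Tn _) (Tn _) (Tn _) (Tn _) (Tn _) (Tn _) => *; ring.
Qed.

Local Transparent partial tube_deriv pwave torus_integral.
Hypothesis ncl : ~ closed_form a.

Lemma intr_norm_ge1 z : z != 0 -> 1 <= `|z%:~R| :> R.
Proof. by move=> z0; rewrite -intr_norm ler1z; lia. Qed.

Lemma T_young p (l : 'rV[int]_n) th (d : R) : sp p -> 0 < d ->
  `|Tn (fun t => p t * wave l th t)| <= d * Tn (fun t => p t * p t) + (2 * pi) ^+ n / d.
Proof.
move=> s1 d0; have s2 := spM s1 s1; have s3 := spM s1 (wave_sp l th).
have sG := spD (spZ d s2) (sp_cst n d^-1).
have TG : Tn (fun t => d * (p t * p t) + d^-1) = d * Tn (fun t => p t * p t) + (2 * pi) ^+ n / d.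
  by rewrite (TD (spZ d s2) (sp_cst n d^-1)) (TZ _ s2) T_cst [d^-1 * _]mulrC.
have FG t : `|p t * wave l th t| <= d * (p t * p t) + d^-1.
  rewrite normrM (@le_trans _ _ `|p t|)//; first by rewrite ler_piMr// wave_le1.
  exact: norm_le_young.
by rewrite -TG; exact: T_norm_le s3 sG FG.
Qed.

(** The mass is quadratic in [u_z], hence the weight appears twice. Coercivity, the energy identity
    and the decay of [f] bound the mass by a multiple of itself plus a decaying term. *)
Lemma density_decay (M : nat) : exists K : R, forall z p q, z != 0 -> sp p -> sp q ->
  (forall g, sp g -> vcoef g (zx z) 0 = Tn (fun t => p t * g t)) ->
  (forall g, sp g -> vcoef g (zx z) (- (pi / 2)) = Tn (fun t => q t * g t)) ->
  `|z%:~R| ^+ M * (`|z%:~R| ^+ M * Tn (dens p q)) <= K.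
Proof.
have [C C0 HC] := magnetic_coercive sa ncl; have [B B0 HB] := xi_decay M sf.
exists (8 * (C * B) ^+ 2) => z p q z0 s1 s2 Ep Eq.
have z1 := intr_norm_ge1 z0.
have EI := energy_identity s1 s2 Ep Eq.
have H1 := HC z%:~R p q z1 s1 s2.
pose Z : R := `|z%:~R| ^+ M; have Z0 : 0 < Z by rewrite exprn_gt0// (lt_le_trans ltr01).
have CB0 : 0 < C * B by exact: mulr_gt0.
(* The mass on the right then has factor [Z / 2] and is absorbed; what is left is a multiple of
   [d^-1], of order [1 / Z]. *)
pose d := Z / (2 * (C * B)); have d0 : 0 < d by rewrite divr_gt0// mulr_gt0.
have H2 := HB p z 0 d s1 d0; have H3 := HB q z (- (pi / 2)) d s2 d0.
have TE : Tn (dens p q) = Tn (fun t => p t * p t) + Tn (fun t => q t * q t).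
  by rewrite -(TD (spM s1 s1) (spM s2 s2)).
have H4 : Z * Tn (energy a z%:~R p q) <= B * (d * Tn (dens p q) + (d^-1 + d^-1)).
  rewrite EI TE; move: H2 H3; rewrite -/Z.
  move: (T1 _) (T1 _) (Tn _) (Tn _) => u2 u1 t2 t1 H2 H3.
  have := ler_norm (- (u1 + u2)); rewrite normrN => /le_trans /(_ (ler_normD _ _)).
  move=> /(ler_wpM2l (ltW Z0)) H5; rewrite (le_trans H5)// mulrDr.
  by rewrite (le_trans (lerD H2 H3))//; lra.
rewrite -/Z; move: H1 H4; move: (Tn (dens p q)) (Tn (energy _ _ _ _)) => E S H1 H4.
have H5 : Z * E <= C * (B * (d * E + (d^-1 + d^-1))).
  by rewrite (le_trans (ler_wpM2l (ltW Z0) H1))// mulrCA ler_wpM2l// ltW.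
have H6 : C * (B * (d * E + (d^-1 + d^-1))) = 2^-1 * (Z * E) + 4 * (C * B) ^+ 2 / Z.
  by rewrite /d; field; rewrite !gt_eqF.
rewrite H6 in H5.
have H7 : Z * E <= 8 * (C * B) ^+ 2 / Z.
  by rewrite (_ : 8 * _ / Z = 2 * (4 * (C * B) ^+ 2 / Z)); [lra|ring].
by rewrite mulrC -ler_pdivlMr.
Qed.

Lemma v_wave_normal (M : nat) : exists K : R, 0 <= K /\ forall k th, k 0 (xdir n) != 0 ->
  `|xi R k| ^+ M * `|v (wave k th)| <= K.
Proof.
have [K HK] := density_decay M.
exists (`|K| + (2 * pi) ^+ n + (2 * pi) ^+ n); split.
  by rewrite !addr_ge0// exprn_ge0// ltW// twopi_gt0.
move=> k th k0; set z := k 0 (xdir n) in k0 *; pose l := lsubmx k.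
have [p [q [s1 s2 Ep Eq]]] := slice_density z.
have sw t := @wave_sp R n l t.
(* The addition formula separates [t] from [x], so that [v] on a wave is read off from the densities
   [p] and [q]. *)
have E : wave k th = fun x => pwave (wave l th) (zx z) 0 x
    - pwave (wave l (th - pi / 2)) (zx z) (- (pi / 2)) x.
  apply/funext => x.
  have ek : dotz k x = dotz (row_mx l 0) x + dotz (zx z) x by rewrite {1}(zx_split k) dotzDl.
  rewrite /pwave !pull_wave /wave ek; move: (dotz (row_mx l 0) x) (dotz (zx z) x) => A B.
  by rewrite (addrAC A) (cosD (A + th)) (addrA A th) (cosBpihalf (A + th)) (cosBpihalf B) (addr0 B).
rewrite E (linB dv.1 (pwave_sp _ _ (sw _)) (pwave_sp _ _ (sw _))).
have -> : v (pwave (wave l th) (zx z) 0) = Tn (fun t => p t * wave l th t) by exact: Ep.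
have -> : v (pwave (wave l (th - pi / 2)) (zx z) (- (pi / 2))) =
    Tn (fun t => q t * wave l (th - pi / 2) t) by exact: Eq.
pose Z : R := `|z%:~R| ^+ M; rewrite -[`|xi R k| ^+ M]/Z.
have Z0 : 0 < Z by rewrite exprn_gt0// (lt_le_trans ltr01)// intr_norm_ge1.
have H1 := T_young l th s1 Z0; have H2 := T_young l (th - pi / 2) s2 Z0.
have H3 := HK z p q k0 s1 s2 Ep Eq.
have TE : Tn (dens p q) = Tn (fun t => p t * p t) + Tn (fun t => q t * q t).
  by rewrite -(TD (spM s1 s1) (spM s2 s2)).
rewrite TE -/Z in H3.
move: (Tn (fun t => p t * p t)) (Tn (fun t => q t * q t)) H3 H1 H2 => t1 t2 H3.
move: (Tn _) (Tn _) => u1 u2 H1 H2.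
rewrite (le_trans (ler_wpM2l (ltW Z0) (ler_normB _ _)))//.
have := ler_wpM2l (ltW Z0) (lerD H1 H2).
rewrite (_ : Z * (Z * t1 + _ + (_ + _)) = Z * (Z * (t1 + t2)) + ((2 * pi) ^+ n + (2 * pi) ^+ n)); last first.
  by field; rewrite gt_eqF.
have := ler_norm K; lra.
Qed.

(** With [u = |v (wave k th)|], the square of [u * wtau^m * wxi^m] factors into [u * wtau^(2m)],
    which is [O(wxi^M2)], and [u * wxi^(2m)], whose decay in [xi] repays that loss. *)
Theorem not_closed_rsmooth : rsmooth v.
Proof.
apply: rapid_rsmooth dv _ => m.
have [C1 [M1 [C10 H1]]] := v_wave_tangential sa dv sf vf m.
have [C2 [M2 [C20 H2]]] := v_wave_tangential sa dv sf vf (2 * m).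
(* The order of decay is chosen after the loss [M2] of the tangential estimate is known. *)
have [K [K0 HK]] := v_wave_normal (M2 + 2 * m).
exists (C1 + (1 + C2 * 2 ^+ (M2 + 2 * m) * K)) => k th.
have w0 := wtau_ge0 R k; have x0 := wxi_ge0 R k.
have wk : wt R k ^+ m <= wtau R k ^+ m * wxi R k ^+ m.
  by rewrite -exprMn lerXn2r ?nnegrE ?mulr_ge0 ?wt_le// ltW// wt_gt0.
apply: (le_trans (ler_wpM2l (normr_ge0 _) wk)).
have c0 : 0 <= C2 * 2 ^+ (M2 + 2 * m) * K by rewrite !mulr_ge0// exprn_ge0.
(* Coercivity says nothing about [xi = 0], but there the loss [wxi] equals 1 and the tangential
   decay suffices. *)
have [k0|k0] := eqVneq (k 0 (xdir n)) 0.
  have x1 : wxi R k = 1 by rewrite /wxi /xi k0 normr0 addr0.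
  have := H1 k th; rewrite x1 !expr1n !mulr1 => H; rewrite (le_trans H)// lerDl.
  by rewrite addr_ge0.
set u := `|v (wave k th)|; set y := u * _.
have u0 : 0 <= u by exact: normr_ge0.
suff H : y ^+ 2 <= C2 * 2 ^+ (M2 + 2 * m) * K.
  have : 0 <= (y - 1) ^+ 2 by exact: sqr_ge0.
  by move: H C10 c0; move: (C2 * _ * K) => c; nra.
have -> : y ^+ 2 = (u * wtau R k ^+ (2 * m)) * (u * wxi R k ^+ (2 * m)).
  by rewrite /y mulnC !exprM; ring.
apply: (le_trans (ler_wpM2r _ (H2 k th))); first by rewrite mulr_ge0// exprn_ge0.
rewrite [leLHS](_ : _ = C2 * (wxi R k ^+ (M2 + 2 * m) * u)); last by rewrite exprD; ring.
rewrite -[leRHS]mulrA ler_wpM2l//.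
have xk : wxi R k <= 2 * `|xi R k| by rewrite /wxi; have := intr_norm_ge1 k0; rewrite /xi; lra.
apply: (@le_trans _ _ ((2 * `|xi R k|) ^+ (M2 + 2 * m) * u)).
  by rewrite ler_wpM2r// lerXn2r ?nnegrE// mulr_ge0.
by rewrite exprMn -mulrA ler_wpM2l ?exprn_ge0// HK.
Qed.

End NotClosed.

(** * Closed coefficients *)

Section ClosedCase.
Variables (R : realType) (n : nat).
Implicit Types (k : 'rV[int]_(n + 1)) (j : 'I_n) (th : R) (c : 'I_n -> R).
Implicit Types (phi psi f : 'rV[R]_(n + 1) -> R) (A : 'rV[R]_n -> R).
Implicit Types (a : 'I_n -> 'rV[R]_n -> R) (u v : ('rV[R]_(n + 1) -> R) -> R).

Local Notation sp1 := (@smooth_torus R (n + 1)).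
Local Notation sp := (@smooth_torus R n).
Local Notation T1 := (@torus_integral R (n + 1)).

Lemma rsmoothN u : linear_form u -> forall (L : ('rV[R]_(n + 1) -> R) -> 'rV[R]_(n + 1) -> R),
  (forall phi, sp1 phi -> sp1 (L phi)) ->
  rsmooth (fun phi => u (fun p => - L phi p)) <-> rsmooth (fun phi => u (L phi)).
Proof.
move=> lu L sL; split=> -[f sf H]; exists (fun p => - f p); try exact: spN; move=> phi s.
  rewrite -[LHS]opprK -(linN lu (sL _ s)) (H _ s) -(TN (spM sf s)).
  by congr T1; apply/funext => p; rewrite mulNr.
rewrite (linN lu (sL _ s)) (H _ s) -(TN (spM sf s)).
by congr T1; apply/funext => p; rewrite mulNr.
Qed.

Lemma T_shear_adj A f phi : sp A -> sp1 f -> sp1 phi ->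
  T1 (fun p => f p * shear A phi p) = T1 (fun p => shear (fun t => - A t) f p * phi p).
Proof.
move=> sA s1 s2; by rewrite -(T_shear (spN sA) (spM s1 (shear_sp sA s2))) shearM shearK.
Qed.

Lemma T_shear_adjV A f phi : sp A -> sp1 f -> sp1 phi ->
  T1 (fun p => f p * shear (fun t => - A t) phi p) = T1 (fun p => shear A f p * phi p).
Proof. by move=> sA s1 s2; rewrite -(T_shear sA (spM s1 (shear_sp (spN sA) s2))) shearM shearKV. Qed.

Lemma rsmooth_shear A v : sp A -> rsmooth (fun phi => v (shear A phi)) -> rsmooth v.
Proof.
move=> sA [f sf vf]; have sN := spN sA; exists (shear A f) => [|phi s]; first exact: shear_sp.
rewrite -{1}[phi](shearKV A) (vf _ (shear_sp sN s)).
exact: T_shear_adjV.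
Qed.

Lemma sq_sum_shear a A phi : (forall j, sp (a j)) -> sp A -> sp1 phi ->
  sq_sum a (shear A phi) = shear A (sq_sum (fun j t => a j t + partial j A t) phi).
Proof.
move=> sa sA s; apply/funext => p; rewrite /sq_sum [RHS]/shear; apply: eq_bigr => j _.
have sb := spD (sa j) (sp_partial j sA).
by rewrite (tube_deriv_shear j (a j) sA s) (tube_deriv_shear j (a j) sA (tube_deriv_sp j sb s)).
Qed.

(** If [g j] is the density of [v] composed with the field, skew-symmetry of the field lets it act
    once more on [g j]. *)
Lemma sq_sum_rsmooth a v : (forall j, sp (a j)) -> linear_form v ->
  (forall j, rsmooth (fun phi => v (tube_deriv j (a j) phi))) ->
  rsmooth (fun phi => v (sq_sum a phi)).
Proof.
move=> sa lv H.
have {}H j : exists g, sp1 g /\ forall phi, sp1 phi -> v (tube_deriv j (a j) phi) = T1 (fun p => g p * phi p).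
  by have [g sg E] := H j; exists g.
have [g Hg] := choice H.
have sD j phi : sp1 phi -> sp1 (tube_deriv j (a j) phi) by exact: tube_deriv_sp.
exists (fun p => \sum_j - tube_deriv j (a j) (g j) p) => [|phi s].
  by apply: sp_sum => j _; apply/spN/sD; case: (Hg j).
have -> : (fun p => (\sum_j - tube_deriv j (a j) (g j) p) * phi p) =
    fun p => \sum_j - (tube_deriv j (a j) (g j) p * phi p).
  by apply/funext => p; rewrite mulr_suml; apply: eq_bigr => j _; rewrite mulNr.
rewrite T_sum => [|j _]; last by apply: spN; apply: spM => //; apply: sD; case: (Hg j).
have sDD j : sp1 (tube_deriv j (a j) (tube_deriv j (a j) phi)) by exact/sD/sD.
rewrite /sq_sum (lin_sum (index_enum _) lv sDD).
apply: eq_bigr => j _; have [sg E] := Hg j.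
rewrite (E _ (sD j _ s)) (tube_deriv_skew j (sa j) sg s) TN//.
exact: (spM (sD j _ sg) s).
Qed.

Lemma tube_deriv_wave j (b : R) k th : tube_deriv j (fun=> b) (wave k th) =
  fun p => (tau R k j + b * xi R k) * wave k (th + pi / 2) p.
Proof.
by apply/funext => p; rewrite /tube_deriv !partial_wave mulrA -mulrDl.
Qed.

Lemma sq_sum_wave c k th : sq_sum (fun j _ => c j) (wave k th) =
  fun p => - (\sum_j (tau R k j + c j * xi R k) ^+ 2) * wave k th p.
Proof.
apply/funext => p; rewrite /sq_sum -sumrN mulr_suml; apply: eq_bigr => j _.
rewrite (tube_deriv_wave j (c j) k th).
have s1 := wave_sp k (th + pi / 2); have s0 := sp_cst (n + 1) (0 : R).
have := tube_deriv_lin j (fun=> c j) (tau R k j + c j * xi R k) s1 s0.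
under [X in tube_deriv _ _ X]eq_fun do rewrite addr0.
move=> ->; rewrite (tube_deriv_wave j (c j)) /tube_deriv !partial_cst.
rewrite !(mulr0, addr0) mulrA -expr2 mulNr -mulrN; congr (_ * _).
by rewrite /wave !addrA cosDpihalf -[_ + _ + pi / 2]addrA; rewrite addrA sinDpihalf.
Qed.

Lemma tube_deriv_rdist j (b : R) u : rdist u -> rdist (fun phi => u (tube_deriv j (fun=> b) phi)).
Proof.
move=> [lu [C [m [C0 uC]]]]; have sb := sp_cst n b; split=> [c phi psi s1 s2|].
  rewrite (tube_deriv_lin j _ c s1 s2) lu//; exact: tube_deriv_sp.
exists (C * (1 + `|b|)), m.+1; split=> [|phi M s H]; first by rewrite mulr_ge0// addr_ge0.
rewrite -mulrA; apply: uC; first exact: tube_deriv_sp.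
have [_ H1] := (Cm_leS _ _ _).1 H.
have s1 i := sp_partial i s; move=> q x qm.
rewrite (_ : tube_deriv _ _ _ = fun p => partial (lshift 1 j) phi p + b * partial (xdir n) phi p)//.
rewrite (partialsD q (s1 _) (spZ b (s1 _))) (partialsZ q b (s1 _)).
rewrite (le_trans (ler_normD _ _))// normrM mulrDl mul1r lerD ?H1//.
by rewrite ler_wpM2l// H1.
Qed.

(* The square of [|symbol of D_j| * |u (wave k th)|] is the product of the rapidly decreasing
   [|symbol of D_j| ^ 2 * |u (wave k th)|] and the polynomially bounded [|u (wave k th)|]. *)
Lemma const_deriv_rapid c u f j : rdist u -> sp1 f ->
  (forall phi, sp1 phi -> u (sq_sum (fun j _ => c j) phi) = T1 (fun p => f p * phi p)) ->
  rapid (fun phi => u (tube_deriv j (fun=> c j) phi)).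
Proof.
(* [2 * m] because the estimate is made for a square, [m0] to offset the polynomial growth of [u] on
   waves. *)
move=> [lu [C [m0 [C0 uC]]]] sf uf m; have [D HD] := T_rapid sf (2 * m + m0).
have D0 : 0 <= D.
  by rewrite (le_trans _ (HD 0 0))// mulr_ge0// exprn_ge0// ltW// wt_gt0.
exists (1 + D * C) => k th; rewrite tube_deriv_wave (linZ _ lu (wave_sp _ _)) normrM.
set th' := th + pi / 2; set l := tau R k j + _; set U := `|u (wave k th')|.
have sw := @wave_sp R _ k th'.
have w0 := @wt_gt0 R _ k; have U0 : 0 <= U by exact: normr_ge0.
have HU : U <= C * wt R k ^+ m0 by apply: uC => // s x; exact: partials_wave_le.
have H2 : l ^+ 2 * U * wt R k ^+ (2 * m + m0) <= D.
  apply: le_trans (HD k th'); rewrite ler_wpM2r ?exprn_ge0 ?(ltW w0)//.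
  rewrite -(uf _ sw) sq_sum_wave (linZ _ lu sw) normrM (ler_wpM2r U0)// normrN ger0_norm.
    by rewrite (bigD1 j)//= lerDl sumr_ge0// => i _; rewrite sqr_ge0.
  by rewrite sumr_ge0// => i _; rewrite sqr_ge0.
set y := `|l| * U * _.
suff H : y ^+ 2 <= D * C.
  have y2 := sqr_ge0 (y - 1); have := mulr_ge0 D0 C0.
  by move: H y2; move: (D * C) y => d z; nra.
have W0 : 0 < wt R k ^+ m0 by exact: exprn_gt0.
rewrite -(ler_pM2r W0) -[leRHS]mulrA; apply: le_trans (ler_wpM2l D0 HU).
apply: le_trans (ler_wpM2r U0 H2).
rewrite [leLHS](_ : _ = l ^+ 2 * U * wt R k ^+ (2 * m + m0) * U)//.
by rewrite /y exprD mulnC exprM -(real_normK (num_real l)); ring.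
Qed.

Section Hypoellipticity.
Variables (a : 'I_n -> 'rV[R]_n -> R) (A : 'rV[R]_n -> R) (c : 'I_n -> R).
Hypotheses (sa : forall j, sp (a j)) (sA : sp A).
Hypothesis aE : forall j t, a j t = c j + partial j A t.

Definition const_fields : set (('rV[R]_(n + 1) -> R) -> 'rV[R]_(n + 1) -> R) :=
  [set L | exists j, L = fun phi p => - tube_deriv j (fun=> c j) phi p].

(** [v] composed with the shear by [- A] solves the constant-coefficient equation with right-hand
    side [shear A f], and shearing back preserves smoothness. *)
Lemma closed_sq_sum_hypoelliptic :
  real_hypoelliptic const_fields -> real_hypoelliptic [set sq_sum a].
Proof.
move=> H v dv vs; have [f sf vf] := vs _ erefl; have sN := spN sA.
apply: (rsmooth_shear sN); have du := shear_rdist sN dv; apply: (H _ du).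
move=> _ [j ->]; apply/(rsmoothN du.1 (L := tube_deriv j (fun=> c j))).
  by move=> phi; apply: tube_deriv_sp; exact: sp_cst.
apply: (rapid_rsmooth (tube_deriv_rdist j (c j) du)).
have sF := shear_sp sA sf.
apply: (const_deriv_rapid j du sF) => phi s.
have E : (fun (j : 'I_n) (_ : 'rV[R]_n) => c j) = fun j t => a j t + partial j (fun t => - A t) t.
  by apply/funext => i; apply/funext => t; rewrite (partialN i sA) aE addrK.
rewrite E -(sq_sum_shear sa sN s) (vf _ (shear_sp sN s)).
exact: T_shear_adjV.
Qed.

Lemma closed_fields_hypoelliptic :
  real_hypoelliptic [set sq_sum a] -> real_hypoelliptic const_fields.
Proof.
move=> H u du us; apply: (rsmooth_shear sA); have dv := shear_rdist sA du.
apply: (H _ dv) => _ ->; apply: (sq_sum_rsmooth sa dv.1) => j.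
have [|f sf uf] := (rsmoothN du.1 (L := tube_deriv j (fun=> c j)) _).1 (us _ (ex_intro _ j erefl)).
  by move=> phi; apply: tube_deriv_sp; exact: sp_cst.
exists (shear (fun t => - A t) f) => [|phi s]; first exact: shear_sp (spN sA) sf.
rewrite -(T_shear_adj sA sf s) -(uf _ (shear_sp sA s)) (tube_deriv_shear j _ sA s).
by congr (u (shear A (tube_deriv j _ phi))); apply/funext => t; rewrite aE.
Qed.

End Hypoellipticity.

End ClosedCase.

Theorem theorem1p4 (R : realType) (n : nat) (hn : (0 < n)%N)
    (a : 'I_n -> 'rV[R]_n -> R) (ha : forall j, smooth_torus (a j)) :
  globally_hypoelliptic [set sum_squares a] <->
  globally_hypoelliptic (averaged_system a) \/ exists t, finite_type a t.
Proof.
have tP := sum_squares_transposes ha.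
have P_real : globally_hypoelliptic [set sum_squares a] <-> real_hypoelliptic [set sq_sum a].
  by apply: hypoelliptic_realP => _ ->; [exists (sq_sum a)|exists (sum_squares a)].
have [cl|ncl] := pselect (closed_form a); last first.
  split=> [_|_]; first by right; apply/(finite_typeP ha).
  apply/P_real => v dv vs; have [f sf vf] := vs _ erefl.
  exact: (not_closed_rsmooth ha dv sf vf ncl).
have [A [c [sA aE cE]]] := closed_exact ha cl.
have tX j t := vf_op_transposes j (sp_cst n (average j (a j) t)).
(* The averages are constant in the closed case, so the fields for different [t] coincide and
   [t = 0] may represent them. *)
have X_real : globally_hypoelliptic (averaged_system a) <-> real_hypoelliptic (const_fields c).
  apply: hypoelliptic_realP => [_ [j [t ->]]|_ [j ->]].
    by exists (fun f p => - tube_deriv j (fun=> c j) f p); [exists j|rewrite -(cE j t)].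
  by exists (vf_op (tube_field j (fun=> average j (a j) 0))); [exists j, 0|rewrite -(cE j 0)].
split=> [/P_real PH|[/X_real XH|/(finite_typeP ha)//]].
  by left; apply/X_real; exact: (closed_fields_hypoelliptic ha sA aE).
by apply/P_real; exact: (closed_sq_sum_hypoelliptic ha sA aE).
Qed.
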